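(* Let $q\in[0,2)$, $\beta>2$, $\delta\in(0,1)$. There exists a sufficiently large constant $C_0$ such that the following holds. Suppose $\lambda\ge C_0$, and \[ \lambda\ge C_0\sqrt{\frac{\log n}{n}},\quad nh(\lambda)\ge C_0k^*_q\Bigl(r+\log\frac{\mathrm{e}p}{k^*_q}\Bigr),\quad n\ge C_0\Bigl(k^*_q\log\frac{\mathrm{e}p}{k^*_q}\vee\log\lambda\Bigr). \] Suppose the initial estimator $\mathbf{V}^0\in O(p,r)$ is a measurable function of $\mathbf{X}^0$ and, uniformly over $\boldsymbol{\Sigma}\in\Theta_q(s,p,r,\lambda)$, satisfies $|\operatorname{supp}(\mathbf{V}^0)|\le k^*_q$ and $\sigma_r(\mathbf{V}'\mathbf{V}^0)\ge1/2$ with probability at least $1-C'/(nh(\lambda))$ for some constant $C'$. Then the estimator $\widehat{\mathbf{V}}$ produced by the reduction scheme satisfies \[ \sup_{\boldsymbol{\Sigma}\in\Theta_q(s,p,r,\lambda)}\mathsf{E}\bigl\|\widehat{\mathbf{V}}\widehat{\mathbf{V}}'-\mathbf{V}\mathbf{V}'\bigr\|_{\mathrm F}^2\le 2\bigl(r\wedge(p-r)\bigr)\wedge C\Psi(k^*_q,p,r,n,\lambda) \] for a constant $C>0$ depending only on $q,\beta,\delta$ (and on $\kappa$, $C'$), not on $n,p,s,r,\lambda$.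
   Context: Spiked model with $\sigma=1$: $\mathbf{X}=\mathbf{U}\mathbf{D}\mathbf{V}'+\mathbf{Z}$ ($n\times p$), $\mathbf{U}$ $n\times r$ i.i.d. $N(0,1)$, $\mathbf{D}=\operatorname{diag}(\lambda_1^{1/2},\dots,\lambda_r^{1/2})$, $\mathbf{V}\in O(p,r)=\{\mathbf{V}\in\mathbb{R}^{p\times r}:\mathbf{V}'\mathbf{V}=\mathbf{I}_r\}$, $\mathbf{Z}$ i.i.d. $N(0,1)$ independent of $\mathbf{U}$. Weak-$\ell_q$ radius $\|\mathbf{V}\|_{q,w}=\max_jj\|\mathbf{V}_{(j)*}\|^q$ over row norms sorted decreasingly (number of nonzero rows for $q=0$); fix $\kappa>1$; $\Theta_q(s,p,r,\lambda)=\{\mathbf{V}\boldsymbol{\Lambda}\mathbf{V}'+\mathbf{I}_p:\boldsymbol{\Lambda}=\operatorname{diag}(\lambda_1,\dots,\lambda_r),\ 0<\lambda\le\lambda_r\le\dots\le\lambda_1\le\kappa\lambda,\ \mathbf{V}\in O(p,r),\ \|\mathbf{V}\|_{q,w}\le s\}$. $h(\lambda)=\lambda^2/(\lambda+1)$; $\Psi(k,p,r,n,\lambda)=\frac{1}{nh(\lambda)}(rk+k\log\frac{\mathrm{e}p}{k})$; $k^*_q=\lceil x_q\rceil$, $x_q=\max\{0\le x\le p:x\le s(nh(\lambda)/(r+\log(\mathrm{e}p/x)))^{q/2}\}$. $\operatorname{supp}$ = set of nonzero rows; $\sigma_r$ = $r$-th largest singular value. Reduction scheme: (1) draw $\tilde{\mathbf{Z}}$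 ($n\times p$, i.i.d. $N(0,1)$, independent of $(\mathbf{U},\mathbf{Z})$) and set $\mathbf{X}^i=\mathbf{X}+(-1)^i\tilde{\mathbf{Z}}$, $i=0,1$. (2) Compute $\mathbf{V}^0$ from $\mathbf{X}^0$. (3) Let $\mathbf{B}=\mathbf{X}^0\mathbf{V}^0$ with thin SVD $\mathbf{B}=\mathbf{L}\mathbf{C}\mathbf{R}'$ ($\mathbf{L}\in\mathbb{R}^{n\times r}$, $\mathbf{C},\mathbf{R}\in\mathbb{R}^{r\times r}$), and set $\mathbf{Y}=\frac1{\sqrt2}(\mathbf{X}^1)'\mathbf{X}^0\mathbf{V}^0\mathbf{R}\mathbf{C}^{-1}$ (if $\mathbf{C}$ is singular, $\widehat{\mathbf{V}}$ may be arbitrary in $O(p,r)$). With $t_k=r+\sqrt{2r\beta\log\frac{\mathrm{e}p}{k}}+\beta\log\frac{\mathrm{e}p}{k}$, $\operatorname{pen}(k)=(1+\delta)^2\sum_{i=1}^kt_i$, $\operatorname{pen}(\boldsymbol{\Theta})=\operatorname{pen}(|\operatorname{supp}\boldsymbol{\Theta}|)$, let $\widehat{\boldsymbol{\Theta}}=\operatorname{argmin}_{\boldsymbol{\Theta}\in\mathbb{R}^{p\times r}}\|\mathbf{Y}-\boldsymbol{\Theta}\|_{\mathrm F}^2+\operatorname{pen}(\boldsymbol{\Theta})$. (4) $\widehat{\mathbf{V}}\in O(p,r)$ is obtained by orthonormalizing the columns of $\widehat{\boldsymbol{\Theta}}$ (so $\operatorname{span}\widehat{\mathbf{V}}=\operatorname{span}\widehat{\boldsymbol{\Theta}}$;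 if $\widehat{\boldsymbol{\Theta}}$ has rank $<r$, $\widehat{\mathbf{V}}$ is any element of $O(p,r)$ whose span contains that of $\widehat{\boldsymbol{\Theta}}$). *)

(* Defs.v *)
From HB Require Import structures.
From mathcomp Require Import all_boot all_order all_algebra.
From mathcomp Require Import all_classical all_reals all_analysis.
From mathcomp Require Import normal_distribution.

Set Implicit Arguments.
Unset Strict Implicit.
Unset Printing Implicit Defensive.

Import Order.TTheory GRing.Theory Num.Theory.
Local Open Scope classical_set_scope.
Local Open Scope ring_scope.

Section SpikedDefs.
Variable R : realType.

Definition frob2 (m n : nat) (A : 'M[R]_(m, n)) : R :=
  \sum_(i < m) \sum_(j < n) (A i j) ^+ 2.

Definition rownorm (m n : nat) (A : 'M[R]_(m, n)) (i : 'I_m) : R :=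
  Num.sqrt (\sum_(j < n) (A i j) ^+ 2).

Definition orthonormal_cols (p r : nat) (V : 'M[R]_(p, r)) : Prop :=
  V^T *m V = 1%:M.

Definition supp_card (p r : nat) (A : 'M[R]_(p, r)) : nat :=
  #|[set i : 'I_p | row i A != 0]|.

Definition sorted_rownorms (p r : nat) (V : 'M[R]_(p, r)) : seq R :=
  sort (fun a b : R => b <= a) [seq rownorm V i | i <- enum 'I_p].

Definition weak_lq (q : R) (p r : nat) (V : 'M[R]_(p, r)) : R :=
  if q == 0 then (supp_card V)%:R
  else \big[Num.max/0]_(j < p)
         ((j.+1)%:R * powR (nth 0 (sorted_rownorms V) j) q).

Definition hfun (lam : R) : R := lam ^+ 2 / (lam + 1).

Definition Psi (k p r n : nat) (lam : R) : R :=
  ((r * k)%:R + k%:R * ln (expR 1 * p%:R / k%:R)) / (n%:R * hfun lam).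

Definition xq (q s : R) (p r n : nat) (lam : R) : R :=
  sup [set x : R | 0 <= x <= p%:R /\
        (x = 0 \/ x <= s * powR (n%:R * hfun lam / (r%:R + ln (expR 1 * p%:R / x))) (q / 2))].

Definition kstar (q s : R) (p r n : nat) (lam : R) : nat :=
  `|Num.ceil (xq q s p r n lam)|%N.

(** Parameter set Theta_q(s,p,r,lambda) described by (V, Lambda) with
    Sigma = V diag(lam) V' + I_p *)
Definition in_Theta (q s kappa : R) (p r : nat) (lam0 : R)
    (V : 'M[R]_(p, r)) (lam : 'I_r -> R) : Prop :=
  [/\ 0 < lam0,
      (forall i, lam0 <= lam i <= kappa * lam0),
      (forall i j : 'I_r, (i <= j)%N -> lam j <= lam i),
      orthonormal_cols V &
      weak_lq q V <= s].

Definition Dmat (r : nat) (lam : 'I_r -> R) : 'M[R]_r :=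
  diag_mx (\row_i Num.sqrt (lam i)).

Definition Xdata (n p r : nat) (V : 'M[R]_(p, r)) (lam : 'I_r -> R)
    (U : 'M[R]_(n, r)) (Z : 'M[R]_(n, p)) : 'M[R]_(n, p) :=
  U *m Dmat lam *m V^T + Z.

(** sigma_r(M) >= c for an r x r matrix M: the singular values of M are the
    square roots of the eigenvalues of M'M, so sigma_r(M) >= c (c >= 0)
    iff every eigenvalue of M'M is >= c^2. *)
Definition sigma_r_ge (r : nat) (M : 'M[R]_r) (c : R) : Prop :=
  forall a : R, eigenvalue (M^T *m M) a -> c ^+ 2 <= a.

Definition tk (r : nat) (beta : R) (p k : nat) : R :=
  r%:R + Num.sqrt (2 * r%:R * beta * ln (expR 1 * p%:R / k%:R))
       + beta * ln (expR 1 * p%:R / k%:R).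

Definition pen (r : nat) (beta delta : R) (p k : nat) : R :=
  (1 + delta) ^+ 2 * \sum_(1 <= i < k.+1) tk r beta p i.

Definition pen_crit (p r : nat) (beta delta : R) (Y Th : 'M[R]_(p, r)) : R :=
  frob2 (Y - Th) + pen r beta delta p (supp_card Th).

Definition is_pen_minimizer (p r : nat) (beta delta : R) (Y Th : 'M[R]_(p, r))
  : Prop :=
  forall Th' : 'M[R]_(p, r), pen_crit beta delta Y Th <= pen_crit beta delta Y Th'.

Definition thin_svd (n r : nat) (B : 'M[R]_(n, r)) (L : 'M[R]_(n, r))
    (C Rm : 'M[R]_r) : Prop :=
  [/\ L^T *m L = 1%:M,
      (forall i j : 'I_r, i != j -> C i j = 0),
      (forall i : 'I_r, 0 <= C i i),
      Rm^T *m Rm = 1%:M &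
      B = L *m C *m Rm^T].

(** Specification of the output of steps (3)-(4) of the reduction scheme,
    given X^0 = x0, X^1 = x1, V^0 = v0: Vh is a valid output.  Vh must be
    in O(p,r); whenever B = x0 v0 has a thin SVD with C nonsingular, Vh's
    span must contain the span of a minimizer of the penalized criterion
    for Y = (1/sqrt 2) x1' x0 v0 R C^{-1}.  (All thin SVDs of a full-rank B
    differ by an orthogonal r x r rotation of L, under which the minimizer
    set rotates and spans are unchanged, so quantifying over all SVDs is
    the same as over the one computed.) *)
Definition reduction_output (n p r : nat) (beta delta : R)
    (x0 x1 : 'M[R]_(n, p)) (v0 Vh : 'M[R]_(p, r)) : Prop :=
  orthonormal_cols Vh /\
  forall (L : 'M[R]_(n, r)) (C Rm : 'M[R]_r),
    thin_svd (x0 *m v0) L C Rm ->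
    (C \in unitmx ->
     exists Th : 'M[R]_(p, r),
       is_pen_minimizer beta delta
         ((Num.sqrt 2)^-1 *: (x1^T *m x0 *m v0 *m Rm *m invmx C)) Th /\
       (Th^T <= Vh^T)%MS).

Definition mutually_independent d (Omega : measurableType d)
    (P : probability Omega R) (I : finType) (g : I -> Omega -> R) : Prop :=
  forall (J : {set I}) (B : I -> set R),
    (forall i, measurable (B i)) ->
    P (\bigcap_(i in [set j | j \in J]) (g i @^-1` B i)) =
    (\prod_(i in J) P (g i @^-1` B i))%E.

Definition std_normal d (Omega : measurableType d)
    (P : probability Omega R) (g : Omega -> R) : Prop :=
  measurable_fun setT g /\
  forall B : set R, measurable B -> P (g @^-1` B) = normal_prob 0 1 B.

Definition gauss_entries d (Omega : measurableType d) (P : probability Omega R)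
    (n p r : nat) (U : Omega -> 'M[R]_(n, r)) (Z Zt : Omega -> 'M[R]_(n, p))
    : Prop :=
  let g : ('I_n * 'I_r) + (('I_n * 'I_p) + ('I_n * 'I_p)) -> Omega -> R :=
    fun k => match k with
             | inl ij => fun w => U w ij.1 ij.2
             | inr (inl ij) => fun w => Z w ij.1 ij.2
             | inr (inr ij) => fun w => Zt w ij.1 ij.2
             end in
  mutually_independent P g /\ (forall k, std_normal P (g k)).

End SpikedDefs.

(* Main.v *)
Require Import Defs.
From HB Require Import structures.
From mathcomp Require Import all_boot all_order all_algebra.
From mathcomp Require Import all_classical all_reals all_analysis.
From mathcomp Require Import normal_distribution measurable_realfun.
From mathcomp Require Import ring lra zify.
Set Implicit Arguments.
Unset Strict Implicit.
Unset Printing Implicit Defensive.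
Import Order.TTheory GRing.Theory Num.Theory.
Local Open Scope classical_set_scope.
Local Open Scope ring_scope.

(** The noises of the two copies of the data, [Z + Zt] and [Z - Zt], are independent Gaussian
    matrices, because rotating each pair of entries of [Z] and [Zt] preserves the Gaussian law. Let
    [L] hold the left singular vectors of [X0 V0]. The matrix of step (3) is then [Y = V A + E] with
    [A = D U^T L / sqrt 2] and [E = (Z - Zt)^T L / sqrt 2]. For fixed [U] and [Z + Zt], the matrix
    [E] is white noise with unit variances, so finding the span of [V] becomes a regression with
    sparse rows and mean [V A].

    Signal. On vectors with at most [k] nonzero coordinates, [Z] and [Zt] have operator norm at most
    of order [sqrt n] ([gaussian_opnorm_upper]), and all singular values of [U] are of that order
    ([gaussian_lower]). As [lam0] is large, the signal dominates [X0 V0], and [A A^T] is bounded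
    below by a constant times [n lam0] ([svd_coordinates]). Hence the projection loss is at most a
    constant times the squared error in estimating [V A], divided by [n lam0] ([frob2_projB_span]).

    Noise. The rows of [E] indexed by [J] form a chi-square with [|J| r] degrees of freedom, and the
    sum of the [t_i] is at least its deviation at level [(beta/2) |J| log(ep/|J|)]. Since
    [beta > 2], the union bound over all [J] converges ([sum_subsets_le]). The matrix [L] is itself
    random, so [chaos_bound] treats at once all orthonormal [L = U a1 + (Z + Zt) a2] of the right
    size where [a2] has at most [k] nonzero rows. This costs an entropy of order
    [k log(ep/k) + (r + k) r], and a net used at two scales keeps the leading constant at
    [1 + delta].

    Selection. With the penalty dominating the noise on every support, comparing the minimizer with
    the truncation of [V A] to the [k] largest rows of [V] gives [oracle_inequality]. The critical
    [k] makes the truncation error of the same order as the other terms ([weak_lq_tail]).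

    Expectation. Statements of high probability are encoded by nonnegative variables of bounded
    mean: either a deterministic bound holds where the variable is below [1], or the variable is
    added to the bound. The theorem then integrates one pointwise inequality. Off the good event the
    loss is at most [2 r], and the failure probability of order [1/(n h)] turns this into a term of
    order [r/(n h)], which is part of [Psi]. *)

(** * Integrals against densities and affine changes of variable *)

Section Density.
Context d (T : measurableType d) (R : realType).
Variables (mu nu : {measure set T -> \bar R}) (f : T -> R).
Hypothesis mf : measurable_fun setT f.
Hypothesis f0 : forall x, 0 <= f x.
Hypothesis nuE : forall A, measurable A -> nu A = (\int[mu]_(x in A) (f x)%:E)%E.
Import HBNNSimple.

(** Indicators satisfy the identity by [nuE]; linearity carries it to simple functions, and monotone
    convergence to every nonnegative measurable function. *)
Lemma ge0_integral_density (g : T -> \bar R) :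
  measurable_fun setT g -> (forall x, 0 <= g x)%E ->
  (\int[nu]_x g x = \int[mu]_x (g x * (f x)%:E))%E.
Proof.
move=> mg g0; pose h := nnsfun_approx measurableT mg.
have ind (E : set T) : measurable E ->
    (\int[nu]_x (\1_E x)%:E = \int[mu]_x ((\1_E x)%:E * (f x)%:E))%E.
  move=> mE; rewrite integral_indic// setIT nuE// integral_mkcond.
  by apply: eq_integral => x _; rewrite epatch_indic muleC.
have smp n : (\int[nu]_x (h n x)%:E = \int[mu]_x ((h n x)%:E * (f x)%:E))%E.
  under eq_integral do rewrite fimfunE -fsumEFin//.
  rewrite ge0_integral_fsum//; last 2 first.
  - by move=> r; exact/measurable_EFinP/measurableT_comp.
  - by move=> m x _; rewrite EFinM nnfun_muleindic_ge0.
  under [RHS]eq_integral => x _.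
    rewrite (fimfunE (h n) x) -fsumEFin// ge0_mule_fsuml; last first.
      by move=> y; rewrite EFinM nnfun_muleindic_ge0.
    over.
  rewrite ge0_integral_fsum//; last 2 first.
  - move=> y; apply: emeasurable_funM; last exact/measurable_EFinP.
    by apply/measurable_EFinP/measurable_funM => //.
  - by move=> m x _; rewrite mule_ge0 ?lee_fin//= -lee_fin EFinM nnfun_muleindic_ge0.
  apply: eq_fsbigr => y /[!inE] -[t _ <-].
  under eq_integral do rewrite EFinM.
  under [RHS]eq_integral do rewrite EFinM -muleA.
  rewrite ge0_integralZl//; last 2 first.
  - exact/measurable_EFinP.
  - by rewrite lee_fin.
  rewrite ge0_integralZl//; last 3 first.
  - by apply: emeasurable_funM; exact/measurable_EFinP.
  - by move=> x _; rewrite mule_ge0 ?lee_fin.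
  - by rewrite lee_fin.
  by rewrite ind.
transitivity (limn (fun n => \int[nu]_x (h n x)%:E))%E.
  rewrite -monotone_convergence//.
  - by apply: eq_integral => x _; apply/esym/cvg_lim => //; exact: cvg_nnsfun_approx.
  - by move=> n; exact/measurable_EFinP/measurable_funTS.
  - by move=> n x _; rewrite lee_fin.
  - by move=> x _ a b ab; rewrite lee_fin; exact/lefP/nd_nnsfun_approx.
under eq_fun do rewrite smp.
rewrite -monotone_convergence//.
- apply: eq_integral => x _; apply/cvg_lim => //.
  by apply: cvgeZr => //; exact: cvg_nnsfun_approx.
- by move=> n; apply: emeasurable_funM; exact/measurable_EFinP.
- by move=> n x _; rewrite mule_ge0 ?lee_fin.
- by move=> x _ a b ab; rewrite lee_wpmul2r ?lee_fin//; exact/lefP/nd_nnsfun_approx.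
Qed.

End Density.

Definition image_measure d d' (T1 : measurableType d) (T2 : measurableType d')
    (R : realType) (m : {measure set T1 -> \bar R}) (f : T1 -> T2)
    (mf : measurable_fun setT f) : {measure set T2 -> \bar R} :=
  measure_function_pushforward__canonical__measure_function_Measure m mf.

Section Lebesgue_affine.
Context {R : realType}.
Notation leb := (@lebesgue_measure R).
Variables (a b : R).
Hypothesis a0 : 0 < a.
Let phi : measurableTypeR R -> measurableTypeR R := fun x => a * x + b.
Let mphi : measurable_fun setT phi.
Proof. by apply: measurable_funD => //; exact: measurable_funM. Qed.

(** Lebesgue measure is the only measure that gives half-open intervals their length, and the
    rescaled image measure does so. *)
Lemma lebesgue_measure_affine (A : set R) : measurable A ->
  (leb A = a%:E * leb (phi @^-1` A))%E.
Proof.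
move=> mA; pose k : {nonneg R} := NngNum (ltW a0).
rewrite (@lebesgue_measure_unique R (mscale k (image_measure leb mphi)))//.
move=> _ [[x y]] _ <-; rewrite /= /mscale/= /pushforward/=.
have -> : phi @^-1` `]x, y] = `](x - b) / a, (y - b) / a]%classic.
  apply/seteqP; split => t /=; rewrite !in_itv/= /phi;
    by rewrite ltr_pdivrMr// ler_pdivlMr// mulrC ltrBlDr lerBrDr.
rewrite !lebesgue_measure_itv/= !lte_fin ltr_pM2r ?invr_gt0// ltrD2r.
case: ifPn => _; last by rewrite mule0.
by rewrite -!EFinD -EFinM; congr EFin; field; rewrite gt_eqF.
Qed.

Lemma ge0_integral_affine (f : measurableTypeR R -> \bar R) :
  measurable_fun setT f -> (forall x, 0 <= f x)%E ->
  (\int[leb]_x f x = a%:E * \int[leb]_x f (a * x + b)%R)%E.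
Proof.
move=> mf f0; pose k : {nonneg R} := NngNum (ltW a0).
rewrite (eq_measure_integral (mscale k (image_measure leb mphi))); last first.
  by move=> A mA _; exact: lebesgue_measure_affine.
by rewrite ge0_integral_mscale//= ge0_integral_pushforward.
Qed.
End Lebesgue_affine.

(** * The standard Gaussian on the line and its planar rotation *)

Section Gauss1.
Context {R : realType}.
Notation leb := (@lebesgue_measure R).
Notation Rm := (measurableTypeR R).
Notation gam := (@normal_prob R 0 1).
Notation phi := (@normal_pdf R 0 1).
Local Open Scope ereal_scope.

Lemma ge0_integral_normal (f : Rm -> \bar R) :
  measurable_fun setT f -> (forall x, 0 <= f x) ->
  \int[gam]_x f x = \int[leb]_x (f x * (phi x)%:E).
Proof.
move=> mf f0; apply: ge0_integral_density => //.
- exact: measurable_normal_pdf.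
- by move=> x; exact: normal_pdf_ge0.
Qed.

(** Completing the square turns the integrand times the standard density into a multiple of the
    normal density with mean [b / (1 - a)] and variance [1 / (1 - a)]. *)
Lemma integral_normal_expR (a b : R) : (a < 1)%R ->
  \int[gam]_t (expR (a * t ^+ 2 / 2 + b * t))%:E =
  (Num.sqrt (1 - a)^-1 * expR (b ^+ 2 / (2 * (1 - a))))%:E.
Proof.
move=> a1; have a0 : (0 < 1 - a)%R by rewrite subr_gt0.
have mexp : measurable_fun setT (fun t : Rm => expR (a * t ^+ 2 / 2 + b * t)).
  apply: measurableT_comp => //; apply: measurable_funD.
    by apply: measurable_funM => //; apply: measurable_funM => //;
      exact: measurable_funX.
  exact: measurable_funM.
rewrite ge0_integral_normal//; last exact/measurable_EFinP.
pose s := Num.sqrt (1 - a)^-1; pose m := (b / (1 - a))%R.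
have s0 : s != 0%R by rewrite gt_eqF// sqrtr_gt0 invr_gt0.
have s2 : (s ^+ 2 = (1 - a)^-1)%R by rewrite sqr_sqrtr// ltW// invr_gt0.
transitivity (\int[leb]_x ((s * expR (b ^+ 2 / (2 * (1 - a))))%:E * (normal_pdf m s x)%:E)).
  apply: eq_integral => x _; rewrite -!EFinM; congr EFin.
  rewrite !normal_pdfE ?oner_eq0// /normal_fun /normal_peak.
  have -> : Num.sqrt (s ^+ 2 * pi *+ 2) = (s * Num.sqrt (1 ^+ 2 * pi *+ 2))%R.
    rewrite expr1n mul1r -mulrnAr sqrtrM ?sqr_ge0// sqrtr_sqr ger0_norm//.
    exact: sqrtr_ge0.
  set P := Num.sqrt _.
  have P0 : P != 0%R.
    by rewrite gt_eqF// sqrtr_gt0 expr1n mul1r pmulrn_lgt0// pi_gt0.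
  have -> : (s * expR (b ^+ 2 / (2 * (1 - a))) * ((s * P)^-1 * expR (- (x - m) ^+ 2 / (s ^+ 2 *+ 2))) =
    P^-1 * (expR (b ^+ 2 / (2 * (1 - a))) * expR (- (x - m) ^+ 2 / (s ^+ 2 *+ 2))))%R.
    by field; apply/andP.
  rewrite mulrCA -!expRD; congr (_ * expR _)%R.
  rewrite s2 subr0 expr1n /m.
  by field; rewrite gt_eqF.
rewrite ge0_integralZl//; last 3 first.
- by apply/measurable_EFinP; exact: measurable_normal_pdf.
- by move=> x _; rewrite lee_fin normal_pdf_ge0.
- by rewrite lee_fin mulr_ge0 ?expR_ge0 ?sqrtr_ge0.
by rewrite integral_normal_pdf mule1.
Qed.

Lemma integral2_normal (F : Rm -> Rm -> \bar R) :
  measurable_fun setT (fun z : Rm * Rm => F z.1 z.2) -> (forall x y, 0 <= F x y) ->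
  \int[gam]_x \int[gam]_y F x y =
  \int[leb]_x \int[leb]_y (F x y * (phi x * phi y)%:E).
Proof.
move=> mF F0.
have mFx x : measurable_fun setT (F x).
  exact: (measurableT_comp mF (pair1_measurable x)).
have mphi : measurable_fun setT (fun y : Rm => (phi y)%:E).
  by apply/measurable_EFinP; exact: measurable_normal_pdf.
rewrite ge0_integral_normal.
- apply: eq_integral => x _; rewrite ge0_integral_normal//.
  rewrite -ge0_integralZr//.
  + by apply: eq_integral => y _; rewrite EFinM -muleA (muleC (phi y)%:E).
  + exact: (emeasurable_funM (mFx x) mphi).
  + by move=> y _; rewrite mule_ge0// lee_fin normal_pdf_ge0.
  + by rewrite lee_fin normal_pdf_ge0.
- exact: (measurable_fun_fubini_tonelli_F (m2 := gam) _ mF (fun z => F0 z.1 z.2)).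
- by move=> x; apply: integral_ge0.
Qed.

(** The map is orthogonal and the product density depends only on [x^2 + y^2]. The planar
    substitution is made of two affine ones: [y = sqrt 2 * u - x], then, after exchanging the
    integrals, [x = (u + v) / sqrt 2]. Their Jacobians [sqrt 2] and [1 / sqrt 2] cancel. *)
Lemma integral_normal_rotation (F : Rm -> Rm -> \bar R) :
  measurable_fun setT (fun z : Rm * Rm => F z.1 z.2) -> (forall x y, 0 <= F x y) ->
  \int[gam]_x \int[gam]_y F x y =
  \int[gam]_x \int[gam]_y F ((x + y) / Num.sqrt 2)%R ((x - y) / Num.sqrt 2)%R.
Proof.
move=> mF F0; pose s2 : R := Num.sqrt 2; pose c := (s2^-1)%R.
have s20 : (0 < s2)%R by rewrite sqrtr_gt0.
have c0 : (0 < c)%R by rewrite invr_gt0.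
have s2c : (s2 * c = 1)%R by rewrite mulfV// gt_eqF.
have s2s2 : (s2 = 2 * c)%R by rewrite -[2%R](@sqr_sqrtr R)// expr2 -mulrA s2c mulr1.
have cc : (c ^+ 2 = 2^-1)%R by rewrite exprVn sqr_sqrtr.
have m1 : measurable_fun setT (fun z : Rm * Rm => z.1) by exact: measurable_fst.
have m2 : measurable_fun setT (fun z : Rm * Rm => z.2) by exact: measurable_snd.
have mD : measurable_fun setT (fun z : Rm * Rm => (z.1 + z.2) / s2)%R.
  by apply: measurable_funM => //; exact: measurable_funD.
have mB : measurable_fun setT (fun z : Rm * Rm => (z.1 - z.2) / s2)%R.
  by apply: measurable_funM => //; exact: measurable_funB.
have mphi : measurable_fun setT phi by exact: measurable_normal_pdf.
pose H (x y : Rm) := F x y * (phi x * phi y)%:E.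
have mH : measurable_fun setT (fun z : Rm * Rm => H z.1 z.2).
  apply: emeasurable_funM => //; apply/measurable_EFinP; apply: measurable_funM.
    exact: (measurableT_comp mphi m1).
  exact: (measurableT_comp mphi m2).
have H0 x y : 0 <= H x y.
  by rewrite mule_ge0// lee_fin mulr_ge0// normal_pdf_ge0.
rewrite integral2_normal// [RHS](@integral2_normal (fun x y : Rm => F ((x + y) / s2)%R ((x - y) / s2)%R))//; last first.
  exact: (measurableT_comp mF (measurable_fun_pair mD mB)).
have step1 x : \int[leb]_y H x y = s2%:E * \int[leb]_u H x (s2 * u + - x)%R.
  rewrite (ge0_integral_affine (- x) s20)//.
  exact: (measurableT_comp mH (pair1_measurable x)).
under eq_integral do rewrite -/(H _ _) step1.
have mK : measurable_fun setT (fun z : Rm * Rm => H z.1 (s2 * z.2 + - z.1)%R).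
  apply: (measurableT_comp mH (measurable_fun_pair m1 _)).
  by apply: measurable_funD; [exact: measurable_funM|exact: measurableT_comp].
rewrite ge0_integralZl//; last 3 first.
- exact: (measurable_fun_fubini_tonelli_F (m2 := leb) _ mK (fun z => H0 _ _)).
- by move=> x _; apply: integral_ge0.
- by rewrite lee_fin ltW.
rewrite (@fubini_tonelli _ _ _ _ _ leb leb (fun z : Rm * Rm => H z.1 (s2 * z.2 + - z.1)%R))//=.
rewrite -ge0_integralZl//; last 3 first.
- exact: (measurable_fun_fubini_tonelli_G (m1 := leb) _ mK (fun z => H0 _ _)).
- by move=> x _; apply: integral_ge0.
- by rewrite lee_fin ltW.
apply: eq_integral => u _.
rewrite (ge0_integral_affine (c * u) c0)//; last first.
  exact: (measurableT_comp mK (pair2_measurable u)).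
rewrite muleA -EFinM s2c mul1e; apply: eq_integral => v _.
rewrite /H.
have -> : (c * v + c * u = (u + v) / s2)%R by rewrite /c; ring.
have -> : (s2 * u - (u + v) / s2 = (u - v) / s2)%R by rewrite -/c s2s2; ring.
congr (_ * _%:E).
rewrite !normal_pdfE ?oner_eq0// /normal_fun !subr0 mulrACA -expRD [RHS]mulrACA -expRD.
congr (_ * expR _)%R; rewrite !exprMn -/c cc.
by field.
Qed.

End Gauss1.

(** * Gaussian configurations over a finite index set *)

Definition upd (I : eqType) (T : Type) (x : I -> T) (k : I) (t : T) : I -> T :=
  fun i => if i == k then t else x i.

(** A separate name for [I -> R], on which [cfg] puts the sigma-algebra generated by boxes. *)
Definition config (R : realType) (I : finType) : Type := I -> R.

Section ConfigPointed.
Variables (R : realType) (I : finType).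
HB.instance Definition _ := gen_eqMixin (config R I).
HB.instance Definition _ := gen_choiceMixin (config R I).
HB.instance Definition _ := isPointed.Build (config R I) (fun=> 0).
End ConfigPointed.

Definition box (R : realType) (I : finType) (B : I -> set R) :
  set (config R I) := [set x | forall i, B i (x i)].

Definition boxes (R : realType) (I : finType) : set (set (config R I)) :=
  [set A | exists2 B : I -> set R, (forall i, measurable (B i)) & A = box B].

Notation cfg R I := (g_sigma_algebraType (@boxes R I)).

Section Configurations.
Context {R : realType} {I : finType}.
Notation gam := (@normal_prob R 0 1).
Local Notation cfg := (cfg R I).
Local Notation boxes := (@boxes R I).

Lemma measurable_box (B : I -> set R) :
  (forall i, measurable (B i)) -> measurable (box B : set cfg).
Proof. by move=> mB; apply: sub_sigma_algebra; exists B. Qed.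

Lemma measurable_coord (i : I) : measurable_fun setT (fun x : cfg => x i).
Proof.
move=> _ Y mY; rewrite setTI.
have -> : (fun x : cfg => x i) @^-1` Y = box (fun j => if j == i then Y else setT).
  apply/seteqP; split => x /=; first by move=> Yx j; case: eqP => // ->.
  by move/(_ i); rewrite eqxx.
by apply: measurable_box => j; case: ifP.
Qed.

Lemma measurable_cfg d (T : measurableType d) (f : T -> cfg) :
  (forall i, measurable_fun setT (fun t => f t i)) -> measurable_fun setT f.
Proof.
move=> mf; apply: (@measurability _ _ T cfg setT f boxes erefl).
move=> _ [_ [B mB ->] <-].
have -> : [set: T] `&` f @^-1` box B = \bigcap_(i in [set: I]) ([set: T] `&` (fun t => f t i) @^-1` B i).
  apply/seteqP; split => [t [_ Bt] i _|t Bt]; first by split => //; exact: Bt.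
  by split => // i; have [] := Bt i Logic.I.
by apply: fin_bigcap_measurable => // i _; apply: mf.
Qed.

Lemma setI_closed_boxes : setI_closed boxes.
Proof.
move=> _ _ [B mB ->] [C mC ->]; exists (fun i => B i `&` C i).
  by move=> i; exact: measurableI.
apply/seteqP; split => x /=; first by move=> [Bx Cx] i; split.
by move=> BC; split => i; have [] := BC i.
Qed.

Lemma measurable_upd (k : I) :
  measurable_fun setT (fun z : cfg * measurableTypeR R => upd z.1 k z.2 : cfg).
Proof.
apply: measurable_cfg => i; rewrite /upd; case: eqP => [_|_].
  exact: measurable_snd.
exact: (measurableT_comp (measurable_coord i) measurable_fst).
Qed.

Definition gaussian_law (mu : set cfg -> \bar R) :=
  forall B : I -> set R, (forall i, measurable (B i)) ->
  mu (box B) = (\prod_i gam (B i))%E.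

Section Resampling.
Variable mu : probability cfg R.
Hypothesis gmu : gaussian_law mu.
Local Open Scope ereal_scope.

(** Drawing one coordinate afresh keeps the measure of every box, and boxes form a generating
    pi-system. This identity plays the part of conditioning on all other coordinates. *)
Lemma integral_resample (k : I) (F : cfg -> \bar R) :
  measurable_fun setT F -> (forall x, 0 <= F x) ->
  \int[mu]_x F x = \int[mu]_x \int[gam]_t F (upd x k t).
Proof.
move=> mF F0; pose nu := image_measure (mu \x gam) (measurable_upd k).
have muoo : mu setT < +oo by rewrite probability_setT ltry.
have munu A : measurable A -> mu A = nu A.
  move=> mA; apply: (@g_sigma_algebra_measure_unique _ R cfg boxes _ (fun=> setT) _ _ mu nu) => //.
  - by move=> _ [B mB ->]; exact: measurable_box.
  - by move=> _; exists (fun=> setT) => //; apply/seteqP; split.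
  - by rewrite bigcup_const//; exists 0%N.
  - exact: setI_closed_boxes.
  - move=> _ [B mB ->]; rewrite [LHS](gmu mB) /nu /= /pushforward.
    have -> : (fun z : cfg * measurableTypeR R => upd z.1 k z.2 : cfg) @^-1` box B =
        box (fun i => if i == k then setT else B i) `*` B k.
      apply/seteqP; split => [[x t]|[x t]] /=.
        move=> Bu; split; last by move: (Bu k); rewrite /upd eqxx.
        by move=> i; move: (Bu i); rewrite /upd; case: eqP.
      move=> [Bx Bt] i; move: (Bx i); rewrite /upd; case: eqP => [->//|//].
    rewrite product_measure1E; [|by apply: measurable_box => i; case: (i == k)|exact: mB].
    rewrite [X in X * _]gmu; last by move=> i; case: (i == k).
    rewrite (bigD1 k)//= [in RHS](bigD1 k)//= eqxx probability_setT mul1e muleC.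
    by congr (_ * _); apply: eq_bigr => i /negPf ->.
rewrite (eq_measure_integral nu); last by move=> A mA _; exact: munu.
rewrite ge0_integral_pushforward//; last exact: measurable_upd.
rewrite preimage_setT fubini_tonelli1//; last by move=> z; exact: F0.
exact: measurableT_comp mF (measurable_upd k).
Qed.

(** Resampling both coordinates reduces the claim to the planar rotation. *)
Lemma integral_rotate (a b : I) (F : cfg -> \bar R) : a != b ->
  measurable_fun setT F -> (forall x, 0 <= F x) ->
  \int[mu]_x F x =
  \int[mu]_x F (upd (upd x a ((x a + x b) / Num.sqrt 2)%R) b ((x a - x b) / Num.sqrt 2)%R).
Proof.
move=> ab mF F0.
have two (G : cfg -> \bar R) : measurable_fun setT G -> (forall x, 0 <= G x) ->
    \int[mu]_x G x = \int[mu]_x \int[gam]_s \int[gam]_t G (upd (upd x a s) b t).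
  move=> mG G0; rewrite (integral_resample b)//.
  rewrite (integral_resample a)//.
    exact: (measurable_fun_fubini_tonelli_F (m2 := gam) _
      (measurableT_comp mG (measurable_upd b)) (fun z => G0 _)).
  by move=> x; exact: integral_ge0.
have mc := @measurable_coord.
pose rot x : cfg := upd (upd x a ((x a + x b) / Num.sqrt 2)%R) b ((x a - x b) / Num.sqrt 2)%R.
have mrot : measurable_fun setT (rot : cfg -> cfg).
  apply: measurable_cfg => i; rewrite /rot /upd.
  case: (i == b); last case: (i == a).
  - by apply: measurable_funM; [apply: measurable_funB; exact: mc|exact: measurable_cst].
  - by apply: measurable_funM; [apply: measurable_funD; exact: mc|exact: measurable_cst].
  - exact: mc.
rewrite (two F mF F0) (two (F \o rot) (measurableT_comp mF mrot) (fun x => F0 _)).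
apply: eq_integral => x _.
pose G (s t : measurableTypeR R) := F (upd (upd x a s) b t).
have mG : measurable_fun setT (fun z : measurableTypeR R * measurableTypeR R => G z.1 z.2).
  apply: (measurableT_comp mF); apply: measurable_cfg => i; rewrite /upd.
  case: (i == b); first exact: measurable_snd.
  by case: (i == a); [exact: measurable_fst|exact: measurable_cst].
transitivity (\int[gam]_s \int[gam]_t G s t); first by [].
rewrite (integral_normal_rotation mG (fun s t => F0 _)).
apply: eq_integral => s _; apply: eq_integral => t _; rewrite /G /= /rot; congr F.
apply/funext => i; rewrite /upd !eqxx (negPf ab).
by case: (i == b); case: (i == a).
Qed.

End Resampling.
End Configurations.

(** * Exponential moments of Gaussian linear and quadratic forms *)

Section ExponentialMoments.
Context {R : realType}.
Notation gam := (@normal_prob R 0 1).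
Notation Rm := (measurableTypeR R).
Local Open Scope ereal_scope.

Lemma integral_normal_expRM (c b : R) :
  \int[gam]_t (expR (c + b * t))%:E = (expR (c + b ^+ 2 / 2))%:E.
Proof.
have mE : measurable_fun setT (fun t : Rm => (expR (0 * t ^+ 2 / 2 + b * t))%:E).
  apply/measurable_EFinP; apply: measurableT_comp => //; apply: measurable_funD.
    apply: measurable_funM; last exact: measurable_cst.
    by apply: measurable_funM; [exact: measurable_cst|exact: measurable_funX].
  by apply: measurable_funM; [exact: measurable_cst|exact: measurable_id].
transitivity ((expR c)%:E * \int[gam]_t (expR (0 * t ^+ 2 / 2 + b * t))%:E).
  rewrite -ge0_integralZl//.
  by apply: eq_integral => t _; rewrite -EFinM -expRD; congr (EFin (expR _)); ring.
rewrite integral_normal_expR// subr0 invr1 sqrtr1 mul1r mulr1 -EFinM -expRD.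
by congr (EFin (expR _)); field.
Qed.

(** Gaussian linearization: [exp (A^2 / 2)] is the mean of [exp (t * A)] over a standard Gaussian
    [t]. So a sub-Gaussian bound on all linear forms, averaged over Gaussian coefficients, bounds
    the exponential of the sum of squares. *)
Lemma square_moment_of_linear d (T : measurableType d) (mu : probability T R)
    (E : finType) (A : E -> T -> R) (w : T -> R) (th : R) :
  (forall e, measurable_fun setT (A e)) -> measurable_fun setT w ->
  (forall x, 0 <= w x)%R -> (2 * th < 1)%R ->
  (forall h : E -> R,
    \int[mu]_x (w x * expR (\sum_e h e * A e x))%:E <= (expR (th * \sum_e h e ^+ 2))%:E) ->
  \int[mu]_x (w x * expR (\sum_e A e x ^+ 2 / 2))%:E <=
    (Num.sqrt (1 - 2 * th)^-1 ^+ #|E|)%:E.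
Proof.
move=> mA mw w0 th1 H; pose s := Num.sqrt (1 - 2 * th)^-1.
have s0 : (0 <= s)%R by exact: sqrtr_ge0.
have mexp (h : E -> R) (l : seq E) : measurable_fun setT
    (fun x => w x * expR (\sum_e h e * A e x + \sum_(e <- l) A e x ^+ 2 / 2))%R.
  apply: measurable_funM => //; apply: measurableT_comp => //.
  apply: measurable_funD; apply: measurable_sum => e.
    by apply: measurable_funM.
  by apply: measurable_funM => //; exact: measurable_funX.
(* Here [l] lists the coordinates already squared. The coefficients [h] vanish on [l], which leaves
   a free slot for the Gaussian [t] that linearizes the next square. *)
have key (l : seq E) : uniq l -> forall h : E -> R, (forall e, e \in l -> h e = 0%R) ->
    \int[mu]_x (w x * expR (\sum_e h e * A e x + \sum_(e <- l) A e x ^+ 2 / 2))%:E <=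
    (expR (th * \sum_e h e ^+ 2) * s ^+ size l)%:E.
  elim: l => [_ h _|e l IH /= /andP[el ul] h hl].
    by under eq_integral do rewrite big_nil addr0; rewrite mulr1; exact: H.
  have he : h e = 0%R by rewrite hl// mem_head.
  have sumA t x : (\sum_f upd h e t f * A f x = \sum_f h f * A f x + A e x * t)%R.
    rewrite (bigD1 e)//= [in RHS](bigD1 e)//= /upd eqxx he mul0r add0r addrC mulrC.
    by congr (_ + _)%R; apply: eq_bigr => f /negPf ->.
  have sumh t : (\sum_f upd h e t f ^+ 2 = \sum_f h f ^+ 2 + t ^+ 2)%R.
    rewrite (bigD1 e)//= [in RHS](bigD1 e)//= /upd eqxx he expr0n/= add0r addrC.
    by congr (_ + _)%R; apply: eq_bigr => f /negPf ->.
  pose G (z : T * Rm) : \bar R := (w z.1 * expR (\sum_f upd h e z.2 f * A f z.1 +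
    \sum_(f <- l) A f z.1 ^+ 2 / 2))%:E.
  have mG : measurable_fun setT G.
    apply/measurable_EFinP; apply: measurable_funM.
      exact: (measurableT_comp mw measurable_fst).
    apply: measurableT_comp => //; apply: measurable_funD; apply: measurable_sum => f.
      apply: measurable_funM; last exact: (measurableT_comp (mA f) measurable_fst).
      by rewrite /upd; case: (f == e); [exact: measurable_snd|exact: measurable_cst].
    apply: measurable_funM; last exact: measurable_cst.
    by apply: measurable_funX; exact: (measurableT_comp (mA f) measurable_fst).
  have G0 z : 0 <= G z by rewrite lee_fin mulr_ge0// expR_ge0.
  have -> : \int[mu]_x (w x * expR (\sum_f h f * A f x + \sum_(f <- e :: l) A f x ^+ 2 / 2))%:E
      = \int[mu]_x \int[gam]_t G (x, t).
    apply: eq_integral => x _.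
    transitivity ((w x)%:E * \int[gam]_t (expR (\sum_f h f * A f x + \sum_(f <- l) A f x ^+ 2 / 2 + A e x * t))%:E).
      rewrite integral_normal_expRM -EFinM big_cons; congr (EFin (_ * expR _)%R); ring.
    rewrite -ge0_integralZl//.
    - by apply: eq_integral => t _; rewrite /G/= sumA -EFinM; congr (EFin (_ * expR _)%R); ring.
    - apply/measurable_EFinP; apply: measurableT_comp => //; apply: measurable_funD.
        exact: measurable_cst.
      by apply: measurable_funM; [exact: measurable_cst|exact: measurable_id].
    - by rewrite lee_fin.
  rewrite [leLHS](@fubini_tonelli _ _ _ _ _ mu gam G mG G0).
  (* The induction hypothesis bounds the inner integral with the extra factor [exp (th * t ^+ 2)],
     whose Gaussian mean is [s]. *)
  apply: (@le_trans _ _ (\int[gam]_t (expR (2 * th * t ^+ 2 / 2 + 0 * t) *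
      (expR (th * \sum_f h f ^+ 2) * s ^+ size l))%:E)).
    apply: ge0_le_integral => //.
    - by move=> t _; apply: integral_ge0.
    - exact: (measurable_fun_fubini_tonelli_G (m1 := mu) _ mG G0).
    - apply/measurable_EFinP; apply: measurable_funM; last exact: measurable_cst.
      apply: measurableT_comp => //; apply: measurable_funD; apply: measurable_funM.
      + by apply: measurable_funM; [exact: measurable_cst|exact: measurable_funX].
      + exact: measurable_cst.
      + exact: measurable_cst.
      + exact: measurable_id.
    move=> t _; apply: le_trans (IH ul (upd h e t) _) _.
      move=> f fl; rewrite /upd; case: eqP => [fe|_]; first by rewrite -fe fl in el.
      by rewrite hl// inE fl orbT.
    rewrite lee_fin sumh mulrDr expRD.
    have -> : (2 * th * t ^+ 2 / 2 + 0 * t = th * t ^+ 2)%R by field.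
    by rewrite [leRHS]mulrCA mulrA.
  under eq_integral do rewrite EFinM.
  rewrite ge0_integralZr//; last 2 first.
  - apply/measurable_EFinP; apply: measurableT_comp => //; apply: measurable_funD; apply: measurable_funM.
    + by apply: measurable_funM; [exact: measurable_cst|exact: measurable_funX].
    + exact: measurable_cst.
    + exact: measurable_cst.
    + exact: measurable_id.
  - by rewrite lee_fin mulr_ge0 ?expR_ge0 ?exprn_ge0.
  rewrite integral_normal_expR// -EFinM lee_fin expr0n/= mul0r expR0 mulr1 -/s exprS.
  by rewrite mulrCA.
have := key (enum E) (enum_uniq _) (fun=> 0%R) (fun _ _ => erefl).
rewrite big1 ?mulr0 ?expR0 ?mul1r -?cardE; last by move=> e _; rewrite expr0n.
apply: le_trans; rewrite le_eqVlt; apply/orP; left; apply/eqP.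
apply: eq_integral => x _; congr (EFin (_ * expR _)%R).
rewrite [X in _ = (X + _)%R]big1 ?add0r; last by move=> e _; rewrite mul0r.
by rewrite big_enum.
Qed.

End ExponentialMoments.

Lemma measurable_sum_pred d (T : measurableType d) (R : realType) (J : finType)
    (Q : pred J) (h : J -> T -> R) : (forall j, measurable_fun setT (h j)) ->
  measurable_fun setT (fun x => \sum_(j | Q j) h j x).
Proof.
by move=> mh; under eq_fun do rewrite -big_filter; exact: measurable_sum.
Qed.

Section GaussianMoments.
Context {R : realType} {I : finType}.
Notation gam := (@normal_prob R 0 1).
Notation Rm := (measurableTypeR R).
Local Notation cfg := (cfg R I).
Variable mu : probability cfg R.
Hypothesis gmu : gaussian_law mu.
Local Open Scope ereal_scope.

Definition free_of (T : Type) (L : seq I) (F : (I -> R) -> T) :=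
  forall j, j \in L -> forall x t, F (upd x j t) = F x.

(** The coefficients [G k] may be random, but they do not involve the coordinates being integrated,
    so they are frozen while these are resampled one by one. *)
Lemma gaussian_mgf (J : eqType) (c : J -> I) (L : seq J) (G : J -> cfg -> R)
    (F : cfg -> R) : injective c ->
  uniq L -> (forall k, measurable_fun setT (G k)) -> measurable_fun setT F ->
  (forall x, 0 <= F x)%R -> free_of (map c L) F ->
  (forall k, free_of (map c L) (G k)) ->
  \int[mu]_x (F x * expR (\sum_(k <- L) G k x * x (c k)))%:E =
  \int[mu]_x (F x * expR (\sum_(k <- L) G k x ^+ 2 / 2))%:E.
Proof.
move=> injc uL mG; elim: L uL F => [|j L IH] /= uL F mF F0 fF fG.
  by apply: eq_integral => x _; rewrite !big_nil.
case/andP: uL => jL uL.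
have mc := @measurable_coord R I.
rewrite (integral_resample gmu (c j)); last 2 first.
- apply/measurable_EFinP; apply: measurable_funM => //; apply: measurableT_comp => //.
  by apply: measurable_sum => k; apply: measurable_funM => //; exact: mc.
- by move=> x; rewrite lee_fin mulr_ge0// expR_ge0.
pose F' x := (F x * expR (G j x ^+ 2 / 2))%R.
transitivity (\int[mu]_x (F' x * expR (\sum_(k <- L) G k x * x (c k)))%:E).
  apply: eq_integral => x _.
  transitivity (\int[gam]_t ((F x)%:E * (expR (\sum_(k <- L) G k x * x (c k) + G j x * t))%:E)).
    apply: eq_integral => t _; rewrite -EFinM fF ?mem_head// big_cons.
    congr (EFin (_ * expR _)%R); rewrite addrC; congr (_ + _)%R.
      apply: eq_big_seq => k kL; rewrite fG ?mem_head// /upd.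
      by case: eqP => // /injc kj; rewrite -kj kL in jL.
    by rewrite fG ?mem_head// /upd eqxx.
  rewrite ge0_integralZl//; last 2 first.
  - apply/measurable_EFinP; apply: measurableT_comp => //; apply: measurable_funD.
      exact: measurable_cst.
    by apply: measurable_funM; [exact: measurable_cst|exact: measurable_id].
  - by rewrite lee_fin.
  by rewrite integral_normal_expRM -EFinM /F' expRD -mulrA [X in (_ * X)%R]mulrC.
rewrite IH//.
- by apply: eq_integral => x _; rewrite /F' -mulrA -expRD big_cons.
- apply: measurable_funM => //; apply: measurableT_comp => //.
  by apply: measurable_funM => //; exact: measurable_funX.
- by move=> x; rewrite mulr_ge0// expR_ge0.
- move=> i iL x t; have ijL : i \in c j :: map c L by rewrite inE iL orbT.
  by rewrite /F' fF// fG.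
- by move=> k i iL x t; rewrite fG// inE iL orbT.
Qed.

(** Integrating out one coordinate of a linear form keeps the shape of the integrand; only the
    weight changes, from [th] to [th / (1 + 2 * th * y ^+ 2)]. *)
Lemma gaussian_square_step (j : I) (th y : R) (B C : cfg -> R) :
  measurable_fun setT B -> measurable_fun setT C -> (0 <= th)%R ->
  free_of [:: j] B -> free_of [:: j] C ->
  \int[mu]_x (expR (- th * (B x + y * x j) ^+ 2 + C x))%:E =
  (Num.sqrt (1 + 2 * th * y ^+ 2)^-1)%:E *
  \int[mu]_x (expR (- (th / (1 + 2 * th * y ^+ 2)) * B x ^+ 2 + C x))%:E.
Proof.
move=> mB mC th0 fB fC.
have mc := @measurable_coord R I.
have D0 : (0 < 1 + 2 * th * y ^+ 2)%R.
  by rewrite ltr_pwDl// mulr_ge0 ?sqr_ge0// mulr_ge0.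
have mE : measurable_fun setT (fun x => (- (th / (1 + 2 * th * y ^+ 2)) * B x ^+ 2 + C x)%R).
  apply: measurable_funD => //; apply: measurable_funM; first exact: measurable_cst.
  exact: measurable_funX.
rewrite (integral_resample gmu j); last 2 first.
- apply/measurable_EFinP; apply: measurableT_comp => //; apply: measurable_funD => //.
  apply: measurable_funM; first exact: measurable_cst.
  apply: measurable_funX; apply: measurable_funD => //.
  by apply: measurable_funM; [exact: measurable_cst|exact: mc].
- by move=> x; rewrite lee_fin expR_ge0.
rewrite -ge0_integralZl//; last first.
  by apply/measurable_EFinP; exact: measurableT_comp.
apply: eq_integral => x _.
transitivity (\int[gam]_t ((expR (- th * B x ^+ 2 + C x))%:E *
    (expR (- (2 * th * y ^+ 2) * t ^+ 2 / 2 + - (2 * th * B x * y) * t))%:E)).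
  apply: eq_integral => t _; rewrite -EFinM -expRD fB ?mem_head// fC ?mem_head//.
  by congr (EFin (expR _)); rewrite /upd eqxx; field.
rewrite ge0_integralZl//; last first.
  apply/measurable_EFinP; apply: measurableT_comp => //; apply: measurable_funD.
    apply: measurable_funM; last exact: measurable_cst.
    by apply: measurable_funM; [exact: measurable_cst|exact: measurable_funX].
  by apply: measurable_funM; [exact: measurable_cst|exact: measurable_id].
rewrite integral_normal_expR; last by rewrite (le_lt_trans _ (ltr01))// oppr_le0 mulr_ge0 ?sqr_ge0// mulr_ge0.
rewrite opprK -!EFinM; congr EFin; rewrite mulrCA -expRD; congr (_ * expR _)%R.
by field; rewrite gt_eqF.
Qed.

(** The one-coordinate factors multiply up: with [D = 1 + 2 * th * y ^+ 2], one has [D * (1 + 2 *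
    (th / D) * S) = 1 + 2 * th * (y ^+ 2 + S)]. *)
Lemma gaussian_square_mgf (n r : nat) (c : 'I_n -> 'I_r -> I) (th : 'I_n -> R)
    (Y : 'I_n -> 'I_r -> R) :
  injective (fun p => c p.1 p.2) -> (forall i, 0 <= th i)%R ->
  \int[mu]_x (expR (\sum_i - th i * (\sum_l Y i l * x (c i l)) ^+ 2))%:E =
  (\prod_i Num.sqrt (1 + 2 * th i * \sum_l Y i l ^+ 2)^-1)%:E.
Proof.
move=> injc; have mc := @measurable_coord R I.
(* Induction on a list outside which the coefficients vanish; the weights are generalized because
   each step divides one of them. *)
suff key (P : seq ('I_n * 'I_r)) (t : 'I_n -> R) (Z : 'I_n -> 'I_r -> R) :
    (forall i, 0 <= t i)%R -> (forall p, p \notin P -> Z p.1 p.2 = 0%R) ->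
    \int[mu]_x (expR (\sum_i - t i * (\sum_l Z i l * x (c i l)) ^+ 2))%:E =
    (\prod_i Num.sqrt (1 + 2 * t i * \sum_l Z i l ^+ 2)^-1)%:E.
  by move=> th0; apply: (key (enum {: 'I_n * 'I_r})) => // p; rewrite mem_enum.
elim: P t Z => [|[i0 l0] P IH] t Z t0 Z0.
  transitivity (\int[mu]_x 1%:E).
    apply: eq_integral => x _; rewrite big1 ?expR0// => i _.
    rewrite big1 ?expr0n ?mulr0// => l _.
    by rewrite (Z0 (i, l))// mul0r.
  rewrite integral_cst// mul1e [LHS]probability_setT; congr EFin.
  rewrite big1// => i _; rewrite big1 ?mulr0 ?addr0 ?invr1 ?sqrtr1// => l _.
  by rewrite (Z0 (i, l))// expr0n.
pose D := (1 + 2 * t i0 * Z i0 l0 ^+ 2)%R.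
have D0 : (0 < D)%R by rewrite ltr_pwDl// mulr_ge0 ?sqr_ge0// mulr_ge0.
pose t' := upd t i0 (t i0 / D)%R; pose Z' := upd Z i0 (upd (Z i0) l0 0%R).
pose B (x : cfg) := (\sum_(l | l != l0) Z i0 l * x (c i0 l))%R.
pose C (x : cfg) := (\sum_(i | i != i0) - t i * (\sum_l Z i l * x (c i l)) ^+ 2)%R.
have mlin i (Q : pred 'I_r) : measurable_fun setT (fun x : cfg => \sum_(l | Q l) Z i l * x (c i l))%R.
  by apply: measurable_sum_pred => l; apply: measurable_funM; [exact: measurable_cst|exact: mc].
have mC : measurable_fun setT C.
  apply: measurable_sum_pred => i; apply: measurable_funM; first exact: measurable_cst.
  exact: (measurable_funX _ (mlin i xpredT)).
have fB : free_of [:: c i0 l0] B.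
  move=> j; rewrite inE => /eqP -> x s; apply: eq_bigr => l ll0; rewrite /upd.
  case: eqP => // cc; have [le] := injc (i0, l) (i0, l0) cc.
  by rewrite le eqxx in ll0.
have fC : free_of [:: c i0 l0] C.
  move=> j; rewrite inE => /eqP -> x s; apply: eq_bigr => i ii0; do 2 congr (_ * _)%R.
    apply: eq_bigr => l _; rewrite /upd; case: eqP => // cc.
    by have [ie _] := injc (i, l) (i0, l0) cc; rewrite ie eqxx in ii0.
  apply: eq_bigr => l _; rewrite /upd; case: eqP => // cc.
  by have [ie _] := injc (i, l) (i0, l0) cc; rewrite ie eqxx in ii0.
transitivity (\int[mu]_x (expR (- t i0 * (B x + Z i0 l0 * x (c i0 l0)) ^+ 2 + C x))%:E).
  apply: eq_integral => x _; congr (EFin (expR _)).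
  by rewrite (bigD1 i0)//= (bigD1 l0)//= [(Z i0 l0 * _ + _)%R]addrC.
rewrite gaussian_square_step//; last exact: mlin.
transitivity ((Num.sqrt D^-1)%:E *
    \int[mu]_x (expR (\sum_i - t' i * (\sum_l Z' i l * x (c i l)) ^+ 2))%:E).
  congr (_ * _); apply: eq_integral => x _; congr (EFin (expR _)).
  rewrite [in RHS](bigD1 i0)//= /t' /Z' /upd !eqxx; congr (_ + _)%R.
    congr (_ * _ ^+ 2)%R; rewrite [in RHS](bigD1 l0)//= eqxx mul0r add0r.
    by apply: eq_bigr => l /negPf ->.
  by apply: eq_bigr => i /negPf ->.
rewrite IH.
- rewrite -EFinM; congr EFin; rewrite (bigD1 i0)//= [in RHS](bigD1 i0)//= mulrA.
  congr (_ * _)%R; last by apply: eq_bigr => i /negPf ii0; rewrite /t' /Z' /upd ii0.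
  rewrite /t' /Z' /upd !eqxx (bigD1 l0)//= eqxx expr0n/= add0r [in RHS](bigD1 l0)//=.
  have -> : (\sum_(l | l != l0) (if l == l0 then 0 else Z i0 l) ^+ 2 =
      \sum_(l | l != l0) Z i0 l ^+ 2)%R by apply: eq_bigr => l /negPf ->.
  set S := (\sum_(l | l != l0) _)%R.
  have S0 : (0 <= S)%R by apply: sumr_ge0 => l _; exact: sqr_ge0.
  rewrite -sqrtrM ?invr_ge0 ?ltW//; congr Num.sqrt; rewrite -invfM; congr (_^-1)%R.
  by rewrite /D; field; rewrite gt_eqF.
- by move=> i; rewrite /t' /upd; case: eqP => // _; rewrite divr_ge0// ltW.
- move=> [i l] nP; rewrite /Z' /upd/=; case: (eqVneq i i0) => [ii|ni].
    case: (eqVneq l l0) => // nl; rewrite (Z0 (i0, l))// inE -ii negb_or nP andbT.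
    by apply: contra nl => /eqP H; apply/eqP; case: H.
  by rewrite (Z0 (i, l))// inE negb_or nP andbT; apply: contra ni => /eqP H; apply/eqP; case: H.
Qed.

End GaussianMoments.

Lemma sum_prodE (V : nmodType) (A B : finType) (f : A * B -> V) :
  \sum_e f e = \sum_a \sum_b f (a, b).
Proof. by rewrite pair_bigA; apply: eq_bigr => -[]. Qed.

(** * Measurable matrix-valued maps, and the upper moment of a Gaussian matrix *)

Section MeasurableMatrices.
Context d (T : measurableType d) (R : realType).

Definition measurable_mx m n (f : T -> 'M[R]_(m, n)) :=
  forall i j, measurable_fun setT (fun x => f x i j).

Lemma measurable_mx_cst m n (A : 'M[R]_(m, n)) : measurable_mx (fun=> A).
Proof. by move=> i j; exact: measurable_cst. Qed.

Lemma measurable_mxD m n (f g : T -> 'M[R]_(m, n)) :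
  measurable_mx f -> measurable_mx g -> measurable_mx (fun x => f x + g x).
Proof.
by move=> mf mg i j; under eq_fun do rewrite mxE; exact: measurable_funD.
Qed.

Lemma measurable_mxB m n (f g : T -> 'M[R]_(m, n)) :
  measurable_mx f -> measurable_mx g -> measurable_mx (fun x => f x - g x).
Proof.
by move=> mf mg i j; under eq_fun do rewrite !mxE; exact: measurable_funB.
Qed.

Lemma measurable_mxM m n k (f : T -> 'M[R]_(m, n)) (g : T -> 'M[R]_(n, k)) :
  measurable_mx f -> measurable_mx g -> measurable_mx (fun x => f x *m g x).
Proof.
move=> mf mg i j; under eq_fun do rewrite mxE.
by apply: measurable_sum => l; exact: measurable_funM.
Qed.

Lemma measurable_mxT m n (f : T -> 'M[R]_(m, n)) :
  measurable_mx f -> measurable_mx (fun x => (f x)^T).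
Proof. by move=> mf i j; under eq_fun do rewrite mxE; exact: mf. Qed.

Lemma measurable_mxZ m n (a : R) (f : T -> 'M[R]_(m, n)) :
  measurable_mx f -> measurable_mx (fun x => a *: f x).
Proof.
move=> mf i j; under eq_fun do rewrite mxE.
by apply: measurable_funM; [exact: measurable_cst|exact: mf].
Qed.

End MeasurableMatrices.

Section UpperMoment.
Context {R : realType} {I : finType}.
Variable mu : probability (cfg R I) R.
Hypothesis gmu : gaussian_law mu.

(** Each row gives a linear form which, divided by [sqrt 2], is sub-Gaussian with constant [1/4];
    then [1 - 2 * (1/4) = 1/2] yields one factor [sqrt 2] per row. *)
Lemma gaussian_upper_moment (n k : nat) (c : 'I_n -> 'I_k -> I) (v : 'I_k -> R) :
  injective (fun q => c q.1 q.2) -> \sum_l v l ^+ 2 <= 1 ->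
  (\int[mu]_x (expR (\sum_i (\sum_l v l * x (c i l)) ^+ 2 / 4))%:E <=
   (Num.sqrt 2 ^+ n)%:E)%E.
Proof.
move=> injc v1; have mc := @measurable_coord R I.
pose A i (x : cfg R I) := (Num.sqrt 2)^-1 * \sum_l v l * x (c i l).
have mA i : measurable_fun setT (A i).
  apply: measurable_funM; first exact: measurable_cst.
  by apply: measurable_sum => l; apply: measurable_funM; [exact: measurable_cst|exact: mc].
have sq2 : (Num.sqrt 2)^-1 ^+ 2 = 2^-1 :> R by rewrite exprVn sqr_sqrtr.
have := @square_moment_of_linear R _ _ mu 'I_n A (fun=> 1) (1 / 4) mA (@measurable_cst _ _ _ _ _ _) (fun=> ler01).
have -> : (1 - 2 * (1 / 4) : R)^-1 = 2 by field.
rewrite card_ord => H; apply: le_trans (H _ _).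
- rewrite le_eqVlt; apply/orP; left; apply/eqP; apply: eq_integral => x _.
  rewrite mul1r; congr (EFin (expR _)); apply: eq_bigr => i _.
  by rewrite /A exprMn sq2; field.
- by lra.
move=> h.
have := @gaussian_mgf R I mu gmu _ (fun q : 'I_n * 'I_k => c q.1 q.2) (enum {: 'I_n * 'I_k})
  (fun q _ => h q.1 * v q.2 / Num.sqrt 2) (fun=> 1) injc (enum_uniq _)
  (fun=> @measurable_cst _ _ _ _ _ _) (@measurable_cst _ _ _ _ _ _) (fun=> ler01)
  (fun _ _ _ _ => erefl) (fun _ _ _ _ _ => erefl).
have -> : (\int[mu]_x (1 * expR (\sum_i h i * A i x))%:E =
  \int[mu]_x (1 * expR (\sum_(q <- enum {: 'I_n * 'I_k}) h q.1 * v q.2 / Num.sqrt 2 * x (c q.1 q.2)))%:E)%E.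
  apply: eq_integral => x _; congr (EFin (_ * expR _)).
  rewrite big_enum sum_prodE/=.
  apply: eq_bigr => i _; rewrite /A !mulr_sumr; apply: eq_bigr => l _; ring.
move=> ->; rewrite integral_cst// [X in (_ * X)%E]probability_setT mule1 mul1r lee_fin ler_expR.
rewrite big_enum sum_prodE/= mulr_sumr.
apply: ler_sum => i _.
rewrite (_ : \sum_l _ = 1 / 4 * h i ^+ 2 * \sum_l v l ^+ 2).
  by rewrite ler_piMr// mulr_ge0 ?sqr_ge0.
rewrite mulr_sumr; apply: eq_bigr => l _; by rewrite exprMn exprMn sq2; field.
Qed.

End UpperMoment.

(** * The noise of the spiked model and the decoupling of its two copies *)

Section SpikedNoise.
Context {R : realType} (n p r : nat).
Definition noise_idx : finType := (('I_n * 'I_r) + (('I_n * 'I_p) + ('I_n * 'I_p)))%type.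
Notation I := noise_idx.
Local Notation cfg := (cfg R I).
Implicit Type x : cfg.

Definition sigU x : 'M[R]_(n, r) := \matrix_(i, j) x (inl (i, j)).
Definition sigZ x : 'M[R]_(n, p) := \matrix_(i, j) x (inr (inl (i, j))).
Definition sigT x : 'M[R]_(n, p) := \matrix_(i, j) x (inr (inr (i, j))).

Variable mu : probability cfg R.
Hypothesis gmu : gaussian_law mu.
Local Open Scope ereal_scope.

(** When [L] contains every index, [Z + Zt] becomes [sqrt 2 * Z] and [Z - Zt] becomes [sqrt 2 * Zt],
    so that the two combinations involve disjoint coordinates. *)
Definition rotc (L : seq ('I_n * 'I_p)) x : cfg := fun k =>
  match k with
  | inl e => x (inl e)
  | inr (inl e) => if e \in L then ((x (inr (inl e)) + x (inr (inr e))) / Num.sqrt 2)%R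
                   else x (inr (inl e))
  | inr (inr e) => if e \in L then ((x (inr (inl e)) - x (inr (inr e))) / Num.sqrt 2)%R
                   else x (inr (inr e))
  end.

Lemma measurable_rotc L : measurable_fun setT (rotc L : cfg -> cfg).
Proof.
have mc := @measurable_coord R I.
apply: measurable_cfg => -[e|[e|e]] /=; first exact: mc.
  case: (e \in L); last exact: mc.
  by apply: measurable_funM; [apply: measurable_funD; exact: mc|exact: measurable_cst].
case: (e \in L); last exact: mc.
by apply: measurable_funM; [apply: measurable_funB; exact: mc|exact: measurable_cst].
Qed.

Lemma integral_rotc (L : seq ('I_n * 'I_p)) (F : cfg -> \bar R) : uniq L ->
  measurable_fun setT F -> (forall x, 0 <= F x) ->
  \int[mu]_x F x = \int[mu]_x F (rotc L x).
Proof.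
move=> uL mF F0; elim: L uL => [_|e L IH /andP[eL uL]].
  apply: eq_integral => x _; congr F; apply/funext.
  by case=> [//|[//|//]].
rewrite (IH uL).
rewrite (@integral_rotate _ _ _ gmu (inr (inl e)) (inr (inr e)) (F \o rotc L) erefl
  (measurableT_comp mF (measurable_rotc L)) (fun x => F0 _)).
have ilr f : (inr (inl f) == inr (inr e) :> I) = false by [].
have irl f : (inr (inr f) == inr (inl e) :> I) = false by [].
have ill f : (inr (inl f) == inr (inl e) :> I) = (f == e) by [].
have irr f : (inr (inr f) == inr (inr e) :> I) = (f == e) by [].
apply: eq_integral => x _ /=; congr F; apply/funext.
case=> [f//|[f|f]] /=; rewrite /upd !inE !(ilr, irl, ill, irr);
  case: (eqVneq f e) => [->|] //=; rewrite ?(negPf eL)//.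
Qed.

Lemma measurable_sigU : measurable_mx sigU.
Proof. by move=> i j; under eq_fun do rewrite mxE; exact: measurable_coord. Qed.

Lemma measurable_sigZ : measurable_mx sigZ.
Proof. by move=> i j; under eq_fun do rewrite mxE; exact: measurable_coord. Qed.

Lemma measurable_sigT : measurable_mx sigT.
Proof. by move=> i j; under eq_fun do rewrite mxE; exact: measurable_coord. Qed.

(** After the rotation, [Z - Zt] is Gaussian and free of the matrix [U a1 + (Z + Zt) a2]. Where the
    weight [W] is nonzero, that matrix has squared operator norm at most [tau], so the linear forms
    in the entries of the product are sub-Gaussian and [square_moment_of_linear] applies. The bound
    is the chi-square moment with [#|J| * r] degrees of freedom. *)
Lemma noise_square_moment (J : {set 'I_p}) (a1 : 'M[R]_r) (a2 : 'M[R]_(p, r))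
    (W : 'M[R]_(n, r) -> 'M[R]_(n, p) -> R) (tau th : R) :
  (0 < tau)%R -> (0 <= th)%R -> (2 * th < 1)%R -> (forall U Z, 0 <= W U Z <= 1)%R ->
  measurable_fun setT (fun x => W (sigU x) (sigZ x + sigT x)%R) ->
  (forall U Z (y : 'cV[R]_r), W U Z != 0%R ->
    (frob2 ((U *m a1 + Z *m a2) *m y) <= tau * frob2 y)%R) ->
  \int[mu]_x (W (sigU x) (sigZ x + sigT x)%R * expR (\sum_(j in J) \sum_l
     (((sigZ x - sigT x)^T *m (sigU x *m a1 + (sigZ x + sigT x) *m a2)) j l) ^+ 2
       * (th / tau) / 2))%:E <= (Num.sqrt (1 - 2 * th)^-1 ^+ (#|J| * r))%:E.
Proof.
move=> tau0 th0 th1 W01 mW Wop.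
have mU := measurable_sigU; have mZ := measurable_sigZ; have mT := measurable_sigT.
pose F x : \bar R := (W (sigU x) (sigZ x + sigT x)%R * expR (\sum_(j in J) \sum_l
     (((sigZ x - sigT x)^T *m (sigU x *m a1 + (sigZ x + sigT x) *m a2)) j l) ^+ 2
       * (th / tau) / 2))%:E.
have mF : measurable_fun setT F.
  apply/measurable_EFinP; apply: measurable_funM => //; apply: measurableT_comp => //.
  apply: measurable_sum_pred => j; apply: measurable_sum => l.
  apply: measurable_funM; last exact: measurable_cst.
  apply: measurable_funM; last exact: measurable_cst.
  apply: measurable_funX; apply: measurable_mxM.
    by apply: measurable_mxT; exact: measurable_mxB.
  apply: measurable_mxD; apply: measurable_mxM; try exact: measurable_mx_cst.
    exact: mU.
  exact: measurable_mxD.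
have F0 x : 0 <= F x.
  by rewrite lee_fin mulr_ge0 ?expR_ge0//; have /andP[] := W01 (sigU x) (sigZ x + sigT x)%R.
pose Q := enum {: 'I_n * 'I_p}.
have inQ e : e \in Q by rewrite mem_enum.
have s2 : (Num.sqrt 2 * Num.sqrt 2 = 2 :> R)%R by rewrite -expr2 sqr_sqrtr.
have s2n : (Num.sqrt 2 != 0 :> R)%R by rewrite sqrtr_eq0 -ltNge.
have twice (a : R) : ((a + a) / Num.sqrt 2 = Num.sqrt 2 * a)%R.
  by apply: (mulIf s2n); rewrite divfK// mulrAC s2 mulr_natl mulr2n.
have rU x : sigU (rotc Q x) = sigU x by apply/matrixP => i j; rewrite !mxE.
have rZD x : (sigZ (rotc Q x) + sigT (rotc Q x) = Num.sqrt 2 *: sigZ x)%R.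
  apply/matrixP => i j; rewrite !mxE/= inQ -twice -mulrDl; congr (_ / _)%R; ring.
have rZB x : (sigZ (rotc Q x) - sigT (rotc Q x) = Num.sqrt 2 *: sigT x)%R.
  apply/matrixP => i j; rewrite !mxE/= inQ -twice -mulrBl; congr (_ / _)%R; ring.
rewrite [leLHS](@integral_rotc Q F (enum_uniq _) mF F0).
pose w x := W (sigU x) (Num.sqrt 2 *: sigZ x)%R.
have mw : measurable_fun setT w.
  have := measurableT_comp mW (measurable_rotc Q).
  by apply: eq_measurable_fun => x _ /=; rewrite rU rZD.
pose Lm x : 'M[R]_(n, r) := (sigU x *m a1 + (Num.sqrt 2 *: sigZ x) *m a2)%R.
have mL : measurable_mx Lm.
  apply: measurable_mxD; apply: measurable_mxM; try exact: measurable_mx_cst.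
    exact: mU.
  exact: measurable_mxZ.
pose cc := Num.sqrt (th / tau).
have cc2 : (cc ^+ 2 = th / tau)%R by rewrite sqr_sqrtr// divr_ge0// ltW.
pose A (e : 'I_#|J| * 'I_r) x := (cc * ((Num.sqrt 2 *: sigT x)^T *m Lm x) (enum_val e.1) e.2)%R.
have mA e : measurable_fun setT (A e).
  apply: measurable_funM; first exact: measurable_cst.
  by apply: measurable_mxM => //; apply: measurable_mxT; exact: measurable_mxZ.
have W0 x : (0 <= w x)%R by have /andP[] := W01 (sigU x) (Num.sqrt 2 *: sigZ x)%R.
have := @square_moment_of_linear R _ _ mu _ A w th mA mw W0 th1.
rewrite card_prod !card_ord => H; apply: le_trans (H _).
  rewrite le_eqVlt; apply/orP; left; apply/eqP; apply: eq_integral => x _.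
  rewrite /F rU rZD rZB -/(w x) -/(Lm x); congr (EFin (_ * expR _)%R).
  rewrite sum_prodE big_enum_val/=.
  apply: eq_bigr => j _; apply: eq_bigr => l _.
  by rewrite /A/= exprMn cc2 [X in (X / _)%R]mulrC.
move=> h {H}.
(* The coefficient of entry [e] of [Zt] in the linear form with coefficients [h]; it involves only
   [U] and [Z]. *)
pose G (e : 'I_n * 'I_p) x : R := (cc * Num.sqrt 2 * \sum_(q : 'I_#|J| * 'I_r)
  (if enum_val q.1 == e.2 then h q * Lm x e.1 q.2 else 0))%R.
have mG e : measurable_fun setT (G e).
  apply: measurable_funM; first exact: measurable_cst.
  apply: measurable_sum => q; case: (enum_val q.1 == e.2); last exact: measurable_cst.
  by apply: measurable_funM; [exact: measurable_cst|exact: mL].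
pose c (e : 'I_n * 'I_p) : I := inr (inr e).
have injc : injective c by move=> e e' [].
have fU k x t : sigU (upd x (c k) t) = sigU x by apply/matrixP => i j; rewrite !mxE.
have fZ k x t : sigZ (upd x (c k) t) = sigZ x by apply/matrixP => i j; rewrite !mxE.
have fw : free_of (map c Q) w by move=> _ /mapP[e _ ->] x t; rewrite /w fU fZ.
have fG k : free_of (map c Q) (G k).
  by move=> _ /mapP[e _ ->] x t; rewrite /G /Lm fU fZ.
have := @gaussian_mgf R I mu gmu _ c Q G w injc (enum_uniq _) mG mw W0 fw fG.
have -> : \int[mu]_x (w x * expR (\sum_e h e * A e x))%:E =
    \int[mu]_x (w x * expR (\sum_(k <- Q) G k x * x (c k)))%:E.
  apply: eq_integral => x _; congr (EFin (_ * expR _)%R).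
  rewrite big_enum/=.
  transitivity (\sum_(e : 'I_n * 'I_p) \sum_(q : 'I_#|J| * 'I_r)
      cc * Num.sqrt 2 * (if enum_val q.1 == e.2 then h q * Lm x e.1 q.2 else 0) * x (c e))%R.
    rewrite exchange_big/=; apply: eq_bigr => q _.
    rewrite sum_prodE/=.
    rewrite /A mxE mulrA !mulr_sumr; apply: eq_bigr => i _.
    rewrite (bigD1 (enum_val q.1))//= eqxx big1 ?addr0; last first.
      by move=> j /negPf nj; rewrite eq_sym nj mulr0 mul0r.
    rewrite !mxE; ring.
  by apply: eq_bigr => e _; rewrite /G mulr_sumr mulr_suml.
move=> ->.
(* The exponent is [th / tau] times the sum over [j] of the squared norms of [Lm x *m y j], where
   [y j] is the row of [h] attached to [j]. A nonzero weight bounds each of them by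
   [tau * frob2 (y j)]. *)
have wle x : (w x * expR (\sum_(k <- Q) G k x ^+ 2 / 2) <= w x * expR (th * \sum_e h e ^+ 2))%R.
  have [->|wn0] := eqVneq (w x) 0%R; first by rewrite !mul0r.
  rewrite ler_wpM2l// ler_expR big_enum/=.
  pose y j : 'cV[R]_r := \col_l (h (j, l)).
  have GE i (j : 'I_p) (jJ : j \in J) : G (i, j) x =
      (cc * Num.sqrt 2 * (Lm x *m y (enum_rank_in jJ j)) i 0)%R.
    rewrite /G/=; congr (_ * _)%R.
    rewrite sum_prodE/=.
    rewrite (bigD1 (enum_rank_in jJ j))//= [X in (_ + X)%R]big1 ?addr0 => [|a na].
      rewrite mxE; apply: eq_bigr => l _.
      by rewrite enum_rankK_in// eqxx [y _ _ _]mxE mulrC.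
    apply: big1 => l _; case: eqP => // aj; case/eqP: na.
    by apply: enum_val_inj; rewrite enum_rankK_in.
  have G0 i (j : 'I_p) : j \notin J -> G (i, j) x = 0%R.
    move=> jJ; rewrite /G/= big1 ?mulr0// => q _; case: eqP => // qj.
    by move: jJ; rewrite -qj enum_valP.
  rewrite sum_prodE exchange_big/=.
  rewrite (bigID (mem J))/= [X in (_ + X)%R]big1 ?addr0; last first.
    by move=> j jJ; apply: big1 => i _; rewrite G0// expr0n/= mul0r.
  rewrite big_enum_val/= sum_prodE mulr_sumr.
  apply: ler_sum => a _.
  have -> : (\sum_i G (i, enum_val a) x ^+ 2 / 2 = th / tau * frob2 (Lm x *m y a))%R.
    rewrite /frob2 mulr_sumr; apply: eq_bigr => i _.
    rewrite (GE _ _ (enum_valP a)) enum_valK_in big_ord1 !exprMn cc2 sqr_sqrtr//; field.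
    by rewrite gt_eqF.
  have := Wop (sigU x) (Num.sqrt 2 *: sigZ x)%R (y a) wn0.
  rewrite -/(Lm x) => /(ler_wpM2l (divr_ge0 th0 (ltW tau0))) Hy.
  apply: le_trans Hy _.
  rewrite mulrA divfK ?gt_eqF// le_eqVlt; apply/orP; left; apply/eqP; congr (_ * _)%R.
  by apply: eq_bigr => l _; rewrite big_ord1 mxE.
apply: (@le_trans _ _ (\int[mu]_x (expR (th * \sum_e h e ^+ 2))%:E)).
  apply: ge0_le_integral => //.
  - by move=> x _; rewrite lee_fin mulr_ge0// expR_ge0.
  - apply/measurable_EFinP; apply: measurable_funM => //; apply: measurableT_comp => //.
    apply: measurable_sum => e; apply: measurable_funM; last exact: measurable_cst.
    exact: measurable_funX.
  - move=> x _; rewrite lee_fin (le_trans (wle x))// ler_piMl ?expR_ge0//.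
    by have /andP[] := W01 (sigU x) (Num.sqrt 2 *: sigZ x)%R.
by rewrite integral_cst// [X in _ * X]probability_setT mule1.
Qed.

End SpikedNoise.

(** * Transfer between the sample space and the coordinate space *)

Section Law.
Context {R : realType} (n p r : nat) d (Omega : measurableType d).
Variables (P : probability Omega R).
Variables (U : Omega -> 'M[R]_(n, r)) (Z Zt : Omega -> 'M[R]_(n, p)).
Hypothesis HG : gauss_entries P U Z Zt.
Notation I := (noise_idx n p r).

Definition noise_map (w : Omega) : cfg R I := fun k =>
  match k with
  | inl e => U w e.1 e.2
  | inr (inl e) => Z w e.1 e.2
  | inr (inr e) => Zt w e.1 e.2
  end.

Lemma measurable_noise_map : measurable_fun setT noise_map.
Proof.
have [_ nG] := HG; apply: measurable_cfg => k.
by have [+ _] := nG k; case: k => [e|[e|e]].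
Qed.

Lemma noise_mapU w : sigU (noise_map w) = U w.
Proof. by apply/matrixP => i j; rewrite mxE. Qed.

Lemma noise_mapZ w : sigZ (noise_map w) = Z w.
Proof. by apply/matrixP => i j; rewrite mxE. Qed.

Lemma noise_mapT w : sigT (noise_map w) = Zt w.
Proof. by apply/matrixP => i j; rewrite mxE. Qed.

(** Independence and normality of the entries say precisely that the image of [P] gives boxes
    product measure. All deviation bounds are proved for that image and pulled back along
    [noise_map]. *)
Lemma exists_gaussian_law : exists mu : probability (cfg R I) R,
  gaussian_law mu /\ forall F, measurable_fun setT F -> (forall x, 0 <= F x)%E ->
  (\int[P]_w F (noise_map w) = \int[mu]_x F x)%E.
Proof.
pose X : {mfun Omega >-> cfg R I} :=
  HB.pack noise_map (isMeasurableFun.Build _ _ _ _ _ measurable_noise_map).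
exists (distribution P X); split => [B mB|F mF F0]; last first.
  by rewrite ge0_integral_distribution.
have [iG nG] := HG; rewrite /distribution/= /pushforward.
have XB : X @^-1` box B = \bigcap_(i in [set j | j \in [set: I]%SET]) ((fun w => noise_map w i) @^-1` B i).
  apply/seteqP; split => w /=; first by move=> H i _; exact: H.
  by move=> H i; apply: H; rewrite /= inE.
rewrite [LHS](congr1 P XB).
have := iG [set: I]%SET B mB.
have -> : (\prod_i normal_prob 0 1 (B i))%E = (\prod_(i in [set: I]%SET)
   P ((fun w => noise_map w i) @^-1` B i))%E.
  apply: eq_big => [i|i _]; first by rewrite inE.
  have [_ H] := nG i; rewrite -(H _ (mB i)).
  by case: i {H} => [e|[e|e]].
move=> H; have e k : (match k with inl ij => fun w => U w ij.1 ij.2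
   | inr (inl ij) => fun w => Z w ij.1 ij.2
   | inr (inr ij) => fun w => Zt w ij.1 ij.2 end) = (fun w => noise_map w k).
  by case: k => [f|[f|f]].
transitivity (P (\bigcap_(i in [set j | j \in [set: I]%SET]) ((match i with inl ij => fun w => U w ij.1 ij.2
   | inr (inl ij) => fun w => Z w ij.1 ij.2
   | inr (inr ij) => fun w => Zt w ij.1 ij.2 end) @^-1` B i))).
  by congr (P _); apply: eq_bigcapr => i _; rewrite e.
by rewrite H; apply: eq_bigr => i _; rewrite e.
Qed.

End Law.

(** * Frobenius and operator norms *)

Section Frobenius.
Variable R : realType.

Lemma sum_Cauchy_Schwarz (I : finType) (a b : I -> R) :
  (\sum_i a i * b i) ^+ 2 <= (\sum_i a i ^+ 2) * (\sum_i b i ^+ 2).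
Proof.
set A := \sum_i a i ^+ 2; set B := \sum_i b i ^+ 2; set C := \sum_i a i * b i.
have A0 : 0 <= A by apply: sumr_ge0 => i _; exact: sqr_ge0.
have B0 : 0 <= B by apply: sumr_ge0 => i _; exact: sqr_ge0.
have quad t : 0 <= B * t ^+ 2 - 2 * C * t + A.
  have -> : B * t ^+ 2 - 2 * C * t + A = \sum_i (a i - t * b i) ^+ 2.
    have -> : \sum_i (a i - t * b i) ^+ 2 =
        \sum_i (t ^+ 2 * b i ^+ 2 + (- (2 * t)) * (a i * b i) + a i ^+ 2).
      by apply: eq_bigr => i _; ring.
    by rewrite !big_split/= -!mulr_sumr -/A -/B -/C; ring.
  by apply: sumr_ge0 => i _; exact: sqr_ge0.
have [B00|Bn0] := eqVneq B 0.
  have [->|Cn0] := eqVneq C 0; first by rewrite expr0n/= mulr_ge0.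
  have := quad ((A + 1) / (2 * C)).
  have -> : B * ((A + 1) / (2 * C)) ^+ 2 - 2 * C * ((A + 1) / (2 * C)) + A = - 1.
    by rewrite B00; field.
  by rewrite oppr_ge0 ler10.
have := quad (C / B).
have -> : B * (C / B) ^+ 2 - 2 * C * (C / B) + A = A - C ^+ 2 / B by field.
by rewrite subr_ge0 ler_pdivrMr// lt_neqAle eq_sym Bn0.
Qed.

Definition fdot m n (A B : 'M[R]_(m, n)) : R := \sum_i \sum_j A i j * B i j.
Definition fnorm m n (A : 'M[R]_(m, n)) : R := Num.sqrt (frob2 A).

Lemma fdotE m n (A B : 'M[R]_(m, n)) : fdot A B = \sum_e A e.1 e.2 * B e.1 e.2.
Proof. by rewrite /fdot pair_bigA. Qed.

Lemma frob2E m n (A : 'M[R]_(m, n)) : frob2 A = \sum_e A e.1 e.2 ^+ 2.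
Proof. by rewrite /frob2 pair_bigA. Qed.

Lemma frob2_ge0 m n (A : 'M[R]_(m, n)) : 0 <= frob2 A.
Proof. by rewrite frob2E; apply: sumr_ge0 => i _; exact: sqr_ge0. Qed.

Lemma fdotAA m n (A : 'M[R]_(m, n)) : fdot A A = frob2 A.
Proof. by rewrite fdotE frob2E; apply: eq_bigr => e _; rewrite expr2. Qed.

Lemma fdotC m n (A B : 'M[R]_(m, n)) : fdot A B = fdot B A.
Proof. by rewrite !fdotE; apply: eq_bigr => e _; rewrite mulrC. Qed.

Lemma fdotDl m n (A B D : 'M[R]_(m, n)) : fdot (A + B) D = fdot A D + fdot B D.
Proof.
by rewrite !fdotE -big_split; apply: eq_bigr => e _; rewrite mxE mulrDl.
Qed.

Lemma fdotZl m n a (A D : 'M[R]_(m, n)) : fdot (a *: A) D = a * fdot A D.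
Proof. by rewrite !fdotE mulr_sumr; apply: eq_bigr => e _; rewrite mxE mulrA. Qed.

Lemma fdotNl m n (A D : 'M[R]_(m, n)) : fdot (- A) D = - fdot A D.
Proof. by rewrite -scaleN1r fdotZl mulN1r. Qed.

Lemma fdotDr m n (A B D : 'M[R]_(m, n)) : fdot D (A + B) = fdot D A + fdot D B.
Proof. by rewrite fdotC fdotDl !(fdotC _ D). Qed.

Lemma fdotNr m n (A D : 'M[R]_(m, n)) : fdot D (- A) = - fdot D A.
Proof. by rewrite fdotC fdotNl fdotC. Qed.

Lemma fdotZr m n a (A D : 'M[R]_(m, n)) : fdot D (a *: A) = a * fdot D A.
Proof. by rewrite fdotC fdotZl fdotC. Qed.

Lemma fdot_tr m n (A B : 'M[R]_(m, n)) : fdot A B = \tr (A^T *m B).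
Proof.
rewrite /fdot exchange_big; apply: eq_bigr => j _.
by rewrite mxE; apply: eq_bigr => i _; rewrite mxE.
Qed.

Lemma frob2_trmx m n (A : 'M[R]_(m, n)) : frob2 A^T = frob2 A.
Proof.
by rewrite /frob2 exchange_big; do 2 (apply: eq_bigr => ? _); rewrite mxE.
Qed.

Lemma frob2Z m n a (A : 'M[R]_(m, n)) : frob2 (a *: A) = a ^+ 2 * frob2 A.
Proof. by rewrite -!fdotAA fdotZl fdotZr mulrA expr2. Qed.

Lemma frob2N m n (A : 'M[R]_(m, n)) : frob2 (- A) = frob2 A.
Proof. by rewrite -scaleN1r frob2Z sqrrN expr1n mul1r. Qed.

Lemma frob2_0 m n : frob2 (0 : 'M[R]_(m, n)) = 0.
Proof. by rewrite -(scale0r 0) frob2Z expr0n mul0r. Qed.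

Lemma frob2_eq0 m n (A : 'M[R]_(m, n)) : frob2 A = 0 -> A = 0.
Proof.
rewrite frob2E => /eqP; rewrite psumr_eq0 => [/allP H|e _]; last exact: sqr_ge0.
apply/matrixP => i j; have := H (i, j) (mem_index_enum _).
by rewrite /= sqrf_eq0 mxE => /eqP.
Qed.

Lemma frob2D m n (A B : 'M[R]_(m, n)) :
  frob2 (A + B) = frob2 A + 2 * fdot A B + frob2 B.
Proof. by rewrite -!fdotAA fdotDl !fdotDr (fdotC B A); ring. Qed.

Lemma fdot_CS m n (A B : 'M[R]_(m, n)) : fdot A B ^+ 2 <= frob2 A * frob2 B.
Proof. rewrite fdotE !frob2E; exact: sum_Cauchy_Schwarz. Qed.

Lemma fdot_AMGM m n (A B : 'M[R]_(m, n)) a : 0 < a ->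
  2 * fdot A B <= a * frob2 A + a^-1 * frob2 B.
Proof.
move=> a0; have := frob2_ge0 (Num.sqrt a *: A - (Num.sqrt a)^-1 *: B).
rewrite frob2D frob2N fdotNr fdotZl fdotZr !frob2Z exprVn (sqr_sqrtr (ltW a0)).
rewrite mulrA mulfV ?mul1r ?gt_eqF ?sqrtr_gt0// => H.
by move: H; lra.
Qed.

Lemma frob2D_le m n (A B : 'M[R]_(m, n)) a : 0 < a ->
  frob2 (A + B) <= (1 + a) * frob2 A + (1 + a^-1) * frob2 B.
Proof. by move=> a0; have := fdot_AMGM A B a0; rewrite frob2D => H; lra. Qed.

Lemma fnorm_ge0 m n (A : 'M[R]_(m, n)) : 0 <= fnorm A.
Proof. exact: sqrtr_ge0. Qed.

Lemma sqr_fnorm m n (A : 'M[R]_(m, n)) : fnorm A ^+ 2 = frob2 A.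
Proof. by rewrite sqr_sqrtr// frob2_ge0. Qed.

Lemma fnorm0 m n : fnorm (0 : 'M[R]_(m, n)) = 0.
Proof. by rewrite /fnorm frob2_0 sqrtr0. Qed.

Lemma fnormZ m n a (A : 'M[R]_(m, n)) : fnorm (a *: A) = `|a| * fnorm A.
Proof. by rewrite /fnorm frob2Z sqrtrM ?sqr_ge0// sqrtr_sqr. Qed.

Lemma fnormN m n (A : 'M[R]_(m, n)) : fnorm (- A) = fnorm A.
Proof. by rewrite /fnorm frob2N. Qed.

Lemma fnorm_le m n m' n' (A : 'M[R]_(m, n)) (B : 'M[R]_(m', n')) c : 0 <= c ->
  (fnorm A <= c * fnorm B) = (frob2 A <= c ^+ 2 * frob2 B).
Proof.
move=> c0; rewrite -!sqr_fnorm -exprMn ler_sqr// nnegrE ?mulr_ge0 ?fnorm_ge0//.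
Qed.

Lemma fdot_le m n (A B : 'M[R]_(m, n)) : fdot A B <= fnorm A * fnorm B.
Proof.
have [h|h] := leP (fdot A B) 0; first by rewrite (le_trans h)// mulr_ge0 ?fnorm_ge0.
rewrite -ler_sqr ?nnegrE ?mulr_ge0 ?fnorm_ge0//; last exact: ltW.
by rewrite exprMn !sqr_fnorm fdot_CS.
Qed.

Lemma fnormD m n (A B : 'M[R]_(m, n)) : fnorm (A + B) <= fnorm A + fnorm B.
Proof.
rewrite -ler_sqr ?nnegrE ?addr_ge0 ?fnorm_ge0// sqr_fnorm frob2D sqrrD !sqr_fnorm.
by have := fdot_le A B; rewrite -mulr_natl => H; lra.
Qed.

Lemma fnormB_ge m n (A B : 'M[R]_(m, n)) : fnorm A - fnorm B <= fnorm (A + B).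
Proof.
rewrite lerBlDr -[X in fnorm X](addrK B) (le_trans (fnormD _ _))// fnormN.
by rewrite lerD2r.
Qed.

Lemma frob2_mul m n k (A : 'M[R]_(m, n)) (B : 'M[R]_(n, k)) :
  frob2 (A *m B) <= frob2 A * frob2 B.
Proof.
rewrite {1}/frob2 {1}/frob2 mulr_suml; apply: ler_sum => i _.
rewrite -[X in _ * X]frob2_trmx /frob2 mulr_sumr; apply: ler_sum => j _.
rewrite mxE; apply: le_trans (sum_Cauchy_Schwarz _ _) _.
by rewrite ler_wpM2l ?sumr_ge0// => [? _|]; rewrite ?sqr_ge0//;
  apply: ler_sum => l _; rewrite mxE.
Qed.

Lemma fnorm_mul m n k (A : 'M[R]_(m, n)) (B : 'M[R]_(n, k)) :
  fnorm (A *m B) <= fnorm A * fnorm B.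
Proof. by rewrite /fnorm -sqrtrM ?frob2_ge0// ler_wsqrtr// frob2_mul. Qed.

Lemma entry_le_fnorm m n (A : 'M[R]_(m, n)) i j : `|A i j| <= fnorm A.
Proof.
rewrite -sqrtr_sqr ler_wsqrtr// frob2E (bigD1 (i, j))//= lerDl sumr_ge0// => e _.
exact: sqr_ge0.
Qed.

Lemma fnorm_le_sum m n (A : 'M[R]_(m, n)) c : (forall i j, `|A i j| <= c) ->
  fnorm A <= (m * n)%:R * c.
Proof.
move=> Ac; have [|] := posnP (m * n).
  move=> mn0; rewrite /fnorm frob2E big1 ?sqrtr0 ?mn0 ?mul0r// => e _.
  by exfalso; have := card_prod 'I_m 'I_n; rewrite !card_ord mn0 => /eqP /pred0P /(_ e).
move=> mn0; have c0 : 0 <= c.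
  case: m n mn0 A Ac => [//|m] [|n] mn0 A Ac; first by rewrite muln0 in mn0.
  exact: le_trans (normr_ge0 _) (Ac 0 0).
have mn1 : 1 <= (m * n)%:R :> R by rewrite ler1n.
rewrite -(@ger0_norm _ (_ * c)) ?mulr_ge0// -sqrtr_sqr ler_wsqrtr// frob2E exprMn.
apply: (@le_trans _ _ (\sum_(e : 'I_m * 'I_n) c ^+ 2)).
  by apply: ler_sum => e _; rewrite -real_normK ?num_real// ler_sqr ?nnegrE.
rewrite sumr_const card_prod !card_ord -[X in X <= _]mulr_natl ler_wpM2r ?sqr_ge0//.
by rewrite expr2 ler_peMl.
Qed.

Lemma frob2_isometry m n k (L : 'M[R]_(m, n)) (A : 'M[R]_(n, k)) :
  L^T *m L = 1%:M -> frob2 (L *m A) = frob2 A.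
Proof.
move=> LL; rewrite -!fdotAA !fdot_tr trmx_mul -mulmxA (mulmxA L^T) LL mul1mx.
by [].
Qed.

Lemma frob2_isometryT m n k (L : 'M[R]_(m, n)) (A : 'M[R]_(m, k)) :
  L^T *m L = 1%:M -> frob2 (L^T *m A) <= frob2 A.
Proof.
move=> LL; have := frob2_ge0 (A - L *m (L^T *m A)).
rewrite frob2D frob2N fdotNr (frob2_isometry _ LL).
have -> : fdot A (L *m (L^T *m A)) = frob2 (L^T *m A).
  by rewrite -fdotAA !fdot_tr trmx_mul trmxK mulmxA.
by move=> H; lra.
Qed.

End Frobenius.

Section OperatorNorm.
Variable R : realType.

Definition opnorm m n (A : 'M[R]_(m, n)) : R :=
  sup [set fnorm (A *m y) | y in [set y : 'cV[R]_n | fnorm y <= 1]].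

Lemma opnorm_has_sup m n (A : 'M[R]_(m, n)) :
  has_sup [set fnorm (A *m y) | y in [set y : 'cV[R]_n | fnorm y <= 1]].
Proof.
split; first by exists (fnorm (A *m (0 : 'cV_n))), 0 => //=; rewrite fnorm0.
exists (fnorm A) => _ [y /= y1 <-]; apply: le_trans (fnorm_mul _ _) _.
by rewrite ler_piMr// fnorm_ge0.
Qed.

Lemma opnorm_ge0 m n (A : 'M[R]_(m, n)) : 0 <= opnorm A.
Proof.
apply: le_trans (ub_le_sup (opnorm_has_sup A).2 (x := fnorm (A *m (0 : 'cV_n))) _).
  exact: fnorm_ge0.
by exists 0 => //=; rewrite fnorm0.
Qed.

Lemma opnorm_mul m n (A : 'M[R]_(m, n)) (y : 'cV[R]_n) :
  fnorm (A *m y) <= opnorm A * fnorm y.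
Proof.
have [y0|yn0] := eqVneq (fnorm y) 0.
  have -> : y = 0 by apply: frob2_eq0; rewrite -sqr_fnorm y0 expr0n.
  by rewrite mulmx0 !fnorm0 mulr0.
have y0 : 0 < fnorm y by rewrite lt_neqAle eq_sym yn0 fnorm_ge0.
rewrite -ler_pdivrMr// mulrC -[X in X * _]ger0_norm ?invr_ge0 ?fnorm_ge0// -fnormZ scalemxAr.
apply: (ub_le_sup (opnorm_has_sup A).2); exists ((fnorm y)^-1 *: y) => //=.
by rewrite fnormZ ger0_norm ?invr_ge0 ?fnorm_ge0// mulVf.
Qed.

Lemma opnorm_le m n (A : 'M[R]_(m, n)) c : 0 <= c ->
  (forall y : 'cV[R]_n, fnorm (A *m y) <= c * fnorm y) -> opnorm A <= c.
Proof.
move=> c0 H; apply: ge_sup; first exact: (opnorm_has_sup A).1.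
by move=> _ [y /= y1 <-]; rewrite (le_trans (H y))// ler_piMr.
Qed.

Lemma opnormD m n (A B : 'M[R]_(m, n)) : opnorm (A + B) <= opnorm A + opnorm B.
Proof.
apply: opnorm_le => [|y]; first by rewrite addr_ge0 ?opnorm_ge0.
by rewrite mulmxDl (le_trans (fnormD _ _))// mulrDl lerD ?opnorm_mul.
Qed.

Lemma opnormZ_le m n a (A : 'M[R]_(m, n)) : opnorm (a *: A) <= `|a| * opnorm A.
Proof.
apply: opnorm_le => [|y]; first by rewrite mulr_ge0 ?opnorm_ge0.
by rewrite -scalemxAl fnormZ -mulrA ler_wpM2l ?opnorm_mul.
Qed.

Lemma opnormZ m n a (A : 'M[R]_(m, n)) : opnorm (a *: A) = `|a| * opnorm A.
Proof.
apply/eqP; rewrite eq_le opnormZ_le/=; have [->|a0] := eqVneq a 0.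
  by rewrite normr0 mul0r opnorm_ge0.
rewrite -ler_pdivlMl ?normr_gt0// -normfV.
by have := opnormZ_le a^-1 (a *: A); rewrite scalerA mulVf// scale1r.
Qed.

Lemma opnorm_le_fnorm m n (A : 'M[R]_(m, n)) : opnorm A <= fnorm A.
Proof. by apply: opnorm_le => [|y]; rewrite ?fnorm_ge0 ?fnorm_mul. Qed.

Lemma opnorm_cV n (y : 'cV[R]_n) : opnorm y = fnorm y.
Proof.
apply/eqP; rewrite eq_le opnorm_le_fnorm/=.
have := opnorm_mul y (1%:M : 'cV[R]_1); rewrite mulmx1.
by rewrite [fnorm 1%:M]/fnorm /frob2 !big_ord1 mxE eqxx expr1n sqrtr1 mulr1.
Qed.

Lemma entry_le_opnorm m n (A : 'M[R]_(m, n)) i j : `|A i j| <= opnorm A.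
Proof.
have := opnorm_mul A (delta_mx j 0); rewrite -colE.
have -> : fnorm (delta_mx j 0 : 'cV[R]_n) = 1.
  rewrite /fnorm /frob2 (bigD1 j)//= big_ord1 mxE !eqxx expr1n big1 ?addr0 ?sqrtr1//.
  by move=> l lj; rewrite big_ord1 mxE (negPf lj) expr0n.
rewrite mulr1; apply: le_trans.
by apply: le_trans (entry_le_fnorm _ i 0); rewrite mxE.
Qed.

End OperatorNorm.

(** * Nets of unit balls and measurability of the operator norm *)

Section Nets.
Variable R : realType.

(* Reducing both coordinates of a lattice modulo [M] maps a ball of radius about
   [1] injectively into (ball of radius [rho]) x [0, M)^D, so a [2 rho]-separated
   set of lattice points of the unit ball, whose translates of the [rho]-ball are
   disjoint, has at most M^D points *)
Lemma exists_net (d c : nat) (N : 'M[R]_(d, c) -> R) (H eps : R) (M : nat) :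
  0 < eps < 1 -> 1 + 8 / eps <= M%:R ->
  (forall A B, N (A + B) <= N A + N B) -> (forall a A, N (a *: A) = `|a| * N A) ->
  (forall (A : 'M[R]_(d, c)) i j, `|A i j| <= N A) ->
  (forall (A : 'M[R]_(d, c)) b, (forall i j, `|A i j| <= b) -> N A <= H * b) ->
  exists s : seq 'M[R]_(d, c), [/\ (size s <= M ^ (d * c))%N,
    forall a, a \in s -> N a <= 1 &
    forall a, N a <= 1 -> exists2 b, b \in s & N (a - b) <= eps].
Proof.
move=> /andP[eps0 eps1] Meps ND NZ Nent Nle; pose rho := eps / 4.
have natZ (k : nat) : k%:R = (k%:Z)%:~R :> R by rewrite pmulrn.
have rho0 : 0 < rho by rewrite /rho; lra.
have N0 : N 0 = 0 by rewrite -(scale0r 0) NZ normr0 mul0r.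
have NN A : N (- A) = N A by rewrite -scaleN1r NZ normrN1 mul1r.
have NBC A B : N (A - B) = N (B - A) by rewrite -opprB NN.
have N_ge0 A : 0 <= N A by have := ND A (- A); rewrite subrr N0 NN => h; lra.
pose h := `|H|.
have Nh (A : 'M[R]_(d, c)) b : 0 <= b -> (forall i j, `|A i j| <= b) -> N A <= h * b.
  by move=> b0 Ab; rewrite (le_trans (Nle _ _ Ab))// ler_wpM2r// ler_norm.
have M1 : 1 <= M%:R :> R by rewrite (le_trans _ Meps)// lerDl divr_ge0// ltW.
have M0 : 0 < M%:R :> R by exact: lt_le_trans M1.
have MrhoM : 2 + rho <= rho * M%:R.
  have : rho * (1 + 8 / eps) <= rho * M%:R by rewrite ler_wpM2l// ltW.
  by apply: le_trans; rewrite /rho le_eqVlt; apply/orP; left; apply/eqP; field; rewrite gt_eqF.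
(* The mesh [1 / q] is so fine that a lattice cell magnified [M] times still has size at most [rho];
   the constant [H] therefore stays out of the final count. *)
pose q := (Num.truncn (h * M%:R / rho)).+1.
have q0 : 0 < q%:R :> R by rewrite ltr0n.
have hMq : h * (M%:R / q%:R) <= rho.
  rewrite mulrA ler_pdivrMr// -ler_pdivrMl// mulrC; apply/ltW.
  by rewrite /q; apply: truncnS_gt.
have hq : h * q%:R^-1 <= rho.
  by apply: le_trans hMq; rewrite ler_wpM2l ?normr_ge0// ler_peMl ?invr_ge0 ?(ltW q0).
pose G := 'M['I_(2 * q).+1]_(d, c).
pose zi (g : G) : 'M[int]_(d, c) := \matrix_(i, j) ((g i j)%:Z - q%:Z).
pose rv (w : 'M[int]_(d, c)) : 'M[R]_(d, c) := \matrix_(i, j) ((w i j)%:~R / q%:R).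
pose toG (w : 'M[int]_(d, c)) : G := \matrix_(i, j) inord `|(w i j + q%:Z)%R|%N.
pose v g := rv (zi g).
have zi_inj : injective zi.
  move=> x y xy; apply/matrixP => i j; apply: val_inj.
  have := congr1 (fun A : 'M[int]_(d, c) => A i j) xy; rewrite !mxE => /addIr.
  by case.
have rvD w w' : rv (w + w') = rv w + rv w'.
  by apply/matrixP => i j; rewrite !mxE intrD mulrDl.
have toGK w : N (rv w) <= 1 -> zi (toG w) = w.
  move=> w1; apply/matrixP => i j.
  have := le_trans (Nent (rv w) i j) w1; rewrite mxE normrM normfV (ger0_norm (ltW q0)).
  rewrite ler_pdivrMr// mul1r -intr_norm (natZ q) ler_int ler_norml => /andP[wl wu].
  rewrite !mxE inordK; last by lia.
  by lia.
pose Q (A : {set G}) := [forall x in A, N (v x) <= 1] &&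
  [forall x in A, [forall y in A, (x != y) ==> (2 * rho < N (v x - v y))]].
(* A maximal separated set of lattice points of the unit ball: separation bounds its cardinality,
   maximality makes it a net. *)
have [P /maxsetP[/andP[/forall_inP P1 /forall_inP P2] Pmax]] : {A | maxset Q A}.
  apply: ex_maxset; exists finset.set0; apply/andP; split; apply/forall_inP => x; by rewrite inE.
have sepP x y : x \in P -> y \in P -> N (v x - v y) <= 2 * rho -> x = y.
  move=> xP yP; have /forall_inP/(_ y yP) := P2 x xP.
  by have [->//|_ /= lt] := eqVneq x y; rewrite leNgt lt.
exists [seq v x | x <- enum P]; split.
- rewrite size_map -cardE.
  pose Y : {set G} := [set y : G | N (v y) <= rho]%SET.
  have [m Mm] : exists m, M = m.+1.
    by case: (M) M0 => [|m _]; [rewrite ltxx|exists m].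
  have absM (a : int) : 0 <= a -> a < M%:Z -> (`|a| < m.+1)%N.
    by clear -Mm; lia.
  pose dv (w : 'M[int]_(d, c)) : 'M[int]_(d, c) := \matrix_(i, j) (w i j %/ M%:Z)%Z.
  pose md (w : 'M[int]_(d, c)) : 'M[int]_(d, c) := \matrix_(i, j) (w i j %% M%:Z)%Z.
  pose mo (w : 'M[int]_(d, c)) : 'M['I_m.+1]_(d, c) := \matrix_(i, j) inord `|(w i j %% M%:Z)%Z|%N.
  have md_bnd w i j : 0 <= md w i j < M%:Z.
    by rewrite mxE modz_ge0 ?ltz_pmod// Mm.
  have NdvY w : N (rv w) <= 1 + rho -> N (rv (dv w)) <= rho.
    move=> w1.
    have -> : rv (dv w) = M%:R^-1 *: (rv w - rv (md w)).
      apply/matrixP => i j; rewrite !mxE {2}(divz_eq (w i j) M%:Z) intrD intrM.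
      by rewrite -mulrBl addrK (natZ M); field; rewrite -?natZ !gt_eqF.
    rewrite NZ ger0_norm ?invr_ge0 ?(ltW M0)// ler_pdivrMl// mulrC.
    apply: le_trans MrhoM; apply: (@le_trans _ _ (1 + rho + rho)).
      apply: le_trans (ND _ _) _; rewrite NN lerD//.
      apply: le_trans hMq; apply: Nh => [|i j].
        by rewrite divr_ge0// ltW.
      have /andP[m0 m1] := md_bnd w i j.
      rewrite [rv _ _ _]mxE normrM normfV (ger0_norm (ltW q0)) ler_wpM2r ?invr_ge0 ?(ltW q0)//.
      by rewrite ger0_norm ?ler0z// (natZ M) ler_int ltW.
    by rewrite /rho; lra.
  (* Quotient and remainder of the sum modulo [M]. The quotient falls back into [Y], and the pair
     determines the sum, hence both summands by separation. Therefore
     [#|P| * #|Y| <= #|Y| * M ^ (d * c)]. *)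
  pose phi (e : G * G) : G * 'M['I_m.+1]_(d, c) :=
    (toG (dv (zi e.1 + zi e.2)), mo (zi e.1 + zi e.2)).
  have Nsum x y : x \in P -> y \in Y -> N (rv (zi x + zi y)) <= 1 + rho.
    move=> xP; rewrite inE => yY; rewrite rvD (le_trans (ND _ _))// lerD//.
    exact: P1.
  have dvK x y : x \in P -> y \in Y ->
      zi (toG (dv (zi x + zi y))) = dv (zi x + zi y).
    move=> xP yY; apply: toGK; apply: le_trans (NdvY _ (Nsum _ _ xP yY)) _.
    by rewrite /rho; lra.
  have phi_inj : {in finset.setX P Y &, injective phi}.
    move=> [x y] [x' y']; rewrite !inE /= => /andP[xP yY] /andP[xP' yY'] [e1 e2].
    have eY : y \in Y by rewrite inE.
    have eY' : y' \in Y by rewrite inE.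
    have zz : zi x + zi y = zi x' + zi y'.
      have ed := dvK x y xP eY; rewrite e1 (dvK x' y' xP' eY') in ed.
      apply/matrixP => i j.
      rewrite [LHS](divz_eq _ M%:Z) [RHS](divz_eq _ M%:Z).
      have := congr1 (fun A : 'M[int]_(d, c) => A i j) ed; rewrite ![dv _ _ _]mxE => ->.
      congr (_ + _).
      have := congr1 (fun A : 'M['I_m.+1]_(d, c) => nat_of_ord (A i j)) e2.
      have /andP[a0 a1] := md_bnd (zi x + zi y) i j.
      have /andP[b0 b1] := md_bnd (zi x' + zi y') i j.
      move: a0 a1 b0 b1; rewrite ![md _ _ _]mxE ![mo _ _ _]mxE.
      set a := (_ %% _)%Z; set b := (_ %% _)%Z => a0 a1 b0 b1.
      rewrite !inordK ?absM// => /(congr1 Posz).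
      by rewrite !gez0_abs.
    have vv : v x - v x' = v y' - v y.
      by apply/eqP; rewrite subr_eq addrAC -subr_eq opprK -!rvD zz addrC.
    have xx : x = x'.
      apply: sepP => //; rewrite vv (le_trans (ND _ _))// NN mulrDl mul1r.
      by rewrite lerD.
    by move: zz; rewrite xx => /addrI /zi_inj ->.
  have : (#|P| * #|Y| <= #|Y| * M ^ (d * c))%N.
    rewrite -cardsX -(card_in_imset phi_inj).
    apply: (@leq_trans #|finset.setX Y [set: 'M['I_m.+1]_(d, c)]%SET|).
      apply: subset_leq_card; apply/fintype.subsetP => _ /imsetP[[x y] + ->].
      rewrite !inE /= => /andP[xP yY]; rewrite andbT.
      have eY : y \in Y by rewrite inE.
      by rewrite /v dvK// NdvY// Nsum.
    by rewrite cardsX cardsT card_mx card_ord Mm.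
  rewrite mulnC leq_pmul2l// card_gt0; apply/finset.set0Pn; exists (toG 0).
  by rewrite inE /v toGK (_ : rv 0 = 0) ?N0 ?ltW//; apply/matrixP => i j; rewrite !mxE mul0r.
- by move=> a /mapP[x]; rewrite mem_enum => /P1 + ->.
(* Shrinking first leaves room for rounding to the lattice inside the unit ball. The distance from
   [a] to the rounded point and from there to [P] are each at most [2 * rho = eps / 2]. *)
move=> a a1; pose a' := (1 - rho) *: a.
pose w : 'M[int]_(d, c) := \matrix_(i, j) Num.floor (q%:R * a' i j).
have wa' : N (rv w - a') <= rho.
  apply: le_trans hq; apply: Nh => [|i j]; first by rewrite invr_ge0 ltW.
  rewrite !mxE ler_norml; set x := (1 - rho) * a i j.
  have := floor_itv (q%:R * x); rewrite intrD mulr1z; set f := (_%:~R) => /andP[fl fu].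
  rewrite lerBrDr lerBlDr ler_pdivlMr// ler_pdivrMr// !mulrDl mulNr mulVf ?gt_eqF//.
  by apply/andP; split; move: fl fu; rewrite mulrC; lra.
have rho1 : 0 <= 1 - rho by rewrite /rho; lra.
have w1 : N (rv w) <= 1.
  rewrite -(subrK a' (rv w)) (le_trans (ND _ _))// NZ ger0_norm//.
  have : (1 - rho) * N a <= 1 - rho by rewrite ler_piMr.
  by lra.
have vg : v (toG w) = rv w by rewrite /v toGK.
have aw : N (a - rv w) <= 2 * rho.
  have -> : a - rv w = rho *: a + (a' - rv w).
    by rewrite /a' scalerBl scale1r addrA addrCA subrr addr0.
  rewrite (le_trans (ND _ _))// NZ (gtr0_norm rho0) NBC mulrDl mul1r lerD//.
  by rewrite ler_piMr// ltW.
have [x xP xg] : exists2 x, x \in P & N (v x - v (toG w)) <= 2 * rho.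
  have [gP|gP] := boolP (toG w \in P).
    by exists (toG w) => //; rewrite subrr N0; rewrite mulr_ge0// ltW.
  apply: contrapT => nex.
  have far x : x \in P -> 2 * rho < N (v x - v (toG w)).
    by move=> xP; rewrite ltNge; apply/negP => le; apply: nex; exists x.
  have := Pmax (toG w |: P)%SET; rewrite /Q => Hm.
  have : toG w \in P.
    have <- : (toG w |: P)%SET = P; last by rewrite !inE eqxx.
    apply: Hm; last exact: finset.subsetUr.
    apply/andP; split; apply/forall_inP => x; rewrite !inE => /orP[/eqP ->|xP].
    - by rewrite vg.
    - exact: P1.
    - apply/forall_inP => y; rewrite !inE => /orP[/eqP ->|yP]; first by rewrite eqxx.
      by rewrite NBC far// implybT.
    - apply/forall_inP => y; rewrite !inE => /orP[/eqP ->|yP]; first by rewrite far// implybT.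
      by have /forall_inP/(_ y yP) := P2 x xP.
  by rewrite (negPf gP).
exists (v x); first by apply/mapP; exists x => //; rewrite mem_enum.
have -> : a - v x = (a - rv w) + (rv w - v x) by rewrite addrA subrK.
apply: le_trans (ND _ _) _.
have xw : N (rv w - v x) <= 2 * rho by rewrite NBC -vg.
have : 2 * rho + 2 * rho = eps by rewrite /rho; field.
by move: aw xw; lra.
Qed.

End Nets.

Section OpnormNets.
Variable R : realType.

Lemma exists_opnorm_net (d c : nat) (eps : R) (M : nat) :
  0 < eps < 1 -> 1 + 8 / eps <= M%:R ->
  exists s : seq 'M[R]_(d, c), [/\ (size s <= M ^ (d * c))%N,
    forall a, a \in s -> opnorm a <= 1 &
    forall a, opnorm a <= 1 -> exists2 b, b \in s & opnorm (a - b) <= eps].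
Proof.
move=> e01 eM; apply: (@exists_net R d c (@opnorm R d c) (d * c)%:R eps M) => //.
- exact: opnormD.
- exact: opnormZ.
- exact: entry_le_opnorm.
- move=> A b Ab; apply: le_trans (opnorm_le_fnorm _) _; exact: fnorm_le_sum.
Qed.

(** The supremum [S] of [f] over the unit ball satisfies [S <= K + eps * S]; the bound [B] makes [S]
    finite, so this can be solved for [S]. *)
Lemma net_sup_bound (d c : nat) (s : seq 'M[R]_(d, c)) (eps : R)
    (f : 'M[R]_(d, c) -> R) (K B : R) : 0 <= eps < 1 ->
  (forall a, opnorm a <= 1 -> exists2 b, b \in s & opnorm (a - b) <= eps) ->
  (forall a b, f (a + b) <= f a + f b) -> (forall t a, 0 <= t -> f (t *: a) = t * f a) ->
  (forall b, b \in s -> f b <= K) -> (forall a, opnorm a <= 1 -> f a <= B) ->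
  forall a, opnorm a <= 1 -> f a <= K / (1 - eps).
Proof.
move=> /andP[e0 e1] net fD fZ fK fB a a1.
pose X := [set f b | b in [set b : 'M[R]_(d, c) | opnorm b <= 1]].
have op0 : opnorm (0 : 'M[R]_(d, c)) <= 1.
  by rewrite -(scale0r 0) opnormZ normr0 mul0r.
have supX : has_sup X.
  by split; [exists (f 0), 0|exists B => _ [b /= b1 <-]; exact: fB].
have fS b : opnorm b <= 1 -> f b <= sup X.
  by move=> b1; apply: ub_le_sup; [exact: supX.2|exists b].
have fsmall b : opnorm b <= eps -> f b <= eps * sup X.
  move=> be; have [e00|en0] := eqVneq eps 0.
    have b0 : opnorm b = 0 by apply/eqP; rewrite eq_le opnorm_ge0 -{1}e00 be.
    have -> : b = 0.
      apply/matrixP => i j; apply/eqP; rewrite mxE -normr_eq0 eq_le normr_ge0 andbT.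
      by rewrite -b0 entry_le_opnorm.
    by rewrite e00 mul0r -(scale0r 0) fZ// mul0r.
  have eg : 0 < eps by rewrite lt_neqAle eq_sym en0.
  have -> : b = eps *: (eps^-1 *: b) by rewrite scalerA mulfV// scale1r.
  rewrite fZ// ler_wpM2l// fS// opnormZ ger0_norm ?invr_ge0//.
  by rewrite ler_pdivrMl// mulr1.
have SK : sup X <= K + eps * sup X.
  apply: ge_sup; first exact: supX.1.
  move=> _ [b /= b1 <-]; have [b' b's bb'] := net b b1.
  rewrite -(subrK b' b) (le_trans (fD _ _))// addrC lerD ?fK//; exact: fsmall.
rewrite ler_pdivlMr ?subr_gt0//; apply: (@le_trans _ _ (sup X * (1 - eps))).
  by rewrite ler_wpM2r ?fS// subr_ge0 ltW.
by move: SK; lra.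
Qed.

(** The norm exceeds [c] exactly when a vector of one of countably many finite nets shows it, since
    the net of mesh [1 / (j + 2)] loses only the factor [1 - 1 / (j + 2)]. *)
Lemma measurable_opnorm dd (T : measurableType dd) (m n : nat) (f : T -> 'M[R]_(m, n)) :
  measurable_mx f -> measurable_fun setT (fun x => opnorm (f x)).
Proof.
move=> mf.
have nets (j : nat) : exists s : seq 'cV[R]_n, (forall a, a \in s -> opnorm a <= 1) /\
    (forall a, opnorm a <= 1 -> exists2 b, b \in s & opnorm (a - b) <= j.+2%:R^-1).
  have j01 : 0 < (j.+2%:R^-1 : R) < 1.
    by rewrite invr_gt0 ltr0n/= invf_lt1 ?ltr0n// ltr1n.
  have := @exists_opnorm_net n 1 _ (1 + 8 * j.+2) j01.
  by case=> [|s [_ s1 s2]]; [rewrite invrK natrD natrM|exists s].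
have [s Hs] := choice nets.
have mfy (y : 'cV[R]_n) : measurable_fun setT (fun x => fnorm (f x *m y)).
  apply: measurableT_comp; first by apply: continuous_measurable_fun; exact: sqrt_continuous.
  apply: measurable_sum => i; apply: measurable_sum => l; apply: measurable_funX.
  exact: (measurable_mxM mf (measurable_mx_cst _)).
apply: (measurability _ (RGenOInfty.measurableE R)).
move=> _ [_ [c ->] <-]; rewrite setTI.
have -> : (fun x => opnorm (f x)) @^-1` `]c, +oo[ =
    \bigcup_j [set x | has (fun y => c < fnorm (f x *m y)) (s j)].
  apply/seteqP; split => x /=; rewrite ?in_itv/= ?andbT.
    move=> cx; apply: contrapT => nH.
    have H j y : y \in s j -> fnorm (f x *m y) <= c.
      by move=> ys; rewrite leNgt; apply/negP => lt; apply: nH; exists j => //=; apply/hasP; exists y.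
    have op j (y : 'cV[R]_n) : opnorm y <= 1 -> fnorm (f x *m y) <= c / (1 - j.+2%:R^-1).
      apply: (@net_sup_bound n 1 (s j) (j.+2%:R^-1) (fun y => fnorm (f x *m y)) c (opnorm (f x))).
      - by rewrite invr_ge0 ler0n/= invf_lt1 ?ltr0n// ltr1n.
      - exact: (Hs j).2.
      - by move=> a b; rewrite mulmxDr fnormD.
      - by move=> t a t0; rewrite -scalemxAr fnormZ ger0_norm.
      - exact: H.
      - by move=> a a1; rewrite (le_trans (opnorm_mul _ _))// -opnorm_cV ler_piMr ?opnorm_ge0.
    have ley (y : 'cV[R]_n) : opnorm y <= 1 -> fnorm (f x *m y) <= c.
      move=> y1; apply/ler_addgt0Pr => e e0; rewrite -lerBlDr.
      set z := fnorm _; rewrite leNgt; apply/negP => lt.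
      pose j := Num.truncn (z / e).
      have j2 : 0 < j.+2%:R :> R by rewrite ltr0n.
      have zj : z / e < j.+2%:R.
        by apply: lt_trans (truncnS_gt (z / e)) _; rewrite ltr_nat.
      have := op j y y1; rewrite -/z ler_pdivlMr; last first.
        by rewrite subr_gt0 invf_lt1 ?ltr0n// ltr1n.
      rewrite leNgt mulrBr mulr1 => /negP; apply; apply: lt_le_trans lt _.
      by rewrite lerD2l lerN2 ler_pdivrMr// mulrC -ler_pdivrMr// ltW.
    have : opnorm (f x) <= c.
      apply: ge_sup; first exact: (opnorm_has_sup _).1.
      by move=> _ [y /= y1 <-]; apply: ley; rewrite opnorm_cV.
    by rewrite leNgt cx.
  move=> [j _ /= /hasP[y ys lt]]; apply: lt_le_trans lt _.
  by rewrite (le_trans (opnorm_mul _ _))// ler_piMr ?opnorm_ge0// -opnorm_cV (Hs j).1.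
apply: bigcupT_measurable => j.
elim: (s j) => [|y l IH]; first by rewrite (_ : [set _ | _] = set0)//; apply/seteqP; split.
rewrite (_ : [set _ | _] = [set x | c < fnorm (f x *m y)] `|` [set x | has (fun y => c < fnorm (f x *m y)) l]).
  apply: measurableU => //; rewrite -[X in measurable X]setTI.
  have := mfy y measurableT _ (@measurable_itv _ `]c, +oo[).
  by congr (measurable (_ `&` _)); apply/seteqP; split => x /=; rewrite in_itv/= andbT.
by apply/seteqP; split => x /=; [move/orP|move=> H; apply/orP].
Qed.

End OpnormNets.

(** * Elementary estimates: logarithms, the penalty, chi-square calibration *)

Section RealEstimates.
Variable R : realType.

Lemma eq_ler (x y : R) : x = y -> x <= y.
Proof. by move=> ->. Qed.

Lemma le_sinh (x : R) : 0 <= x -> x <= (expR x - expR (- x)) / 2.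
Proof.
move=> x0; pose f (t : R) : R := (expR t - expR (- t)) / 2 - t.
have df (t : R) : is_derive t 1 f ((expR t + expR (- t)) / 2 - 1).
  rewrite /f; apply: is_derive_eq.
  by rewrite !scaler0 add0r mulrN1 opprK -[2^-1 *: _]/(2^-1 * _); ring.
have : f 0 <= f x.
  apply: (@ger0_derive1_ndecry R f 0) => //.
  - move=> t _; rewrite derive1E derive_val subr_ge0 ler_pdivlMr// mul1r expRN.
    have e0 := expR_gt0 t; rewrite -subr_ge0.
    have -> : expR t + (expR t)^-1 - 2 = (expR t - 1) ^+ 2 / expR t by field; rewrite gt_eqF.
    by rewrite divr_ge0 ?sqr_ge0// ltW.
  - by apply: derivable_within_continuous => t _; apply: ex_derive.
by rewrite /f oppr0 subrr mul0r addr0 subr_ge0.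
Qed.

(** This is [x <= sinh x] at [x = ln s]. Being sharper than [ln s <= s - 1], it yields the deviation
    [D + 2 sqrt(D x) + 2 x] of a chi-square with its exact constants. *)
Lemma ln_le_half_sub (s : R) : 1 <= s -> ln s <= (s - s^-1) / 2.
Proof.
move=> s1; have s0 : 0 < s by exact: lt_le_trans s1.
by have := le_sinh (ln_ge0 s1); rewrite expRN !lnK.
Qed.

Lemma natpow_le_fact_exp (m : nat) : m%:R ^+ m <= m`!%:R * expR m%:R :> R.
Proof.
case: m => [|m]; first by rewrite expr0 fact0 expR0 mulr1.
have f0 : 0 < m.+1`!%:R :> R by rewrite ltr0n fact_gt0.
rewrite mulrC -ler_pdivrMr//; apply: le_trans (expR_ge1Dxn m (ler0n R m.+1)).
by rewrite lerDr.
Qed.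

Definition logep (p m : nat) : R := ln (expR 1 * p%:R / m%:R).

Lemma logepE p m : (0 < m <= p)%N -> logep p m = 1 + ln p%:R - ln m%:R.
Proof.
move=> /andP[m0 mp]; have p0 : (0 < p)%N by exact: leq_trans mp.
rewrite /logep ln_div ?posrE ?mulr_gt0 ?expR_gt0 ?ltr0n// lnM ?posrE ?expR_gt0 ?ltr0n//.
by rewrite expRK.
Qed.

Lemma logep_ge1 p m : (0 < m <= p)%N -> 1 <= logep p m.
Proof.
move=> h; rewrite logepE// -addrA lerDl subr_ge0 ler_ln ?posrE ?ltr0n ?ler_nat;
  by case/andP: h => // m0; apply: leq_trans.
Qed.

Lemma logep_decr p m m' : (0 < m <= m')%N -> (m' <= p)%N -> logep p m' <= logep p m.
Proof.
move=> /andP[m0 mm'] mp; rewrite !logepE ?m0 ?(leq_trans mm' mp) ?(leq_trans m0 mm')//.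
by rewrite lerD2l lerN2 ler_ln ?posrE ?ltr0n ?ler_nat// (leq_trans m0).
Qed.

Lemma ffact_le_expn n m : (n ^_ m <= n ^ m)%N.
Proof.
by elim: m => [|m IH]; rewrite ?ffactn0 ?expn0 ?ffactnSr ?expnSr ?leq_mul ?leq_subr.
Qed.

Lemma bin_le_expR p m : (m <= p)%N -> 'C(p, m)%:R <= expR (m%:R * logep p m).
Proof.
case: m => [|m] mp; first by rewrite bin0 mul0r expR0.
have m0 : 0 < m.+1%:R :> R by rewrite ltr0n.
have p0 : 0 < p%:R :> R by rewrite ltr0n (leq_trans _ mp).
have f0 : 0 < m.+1`!%:R :> R by rewrite ltr0n fact_gt0.
rewrite expRM_natl lnK ?posrE ?divr_gt0 ?mulr_gt0 ?expR_gt0//.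
rewrite -(ler_pM2r f0) -natrM bin_ffact.
apply: (@le_trans _ _ (p%:R ^+ m.+1)); first by rewrite -natrX ler_nat ffact_le_expn.
rewrite !exprMn exprVn -expRM_natl mulr1.
rewrite [leRHS](_ : _ = p%:R ^+ m.+1 * (m.+1`!%:R * expR m.+1%:R / m.+1%:R ^+ m.+1)).
  by rewrite ler_peMr ?exprn_ge0// ?(ltW p0)// ler_pdivlMr ?exprn_gt0// mul1r natpow_le_fact_exp.
by field; rewrite expf_neq0// gt_eqF.
Qed.

(** The sum equals [k (1 + ln p) - ln k!], and [k!] is at least [(k / e)^k]. *)
Lemma sum_logep p k : (0 < k <= p)%N ->
  \sum_(1 <= i < k.+1) logep p i <= k%:R * logep p k + k%:R.
Proof.
move=> /andP[k0 kp].
have kR : 0 < k%:R :> R by rewrite ltr0n.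
have -> : \sum_(1 <= i < k.+1) logep p i = k%:R * (1 + ln p%:R) - ln k`!%:R.
  have : forall m, (m <= p)%N ->
      \sum_(1 <= i < m.+1) logep p i = m%:R * (1 + ln p%:R) - ln m`!%:R.
    elim=> [_|m IH mp]; first by rewrite big_geq// mul0r fact0 ln1 subr0.
    rewrite big_nat_recr//= IH ?(ltnW mp)// logepE// factS natrM lnM ?posrE ?ltr0n ?fact_gt0//.
    by rewrite -natr1; ring.
  by apply.
rewrite logepE ?k0// mulrBr -addrA lerD2l.
have := natpow_le_fact_exp k; rewrite -ler_ln ?posrE ?exprn_gt0 ?mulr_gt0 ?ltr0n ?fact_gt0 ?expR_gt0//.
rewrite lnXn// lnM ?posrE ?ltr0n ?fact_gt0 ?expR_gt0// expRK -mulr_natl.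
by move=> h; lra.
Qed.

Section Penalty.
Variables (r p : nat) (beta : R).
Hypothesis beta0 : 0 < beta.

Lemma tkE i : tk r beta p i =
  r%:R + Num.sqrt (2 * r%:R * beta * logep p i) + beta * logep p i.
Proof. by []. Qed.

Lemma tk_ge0 i : (0 < i <= p)%N -> 0 <= tk r beta p i.
Proof.
move=> ip; rewrite tkE addr_ge0 ?addr_ge0 ?sqrtr_ge0// mulr_ge0 ?ltW//.
by apply: lt_le_trans (logep_ge1 ip).
Qed.

Lemma tk_decr i j : (0 < i <= j)%N -> (j <= p)%N -> tk r beta p j <= tk r beta p i.
Proof.
move=> ij jp; have l := logep_decr ij jp.
rewrite !tkE lerD ?ler_wpM2l ?(ltW beta0)// lerD2l ler_wsqrtr// ler_wpM2l//.
by rewrite mulr_ge0 ?(ltW beta0)// mulr_ge0.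
Qed.

(** The penalty without its factor [(1 + delta) ^+ 2]. *)
Definition pensum (m : nat) : R := \sum_(1 <= i < m.+1) tk r beta p i.

Lemma pensumS m : pensum m.+1 = pensum m + tk r beta p m.+1.
Proof. by rewrite /pensum big_nat_recr. Qed.

Lemma pensum0 : pensum 0 = 0.
Proof. by rewrite /pensum big_geq. Qed.

Lemma pensum_homo m m' : (m <= m' <= p)%N -> pensum m <= pensum m'.
Proof.
move=> /andP[]; elim: m' => [|m' IH]; first by rewrite leqn0 => /eqP ->.
rewrite leq_eqVlt => /orP[/eqP ->//|mm'] mp; rewrite pensumS.
by rewrite -[leLHS]addr0 lerD ?IH ?(ltnW mp)// tk_ge0.
Qed.

Lemma pensum_ge0 m : (m <= p)%N -> 0 <= pensum m.
Proof. by move=> mp; rewrite -pensum0 pensum_homo. Qed.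

(** The increments [t_i] decrease, so the [k] increments after the [m]-th are at most the first
    [k]. *)
Lemma pensum_subadd m k : (m + k <= p)%N -> pensum (m + k) <= pensum m + pensum k.
Proof.
elim: k => [|k IH] mk; first by rewrite addn0 pensum0 addr0.
have mkp : (m + k <= p)%N by rewrite (leq_trans _ mk)// leq_add2l.
rewrite addnS !pensumS (addrA (pensum m)); apply: lerD; first exact: IH.
by apply: tk_decr; rewrite -?addnS// leq_addl.
Qed.

(** Each [t_i] with [i <= m] is at least [t_m]. The left side is the chi-square deviation
    [D + 2 sqrt(D x) + 2 x] for [D = m r] and [x = (beta / 2) m log(ep/m)], so the penalty dominates
    the noise on any [m] rows. *)
Lemma pensum_lower m : (0 < m <= p)%N ->
  m%:R * r%:R + m%:R * Num.sqrt (2 * r%:R * beta * logep p m) +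
    beta * m%:R * logep p m <= pensum m.
Proof.
move=> /andP[m0 mp]; apply: (@le_trans _ _ (\sum_(1 <= i < m.+1) tk r beta p m)).
  rewrite sumr_const_nat subn1/= tkE -mulr_natl.
  by apply: eq_ler; ring.
rewrite /pensum !big_nat; apply: ler_sum => i /andP[i0 im].
by apply: tk_decr; rewrite ?i0.
Qed.

Lemma pensum_upper k : (0 < k <= p)%N ->
  pensum k <= 2 * (k%:R * r%:R) + 3 * beta * (k%:R * logep p k).
Proof.
move=> kp; apply: (@le_trans _ _ (\sum_(1 <= i < k.+1) (2 * r%:R + 3 / 2 * beta * logep p i))).
  rewrite /pensum !big_nat; apply: ler_sum => i /andP[i0 ik].
  have ip : (0 < i <= p)%N by move: kp i0 ik; lia.
  have l1 := logep_ge1 ip; have bl : 0 <= beta * logep p i.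
    by rewrite mulr_ge0 ?(ltW beta0)// (le_trans ler01).
  rewrite tkE.
  have : Num.sqrt (2 * r%:R * beta * logep p i) <= r%:R + beta * logep p i / 2.
    have r0 : 0 <= r%:R :> R by [].
    have s0 : 0 <= r%:R + beta * logep p i / 2 by rewrite addr_ge0// divr_ge0.
    rewrite -[leRHS]ger0_norm// -sqrtr_sqr ler_wsqrtr//.
    rewrite -subr_ge0.
    have -> : (r%:R + beta * logep p i / 2) ^+ 2 - 2 * r%:R * beta * logep p i =
      (r%:R - beta * logep p i / 2) ^+ 2 by field.
    exact: sqr_ge0.
  by lra.
rewrite big_split/= sumr_const_nat subn1/= -mulr_sumr -mulr_natl.
have := sum_logep kp; have l1 := logep_ge1 kp.
case/andP: kp => k0 _; have kR : 0 <= k%:R :> R by [].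
have : k%:R <= k%:R * logep p k by rewrite ler_peMr.
move=> h1 h2; have : \sum_(1 <= i < k.+1) logep p i <= 2 * (k%:R * logep p k) by lra.
move=> h3; have : 3 / 2 * beta * \sum_(1 <= i < k.+1) logep p i <=
   3 / 2 * beta * (2 * (k%:R * logep p k)).
  by rewrite ler_wpM2l// mulr_ge0 ?(ltW beta0)// divr_ge0.
by set A := (\sum_(1 <= i < k.+1) _); lra.
Qed.

End Penalty.

(* The Chernoff bound for a chi-square variable with [D] degrees of freedom is
   optimal at [th = y / (1 + 2 y)] with [y = sqrt (x / D)]; replacing [x / D] by
   [x / D + eta] keeps [th] away from [0] at a small relative cost *)
Lemma chisq_calibration (D x eta : R) :
  0 < D -> 0 <= x -> 0 < eta ->
  let y := Num.sqrt (x / D + eta) in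
  let th := y / (1 + 2 * y) in
  [/\ Num.sqrt eta / (1 + 2 * Num.sqrt eta) <= th, 2 * th < 1 &
   (D * ln (Num.sqrt (1 - 2 * th)^-1) + x) / th <=
   (1 + 2 * Num.sqrt eta + 2 * eta) * D + 2 * Num.sqrt (D * x) + 2 * x].
Proof.
move=> D0 x0 e0 y th.
have xD0 : 0 <= x / D by rewrite divr_ge0// ltW.
have se0 : 0 < Num.sqrt eta by rewrite sqrtr_gt0.
have ysq : Num.sqrt eta <= y by rewrite ler_wsqrtr// lerDr.
have y0 : 0 < y by exact: lt_le_trans ysq.
have y2 : y ^+ 2 = x / D + eta by rewrite sqr_sqrtr// addr_ge0// ltW.
have d0 : 0 < 1 + 2 * y by lra.
have th0 : 0 < th by rewrite divr_gt0.
have e1 : 1 - 2 * th = (1 + 2 * y)^-1 by rewrite /th; field; rewrite gt_eqF.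
split.
- rewrite /th ler_pdivrMr ?(addr_gt0 ltr01) ?mulr_gt0// mulrAC ler_pdivlMr//.
  by rewrite !mulrDr !mulr1; move: ysq; nra.
- by rewrite -subr_gt0 e1 invr_gt0.
rewrite e1 invrK; set s := 1 + 2 * y.
have s1 : 1 <= s by rewrite /s; lra.
have s0 : 0 < s by exact: lt_le_trans s1.
have ln2 : ln s = 2 * ln (Num.sqrt s).
  by rewrite -{1}(sqr_sqrtr (ltW s0)) lnXn ?sqrtr_gt0// mulr_natl.
have ls : ln (Num.sqrt s) <= y * (1 + y) / s.
  have := ln_le_half_sub s1; rewrite ln2.
  have -> : (s - s^-1) / 2 = 2 * (y * (1 + y) / s) by rewrite /s; field; rewrite gt_eqF.
  by move=> h; lra.
rewrite ler_pdivrMr//.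
have sqD : Num.sqrt (D * x) = D * Num.sqrt (x / D).
  rewrite -{2}(ger0_norm (ltW D0)) -sqrtr_sqr -sqrtrM ?sqr_ge0//; congr Num.sqrt.
  by field; rewrite gt_eqF.
have ysum : y <= Num.sqrt (x / D) + Num.sqrt eta.
  have h : 0 <= Num.sqrt (x / D) + Num.sqrt eta by rewrite addr_ge0 ?sqrtr_ge0.
  rewrite -(ger0_norm h) -sqrtr_sqr ler_wsqrtr// sqrrD !sqr_sqrtr ?(ltW e0)//.
  by rewrite lerD2r lerDl mulrn_wge0// mulr_ge0 ?sqrtr_ge0.
have xE : x = D * y ^+ 2 - D * eta by rewrite y2; field; rewrite gt_eqF.
have main : D * ln (Num.sqrt s) + x <= D * (1 + 2 * y + 2 * y ^+ 2) * th.
  have -> : D * (1 + 2 * y + 2 * y ^+ 2) * th = D * (y * (1 + y) / s) + D * y ^+ 2.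
    by rewrite /th -/s /s; field; rewrite gt_eqF.
  rewrite xE; have : D * ln (Num.sqrt s) <= D * (y * (1 + y) / s) by rewrite ler_wpM2l ?(ltW D0).
  have : 0 <= D * eta by rewrite mulr_ge0 ?ltW.
  by lra.
apply: le_trans main _; rewrite ler_wpM2r ?(ltW th0)// sqD.
have : D * y <= D * (Num.sqrt (x / D) + Num.sqrt eta) by rewrite ler_wpM2l ?(ltW D0).
by rewrite xE; lra.
Qed.

(** There are at most [exp (m log(ep/m))] sets of size [m], so each size contributes at most
    [q ^+ m], with [q < 1] because [b > 1]. It is used with [b = beta / 2]. *)
Lemma sum_subsets_le (p : nat) (b : R) : 1 < b ->
  \sum_(J : {set 'I_p}) expR (- (b * (#|J|%:R * logep p #|J|))) <=
  (1 - expR (- (b - 1)))^-1.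
Proof.
move=> b1; set q := expR (- (b - 1)).
have q1 : q < 1 by rewrite expR_lt1 oppr_lt0 subr_gt0.
have q0 : 0 <= q by exact: expR_ge0.
apply: (@le_trans _ _ (\sum_(m < p.+1) q ^+ m)).
  rewrite (partition_big (fun J : {set 'I_p} => inord #|J| : 'I_p.+1) xpredT)//=.
  apply: ler_sum => m _.
  have mp : (m <= p)%N by rewrite -ltnS.
  rewrite (eq_bigr (fun=> expR (- (b * (m%:R * logep p m))))); last first.
    move=> J /eqP <-; rewrite inordK// ltnS.
    by apply: leq_trans (max_card _) _; rewrite card_ord.
  rewrite sumr_const.
  have -> : #|[pred J : {set 'I_p} | inord #|J| == m]| = 'C(p, m).
    transitivity 'C(#|'I_p|, m); last by rewrite card_ord.
    rewrite -card_draws cardsE; apply: eq_card => J.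
    rewrite !inE -val_eqE/= inordK// ltnS.
    by apply: leq_trans (max_card _) _; rewrite card_ord.
  rewrite -[leLHS]mulr_natl; apply: (@le_trans _ _ (expR (m%:R * logep p m) * expR (- (b * (m%:R * logep p m))))).
    by rewrite ler_wpM2r ?expR_ge0// bin_le_expR.
  rewrite -expRD /q -expRM_natl ler_expR; case: (posnP m) => [->|m0]; first by rewrite !mul0r mulr0 subr0.
  have l1 : 1 <= logep p m by rewrite logep_ge1// m0.
  have : m%:R <= m%:R * logep p m by rewrite ler_peMr.
  set A := m%:R * logep p m => h; have : (b - 1) * m%:R <= (b - 1) * A.
    by rewrite ler_wpM2l// subr_ge0 ltW.
  by lra.
have qp : 0 < 1 - q by rewrite subr_gt0.
rewrite -[_^-1]mul1r ler_pdivlMr// mulrC -opprB mulNr -subrX1 opprB.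
by rewrite lerBlDr lerDl exprn_ge0.
Qed.

End RealEstimates.

(** * Finite sums of integrals, row supports and coordinate selection *)

Section FiniteSums.
Context d (T : measurableType d) (R : realType) (mu : {measure set T -> \bar R}).

Lemma integral_sum_le (J : eqType) (s : seq J) (F : J -> T -> R) (b : R) :
  (forall j, measurable_fun setT (F j)) -> (forall j x, 0 <= F j x) -> 0 <= b ->
  (forall j, j \in s -> (\int[mu]_x (F j x)%:E <= b%:E)%E) ->
  (\int[mu]_x (\sum_(j <- s) F j x)%:E <= ((size s)%:R * b)%:E)%E.
Proof.
move=> mF F0 b0 Fb.
under eq_integral do rewrite -sumEFin.
rewrite ge0_integral_sum//; [|by move=> j; exact/measurable_EFinP|by move=> j x _; rewrite lee_fin].
apply: (@le_trans _ _ (\sum_(j <- s) b%:E)%E).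
  by rewrite !big_seq; apply: lee_sum => j; exact: Fb.
by rewrite sumEFin lee_fin big_const_seq count_predT iter_addr_0 mulr_natl.
Qed.

End FiniteSums.

Lemma exists_superset_card (T : finType) (A : {set T}) (k : nat) :
  (#|A| <= k <= #|T|)%N -> exists2 S : {set T}, A \subset S & #|S| = k.
Proof.
move=> /andP[]; elim: k => [|k IH].
  by rewrite leqn0 => /eqP A0 _; exists A.
rewrite leq_eqVlt => /orP[/eqP Ak _|Ak kT]; first by exists A.
have [S AS Sk] := IH Ak (ltnW kT).
have [x xS] : exists x, x \notin S.
  apply/existsP; rewrite -negb_forall; apply/negP => /forallP allS.
  have : #|T| = #|S| by apply: eq_card => x; rewrite !inE allS.
  by move=> TS; rewrite TS Sk ltnn in kT.
exists (x |: S)%SET; first exact: fintype.subset_trans AS (finset.subsetUr _ _).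
by rewrite cardsU1 xS Sk.
Qed.

Section Selection.
Variable R : realType.

(** The isometric inclusion of the coordinates in [S]. *)
Definition selmx q (S : {set 'I_q}) : 'M[R]_(q, #|S|) :=
  \matrix_(i, l) (i == enum_val l)%:R.

Lemma selmx_mul n q (S : {set 'I_q}) (G : 'M[R]_(n, q)) i l :
  (G *m selmx S) i l = G i (enum_val l).
Proof.
rewrite mxE (bigD1 (enum_val l))//= mxE eqxx mulr1 big1 ?addr0// => j jl.
by rewrite mxE (negPf jl) mulr0.
Qed.

Lemma selmx_isometry q (S : {set 'I_q}) : (selmx S)^T *m selmx S = 1%:M.
Proof.
apply/matrixP => l l'; rewrite selmx_mul !mxE eq_sym.
by rewrite (inj_eq enum_val_inj).
Qed.

Lemma selmxK q m (S : {set 'I_q}) (A : 'M[R]_(q, m)) :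
  [set i | row i A != 0]%SET \subset S -> selmx S *m ((selmx S)^T *m A) = A.
Proof.
move=> AS; apply/matrixP => i j; rewrite mxE.
have e l : ((selmx S)^T *m A) l j = A (enum_val l) j.
  rewrite -[_ *m A]trmxK trmx_mul trmxK mxE selmx_mul mxE; by [].
have [iS|iS] := boolP (i \in S).
  rewrite (bigD1 (enum_rank_in iS i))//= e !mxE enum_rankK_in// eqxx mul1r.
  rewrite big1 ?addr0// => l li; rewrite mxE; case: eqP => [il|]; last by rewrite mul0r.
  by case/eqP: li; apply: enum_val_inj; rewrite enum_rankK_in.
rewrite big1.
  have : i \notin [set i | row i A != 0]%SET by apply: contra iS; exact: (fintype.subsetP AS).
  by rewrite inE negbK => /eqP /rowP /(_ j); rewrite !mxE.
move=> l _; rewrite mxE; case: eqP => [il|]; last by rewrite mul0r.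
by move: iS; rewrite il enum_valP.
Qed.

End Selection.

Definition suppmx (R : realType) m n (A : 'M[R]_(m, n)) : {set 'I_m} :=
  [set i | row i A != 0]%SET.

Lemma supp_cardE (R : realType) m n (A : 'M[R]_(m, n)) : supp_card A = #|suppmx A|.
Proof. by apply: eq_card => i; rewrite !inE; apply/idP/idP; rewrite in_setE. Qed.

(** * Extreme singular values of Gaussian matrices *)

Section UpperTail.
Context {R : realType} {I : finType}.
Variable mu : probability (cfg R I) R.
Hypothesis gmu : gaussian_law mu.

(** The variable [X] sums exponentials of deviations over all supports of size [k] and all vectors
    of a [1/2]-net. If [X < 1] then every term is below [1], which controls every deviation, while
    the mean of [X] plays the part of a failure probability. *)
Lemma gaussian_opnorm_upper (n q k : nat) (c : 'I_n -> 'I_q -> I) :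
  injective (fun e => c e.1 e.2) -> (0 < k <= q)%N ->
  (1 + ln 17) * (k%:R * logep R q k) <= n%:R ->
  exists X : cfg R I -> R, [/\ measurable_fun setT X, forall x, 0 <= X x,
    (\int[mu]_x (X x)%:E <= (expR (- n%:R))%:E)%E &
    forall x, X x < 1 -> forall v : 'cV[R]_q, (supp_card v <= k)%N ->
      fnorm ((\matrix_(i, l) x (c i l)) *m v) <= 7 * Num.sqrt n%:R * fnorm v].
Proof.
move=> injc /andP[k0 kq] kn; have mc := @measurable_coord R I.
pose G (x : cfg R I) : 'M[R]_(n, q) := \matrix_(i, l) x (c i l).
have mG : measurable_mx G by move=> i l; under eq_fun do rewrite mxE; exact: mc.
have half01 : 0 < (2^-1 : R) < 1 by lra.
have h17 : 1 + 8 / 2^-1 <= 17%:R :> R by lra.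
have [net netP] : exists net : (forall S : {set 'I_q}, seq 'cV[R]_#|S|), forall S : {set 'I_q},
    [/\ (size (net S) <= 17 ^ (#|S| * 1))%N, forall a, a \in net S -> opnorm a <= 1 &
    forall a : 'cV[R]_#|S|, opnorm a <= 1 -> exists2 b, b \in net S & opnorm (a - b) <= 2^-1].
  exists (fun S : {set 'I_q} => sval (cid (exists_opnorm_net #|S| 1 half01 h17))) => S.
  exact: svalP (cid (exists_opnorm_net #|S| 1 half01 h17)).
pose Sk := enum [set S : {set 'I_q} | #|S| == k]%SET.
(* The threshold is [10 n] for the squared norm. The moment [sqrt 2 ^+ n <= e^(n/2)] against
   [e^(-10n/4)] leaves [e^(-2n)], and the at most [e^n] pairs of a support and a net vector leave
   [e^(-n)]. *)
pose F (S : {set 'I_q}) (y : 'cV[R]_#|S|) (x : cfg R I) :=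
  expR (frob2 (G x *m selmx R S *m y) / 4 - 10 / 4 * n%:R).
have mF S y : measurable_fun setT (F S y).
  apply: measurableT_comp => //; apply: measurable_funB => //.
  apply: measurable_funM => //; apply: measurable_sum => i; apply: measurable_sum => j.
  by apply: measurable_funX; apply: measurable_mxM; [apply: measurable_mxM => //|];
    exact: measurable_mx_cst.
have F0 S y x : 0 <= F S y x by exact: expR_ge0.
exists (fun x => \sum_(S <- Sk) \sum_(y <- net S) F S y x); split.
- by apply: measurable_sum => S; apply: measurable_sum.
- by move=> x; apply: sumr_ge0 => S _; apply: sumr_ge0.
- have b0 : 0 <= expR (- (2 * n%:R)) :> R by exact: expR_ge0.
  apply: le_trans (integral_sum_le (b := (17 ^ k)%:R * expR (- (2 * n%:R))) _ _ _ _) _.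
  + by move=> S; apply: measurable_sum.
  + by move=> S x; apply: sumr_ge0.
  + by rewrite mulr_ge0.
  + move=> S; rewrite mem_enum inE => /eqP Sk'.
    apply: le_trans (integral_sum_le (b := expR (- (2 * n%:R))) _ _ _ _) _ => //.
    * move=> y yn; have [_ y1 _] := netP S; have {y1}y1 := y1 _ yn.
      have y1' : \sum_l y l 0 ^+ 2 <= 1.
        have -> : \sum_l y l 0 ^+ 2 = frob2 y by apply: eq_bigr => l _; rewrite big_ord1.
        by rewrite -sqr_fnorm -opnorm_cV expr_le1// opnorm_ge0.
      have injS : injective (fun e : 'I_n * 'I_#|S| => c e.1 (enum_val e.2)).
        move=> [i l] [i' l'] /= e; have [-> /enum_val_inj ->//] := injc (i, enum_val l) (i', enum_val l') e.
      have H := @gaussian_upper_moment R I mu gmu n #|S| (fun i l => c i (enum_val l))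
        (fun l => y l 0) injS y1'.
      have -> : (\int[mu]_x (F S y x)%:E = (expR (- (10 / 4 * n%:R)))%:E *
          \int[mu]_x (expR (\sum_i (\sum_l y l 0 * x (c i (enum_val l))) ^+ 2 / 4))%:E)%E.
        rewrite -ge0_integralZl//; last first.
          apply/measurable_EFinP; apply: measurableT_comp => //; apply: measurable_sum => i.
          apply: measurable_funM => //; apply: measurable_funX; apply: measurable_sum => l.
          by apply: measurable_funM => //; exact: mc.
        apply: eq_integral => x _; rewrite -EFinM -expRD /F addrC; congr (EFin (expR (_ + _))).
        rewrite /frob2 mulr_suml; apply: eq_bigr => i _; rewrite big_ord1; congr (_ ^+ 2 / 4).
        by rewrite mxE; apply: eq_bigr => l _; rewrite selmx_mul mxE mulrC.
      apply: le_trans (lee_wpmul2l _ H) _; first by rewrite lee_fin expR_ge0.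
      rewrite -EFinM lee_fin.
      have s2 : Num.sqrt 2 <= expR (1 / 2) :> R.
        have e12 : 0 <= expR (1 / 2) :> R by exact: expR_ge0.
        rewrite -(ger0_norm e12) -sqrtr_sqr ler_wsqrtr// -expRM_natl.
        have -> : 2%:R * (1 / 2) = 1 :> R by field.
        have := expR_ge1Dx (1 : R); lra.
      apply: (@le_trans _ _ (expR (- (10 / 4 * n%:R)) * expR (1 / 2) ^+ n)).
        by rewrite ler_wpM2l ?expR_ge0// lerXn2r// nnegrE ?sqrtr_ge0 ?expR_ge0.
      by rewrite -expRM_natl -expRD ler_expR; lra.
    * rewrite lee_fin ler_wpM2r// ler_nat; have [h _ _] := netP S.
      by apply: leq_trans h _; rewrite muln1 Sk'.
  have -> : size Sk = 'C(q, k) by rewrite /Sk -cardE card_draws card_ord.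
  rewrite lee_fin mulrA.
  apply: (@le_trans _ _ (expR n%:R * expR (- (2 * n%:R)))); last by rewrite -expRD ler_expR; lra.
  rewrite ler_wpM2r//; apply: le_trans (_ : expR (k%:R * logep R q k) * expR (k%:R * ln 17) <= _).
    by rewrite ler_pM// ?bin_le_expR// natrX expRM_natl lnK ?posrE.
  rewrite -expRD ler_expR; apply: le_trans kn.
  have l1 : 1 <= logep R q k by rewrite logep_ge1// k0.
  have : k%:R * ln 17 <= ln 17 * (k%:R * logep R q k).
    rewrite mulrC ler_wpM2l ?ln_ge0//; first lra.
    by rewrite ler_peMr.
  by lra.
move=> x X1 v vk.
have [S vS Sk'] : exists2 S : {set 'I_q}, [set i | row i v != 0]%SET \subset S & #|S| = k.
  by apply: exists_superset_card; rewrite -/(suppmx v) -supp_cardE vk card_ord kq.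
have SSk : S \in Sk by rewrite mem_enum inE Sk'.
have [_ net1 net2] := netP S.
pose w := (selmx R S)^T *m v.
have vw : v = selmx R S *m w by rewrite selmxK.
have nw : fnorm v = fnorm w by rewrite {1}vw /fnorm frob2_isometry// selmx_isometry.
have n0 : 0 <= Num.sqrt n%:R :> R by exact: sqrtr_ge0.
(* The squared norm is below [10 n], which is at most [(7/2)^2 n]; the [1/2]-net then doubles [7/2]
   to [7]. *)
have bnd y : y \in net S -> fnorm (G x *m selmx R S *m y) <= 7 / 2 * Num.sqrt n%:R.
  move=> yn.
  have : F S y x < 1.
    apply: le_lt_trans X1.
    rewrite (big_rem S)//= (big_rem y)//= -addrA lerDl addr_ge0 ?sumr_ge0// => ? _.
    exact: sumr_ge0.
  rewrite /F expR_lt1 subr_lt0 => h.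
  rewrite -ler_sqr ?nnegrE ?fnorm_ge0 ?mulr_ge0// sqr_fnorm exprMn sqr_sqrtr//.
  by have : 0 <= n%:R :> R by []; lra.
have op (y : 'cV[R]_#|S|) : opnorm y <= 1 ->
    fnorm (G x *m selmx R S *m y) <= 7 * Num.sqrt n%:R.
  move=> y1; have := @net_sup_bound R #|S| 1 (net S) 2^-1
    (fun y => fnorm (G x *m selmx R S *m y)) (7 / 2 * Num.sqrt n%:R)
    (opnorm (G x *m selmx R S)).
  move=> /(_ _ net2 _ _ bnd _ y y1) H; apply: le_trans (H _ _ _ _) _.
  - by apply/andP; split; lra.
  - by move=> a b; rewrite mulmxDr fnormD.
  - by move=> t a t0; rewrite -scalemxAr fnormZ ger0_norm.
  - by move=> a a1; rewrite (le_trans (opnorm_mul _ _))// -opnorm_cV ler_piMr ?opnorm_ge0.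
  - by apply: eq_ler; field.
rewrite -/(G x) nw; have -> : G x *m v = G x *m selmx R S *m w by rewrite -mulmxA -vw.
have [w0|wn0] := eqVneq (fnorm w) 0.
  have -> : w = 0 by apply: frob2_eq0; rewrite -sqr_fnorm w0 expr0n.
  by rewrite mulmx0 !fnorm0 mulr0.
have wg : 0 < fnorm w by rewrite lt_neqAle eq_sym wn0 fnorm_ge0.
rewrite -ler_pdivrMr// mulrC -[X in X * _]ger0_norm ?invr_ge0 ?fnorm_ge0// -fnormZ scalemxAr.
by apply: op; rewrite opnorm_cV fnormZ ger0_norm ?invr_ge0 ?fnorm_ge0// mulVf.
Qed.

End UpperTail.

(** A small-ball estimate: for large [th] the mean of [exp (- th |G y|^2)] is so small, uniformly
    over vectors [y] that are not short, that it beats the cardinality of a net of the ball in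
    dimension [r]. The upper bound on [G] passes from the net to all vectors. *)
Lemma gaussian_lower (R : realType) : exists cl : R, exists K : R, [/\ 0 < cl, 0 <= K &
  forall (I : finType) (mu : probability (cfg R I) R), gaussian_law mu ->
  forall (n r : nat) (c : 'I_n -> 'I_r -> I), injective (fun e => c e.1 e.2) ->
  r%:R * K <= n%:R ->
  exists X : cfg R I -> R, [/\ measurable_fun setT X, forall x, 0 <= X x,
    (\int[mu]_x (X x)%:E <= (expR (- n%:R))%:E)%E &
    forall x, X x < 1 ->
      let G : 'M[R]_(n, r) := \matrix_(i, l) x (c i l) in
      (forall v : 'cV[R]_r, fnorm (G *m v) <= 7 * Num.sqrt n%:R * fnorm v) ->
      forall v : 'cV[R]_r, cl * Num.sqrt n%:R * fnorm v <= fnorm (G *m v)]].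
Proof.
(* For [|y| >= 1/2] one has [2 * th * |y|^2 >= e^6], so each row contributes a factor at most
   [e^(-3)]. Of [e^(-3n)], one [e^n] pays for the threshold and one for the net. *)
pose th : R := 2 * expR 6.
have th0 : 0 < th by rewrite mulr_gt0// expR_gt0.
have th1 : 1 <= th by have := expR_ge1Dx (6 : R); rewrite /th; lra.
pose c0 : R := Num.sqrt th^-1.
have c00 : 0 < c0 by rewrite sqrtr_gt0 invr_gt0.
have c02 : c0 ^+ 2 = th^-1 by rewrite sqr_sqrtr// invr_ge0 ltW.
have c01 : c0 <= 1.
  by rewrite -(ler_sqr (ltW c00)) ?nnegrE// c02 expr1n invf_le1.
(* An error [eps] in the vector moves its image by at most [7 sqrt n * eps], half of the bound
   [c0 sqrt n] obtained on the net. *)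
pose eps := c0 / 14.
have e01 : 0 < eps < 1 by apply/andP; split; rewrite /eps; lra.
pose M := (Num.truncn (1 + 8 / eps)).+1.
have eM : 1 + 8 / eps <= M%:R by apply/ltW; exact: truncnS_gt.
have M1 : 1 <= M%:R :> R by rewrite ler1n.
exists (c0 / 2), (ln M%:R); split; first by lra.
  exact: ln_ge0.
move=> I mu gmu n r c injc rn; have mc := @measurable_coord R I.
pose G (x : cfg R I) : 'M[R]_(n, r) := \matrix_(i, l) x (c i l).
have mG : measurable_mx G by move=> i l; under eq_fun do rewrite mxE; exact: mc.
have [s [sM s1 s2]] := exists_opnorm_net r 1 e01 eM.
(* Short net vectors have no useful lower bound; a net vector within [eps] of a unit vector has norm
   at least [1/2]. *)
pose s' := [seq y <- s | 2^-1 <= fnorm y].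
pose F (y : 'cV[R]_r) (x : cfg R I) := expR (- th * frob2 (G x *m y) + n%:R).
have mF y : measurable_fun setT (F y).
  apply: measurableT_comp => //; apply: measurable_funD => //.
  apply: measurable_funM => //; apply: measurable_sum => i; apply: measurable_sum => j.
  by apply: measurable_funX; apply: measurable_mxM => //; exact: measurable_mx_cst.
have F0 y x : 0 <= F y x by exact: expR_ge0.
exists (fun x => \sum_(y <- s') F y x); split.
- exact: measurable_sum.
- by move=> x; apply: sumr_ge0.
- have b0 : 0 <= expR (- (2 * n%:R)) :> R by exact: expR_ge0.
  apply: le_trans (integral_sum_le (b := expR (- (2 * n%:R))) _ _ _ _) _ => //.
  + move=> y; rewrite mem_filter => /andP[yh _].
    have y4 : 4^-1 <= \sum_l y l 0 ^+ 2.
      have -> : \sum_l y l 0 ^+ 2 = frob2 y by apply: eq_bigr => l _; rewrite big_ord1.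
      rewrite -sqr_fnorm; have -> : 4^-1 = 2^-1 ^+ 2 :> R by field.
      by rewrite ler_sqr// nnegrE ?fnorm_ge0// invr_ge0.
    have H := @gaussian_square_mgf R I mu gmu n r c (fun=> th) (fun _ l => y l 0) injc (fun=> ltW th0).
    have -> : (\int[mu]_x (F y x)%:E = (expR n%:R)%:E *
        \int[mu]_x (expR (\sum_i - th * (\sum_l y l 0 * x (c i l)) ^+ 2))%:E)%E.
      rewrite -ge0_integralZl//; last first.
        apply/measurable_EFinP; apply: measurableT_comp => //; apply: measurable_sum => i.
        apply: measurable_funM => //; apply: measurable_funX; apply: measurable_sum => l.
        by apply: measurable_funM => //; exact: mc.
      apply: eq_integral => x _; rewrite -EFinM -expRD /F addrC; congr (EFin (expR (_ + _))).
      rewrite /frob2 mulr_sumr; apply: eq_bigr => i _; rewrite big_ord1; congr (_ * _ ^+ 2).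
      by rewrite mxE; apply: eq_bigr => l _; rewrite mxE mulrC.
    rewrite H -EFinM lee_fin prodr_const card_ord.
    set q := Num.sqrt _; have q3 : q <= expR (- 3).
      have e3 : 0 <= expR (- 3) :> R by exact: expR_ge0.
      rewrite -(ger0_norm e3) -sqrtr_sqr ler_wsqrtr// -expRM_natl.
      have -> : 2%:R * - 3 = - 6 :> R by ring.
      rewrite expRN lef_pV2 ?posrE ?expR_gt0//; last first.
        by rewrite ltr_pwDl// mulr_ge0 ?(le_trans _ y4)// ?invr_ge0// mulr_ge0// ltW.
      have : 2 * th * 4^-1 <= 2 * th * \sum_l y l 0 ^+ 2.
        by rewrite ler_wpM2l// mulr_ge0// ltW.
      by rewrite /th; lra.
    apply: (@le_trans _ _ (expR n%:R * expR (- 3) ^+ n)).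
      by rewrite ler_wpM2l ?expR_ge0// lerXn2r// nnegrE ?sqrtr_ge0 ?expR_ge0.
    by rewrite -expRM_natl -expRD ler_expR; lra.
  + rewrite lee_fin; apply: (@le_trans _ _ (expR n%:R * expR (- (2 * n%:R)))); last first.
      by rewrite -expRD ler_expR; lra.
    rewrite ler_wpM2r//; apply: (@le_trans _ _ (M ^ r)%:R).
      rewrite ler_nat (leq_trans _ (leq_trans sM _))//; last by rewrite muln1.
      by rewrite size_filter count_size.
    by rewrite natrX -[X in X ^+ _](lnK (x := M%:R)) ?posrE ?ltr0n// -expRM_natl ler_expR.
move=> x X1 /= Gup v.
have n0 : 0 <= Num.sqrt n%:R :> R by exact: sqrtr_ge0.
have bnd y : y \in s' -> c0 * Num.sqrt n%:R <= fnorm (G x *m y).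
  move=> ys; have : F y x < 1.
    apply: le_lt_trans X1; rewrite (big_rem y)//= lerDl sumr_ge0// => ? _; exact: F0.
  rewrite /F expR_lt1 => h.
  rewrite -ler_sqr ?nnegrE ?fnorm_ge0 ?mulr_ge0 ?(ltW c00)// sqr_fnorm exprMn c02 sqr_sqrtr//.
  by rewrite ler_pdivrMl//; lra.
have unit (y : 'cV[R]_r) : fnorm y = 1 -> c0 / 2 * Num.sqrt n%:R <= fnorm (G x *m y).
  move=> y1; have [|y' y's yy'] := s2 y; first by rewrite opnorm_cV y1.
  rewrite opnorm_cV in yy'.
  have y'h : 2^-1 <= fnorm y'.
    have := fnormD (y - y') y'; rewrite subrK y1; move: yy'; rewrite /eps; lra.
  have y's' : y' \in s' by rewrite mem_filter y'h.
  have b1 := bnd _ y's'; have b2 := Gup (y - y').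
  have := fnormB_ge (G x *m y') (G x *m (y - y')).
  rewrite -mulmxDr addrCA subrr addr0 => b3.
  have : 7 * Num.sqrt n%:R * fnorm (y - y') <= c0 / 2 * Num.sqrt n%:R.
    rewrite [leRHS](_ : _ = 7 * Num.sqrt n%:R * eps); last by rewrite /eps; field.
    by rewrite ler_wpM2l// mulr_ge0.
  by move: b1 b2 b3; rewrite -/(G x); lra.
have [v0|vn0] := eqVneq (fnorm v) 0.
  by rewrite v0 mulr0 fnorm_ge0.
have vg : 0 < fnorm v by rewrite lt_neqAle eq_sym vn0 fnorm_ge0.
have iv : `|(fnorm v)^-1| = (fnorm v)^-1 by rewrite ger0_norm ?invr_ge0 ?fnorm_ge0.
have := unit ((fnorm v)^-1 *: v); rewrite -scalemxAr !fnormZ iv mulVf// => /(_ erefl).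
by rewrite [leRHS]mulrC ler_pdivlMr.
Qed.

(** * A uniform bound for the noise multiplied by a random orthonormal factor *)

Definition rowres (R : realType) m n (J : {set 'I_m}) (A : 'M[R]_(m, n)) : 'M[R]_(m, n) :=
  \matrix_(i, j) if i \in J then A i j else 0.

Lemma frob2_rowres (R : realType) m n (J : {set 'I_m}) (A : 'M[R]_(m, n)) :
  frob2 (rowres J A) = \sum_(i in J) \sum_j A i j ^+ 2.
Proof.
rewrite /frob2 [RHS]big_mkcond/=; apply: eq_bigr => i _; case: ifP => iJ.
  by apply: eq_bigr => j _; rewrite mxE iJ.
by apply: big1 => j _; rewrite mxE iJ expr0n.
Qed.

Lemma rowresD (R : realType) m n (J : {set 'I_m}) (A B : 'M[R]_(m, n)) :
  rowres J (A + B) = rowres J A + rowres J B.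
Proof. by apply/matrixP => i j; rewrite !mxE; case: ifP; rewrite ?addr0. Qed.

Lemma rowresZ (R : realType) m n (J : {set 'I_m}) a (A : 'M[R]_(m, n)) :
  rowres J (a *: A) = a *: rowres J A.
Proof. by apply/matrixP => i j; rewrite !mxE; case: ifP; rewrite ?mulr0. Qed.

Lemma frob2_rowres_le (R : realType) m n (J : {set 'I_m}) (A : 'M[R]_(m, n)) :
  frob2 (rowres J A) <= frob2 A.
Proof.
apply: ler_sum => i _; apply: ler_sum => j _; rewrite mxE; case: ifP => // _.
by rewrite expr0n/= sqr_ge0.
Qed.

(** The matrices [U a1 + Z0 a2] with the rows of [a2] supported in [S], parametrized by one stacked
    matrix [b]; the scale [rho] brings the relevant [b] into the unit ball. *)
Definition lincomb (R : realType) n p r (rho : R) (S : {set 'I_p}) (U : 'M[R]_(n, r))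
    (Z0 : 'M[R]_(n, p)) (b : 'M[R]_(r + #|S|, r)) : 'M[R]_(n, r) :=
  U *m (rho *: usubmx b) + Z0 *m (rho *: (selmx R S *m dsubmx b)).

Lemma lincombD (R : realType) n p r (rho : R) (S : {set 'I_p}) (U : 'M[R]_(n, r))
    (Z0 : 'M[R]_(n, p)) (a b : 'M[R]_(r + #|S|, r)) :
  lincomb rho U Z0 (a + b) = lincomb rho U Z0 a + lincomb rho U Z0 b.
Proof. by rewrite /lincomb !linearD/= addrACA. Qed.

Lemma lincombZ (R : realType) n p r (rho : R) (S : {set 'I_p}) (U : 'M[R]_(n, r))
    (Z0 : 'M[R]_(n, p)) t (a : 'M[R]_(r + #|S|, r)) :
  lincomb rho U Z0 (t *: a) = t *: lincomb rho U Z0 a.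
Proof.
rewrite /lincomb; have -> : usubmx (t *: a) = t *: usubmx a by rewrite linearZ.
have -> : dsubmx (t *: a) = t *: dsubmx a by rewrite linearZ.
by rewrite -!scalemxAr scalerDr !scalerA [t * rho]mulrC.
Qed.

Section ChaosLevel.
Context {R : realType} (n p r k : nat).
Variable mu : probability (cfg R (noise_idx n p r)) R.
Hypothesis gmu : gaussian_law mu.

(** A union bound over the row set [J], the support [S] and the net of parameters [b], kept as one
    variable [Xi]. Each term is an exponential moment divided by its bound and by the number of
    choices, so the mean of [Xi] is bounded independently of the dimensions. *)
Lemma chaos_level (beta eta rho tau : R) (M : nat)
    (net : forall S : {set 'I_p}, seq 'M[R]_(r + #|S|, r)) :
  2 < beta -> 0 < eta -> 0 < tau -> (0 < M)%N -> (0 < r)%N -> (0 < k <= p)%N ->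
  (forall S, (size (net S) <= M ^ ((r + #|S|) * r))%N) ->
  exists Xi : cfg R (noise_idx n p r) -> R, [/\ measurable_fun setT Xi, forall x, 0 <= Xi x,
    (\int[mu]_x (Xi x)%:E <= ((1 - expR (- (beta / 2 - 1)))^-1)%:E)%E &
    forall x (S J : {set 'I_p}) (b : 'M[R]_(r + #|S|, r)), #|S| = k -> b \in net S ->
      let L := lincomb rho (sigU x) (sigZ x + sigT x) b in
      opnorm L ^+ 2 <= tau ->
      frob2 (rowres J ((sigZ x - sigT x)^T *m L)) / 2 <=
      tau * ((1 + 2 * Num.sqrt eta + 2 * eta) * pensum r p beta #|J| +
             (k%:R * logep R p k + ((r + k) * r)%:R * ln M%:R + Xi x) *
             ((1 + 2 * Num.sqrt eta) / Num.sqrt eta))].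
Proof.
move=> b2 e0 t0 M0 r0 /andP[k0 kp] sizeM.
have se0 : 0 < Num.sqrt eta by rewrite sqrtr_gt0.
(* The deviation level for [m] rows: it exceeds the entropy of choosing [J] because [beta > 2], and
   [2 * xm m] is the last term of [pensum_lower]. *)
pose xm (m : nat) : R := (beta / 2) * (m%:R * logep R p m).
pose D (m : nat) : R := m%:R * r%:R.
pose th m := let y := Num.sqrt (xm m / D m + eta) in y / (1 + 2 * y).
have th0 m : 0 <= th m.
  by apply: divr_ge0; rewrite ?sqrtr_ge0// addr_ge0// mulr_ge0// sqrtr_ge0.
have th1 m : 2 * th m < 1.
  rewrite /th; set y := Num.sqrt _; have y0 : 0 <= y by exact: sqrtr_ge0.
  by rewrite mulrA ltr_pdivrMr; lra.
(* The entropy of the pair of a support of size [k] and a net matrix. *)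
pose Ent : R := k%:R * logep R p k + ((r + k) * r)%:R * ln M%:R.
pose bm m : R := D m * ln (Num.sqrt (1 - 2 * th m)^-1) + xm m + Ent.
pose L (S : {set 'I_p}) (b : 'M[R]_(r + #|S|, r)) (x : cfg R (noise_idx n p r)) := lincomb rho (sigU x) (sigZ x + sigT x) b.
(* The indicator of the event that [L] has squared operator norm at most [tau]; it depends only on
   [U] and [Z + Zt], as [noise_square_moment] requires. *)
pose W (S : {set 'I_p}) (b : 'M[R]_(r + #|S|, r)) (U : 'M[R]_(n, r)) (Z : 'M[R]_(n, p)) : R :=
  (opnorm (lincomb rho U Z b) ^+ 2 <= tau)%R%:R.
pose E (J S : {set 'I_p}) (b : 'M[R]_(r + #|S|, r)) (x : cfg R (noise_idx n p r)) : R :=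
  \sum_(j in J) \sum_l (((sigZ x - sigT x)^T *m L S b x) j l) ^+ 2 * (th #|J| / tau) / 2.
pose F (J S : {set 'I_p}) (b : 'M[R]_(r + #|S|, r)) (x : cfg R (noise_idx n p r)) : R :=
  W S b (sigU x) (sigZ x + sigT x) * expR (E J S b x) * expR (- bm #|J|).
have W01 S b (U : 'M[R]_(n, r)) Z : 0 <= W S b U Z <= 1 by rewrite /W; case: (opnorm _ ^+ 2 <= tau); rewrite ?lexx ler01.
have F0 J S b x : 0 <= F J S b x.
  by have /andP[? _] := W01 S b (sigU x) (sigZ x + sigT x); rewrite !mulr_ge0// expR_ge0.
have mL (S : {set 'I_p}) (b : 'M[R]_(r + #|S|, r)) : measurable_mx (L S b).
  apply: measurable_mxD; apply: measurable_mxM; try exact: measurable_mx_cst.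
    exact: measurable_sigU.
  by apply: measurable_mxD; [exact: measurable_sigZ|exact: measurable_sigT].
have mW (S : {set 'I_p}) (b : 'M[R]_(r + #|S|, r)) :
    measurable_fun setT (fun x => W S b (sigU x) (sigZ x + sigT x)).
  have mo := measurable_opnorm (mL S b).
  have -> : (fun x => W S b (sigU x) (sigZ x + sigT x)) =
      \1_[set x | opnorm (L S b x) ^+ 2 <= tau].
    by apply/funext => x; rewrite indicE/= mem_setE /W.
  apply: measurable_indic; rewrite -[X in measurable X]setTI.
  by apply: measurable_fun_le => //; apply: measurable_funX.
have mE (J S : {set 'I_p}) (b : 'M[R]_(r + #|S|, r)) : measurable_fun setT (E J S b).
  apply: measurable_sum_pred => j; apply: measurable_sum => l.
  apply: measurable_funM => //; apply: measurable_funM => //; apply: measurable_funX.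
  apply: measurable_mxM; last exact: mL.
  by apply: measurable_mxT; apply: measurable_mxB; [exact: measurable_sigZ|exact: measurable_sigT].
have mWE (J S : {set 'I_p}) (b : 'M[R]_(r + #|S|, r)) :
    measurable_fun setT (fun x => W S b (sigU x) (sigZ x + sigT x) * expR (E J S b x)).
  by apply: measurable_funM; [exact: mW|exact: measurableT_comp].
have mF (J S : {set 'I_p}) (b : 'M[R]_(r + #|S|, r)) : measurable_fun setT (F J S b).
  by apply: measurable_funM; [exact: mWE|].
have intF (J S : {set 'I_p}) (b : 'M[R]_(r + #|S|, r)) :
    (\int[mu]_x (F J S b x)%:E <= (expR (- xm #|J| - Ent))%:E)%E.
  have nn : 0 <= expR (- bm #|J|) by exact: expR_ge0.
  have -> : (\int[mu]_x (F J S b x)%:E = (expR (- bm #|J|))%:E * \int[mu]_x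
      (W S b (sigU x) (sigZ x + sigT x) * expR (E J S b x))%:E)%E.
    rewrite -ge0_integralZl//; first by apply: eq_integral => x _; rewrite -EFinM mulrC.
      by apply/measurable_EFinP; exact: mWE.
    by move=> x _; rewrite lee_fin mulr_ge0 ?expR_ge0.
  have WP (U : 'M[R]_(n, r)) (Z : 'M[R]_(n, p)) (y : 'cV[R]_r) : W S b U Z != 0 ->
      frob2 ((U *m (rho *: usubmx b) + Z *m (rho *: (selmx R S *m dsubmx b))) *m y) <=
      tau * frob2 y.
    rewrite /W; case: leP => [h _|_]; last by rewrite eqxx.
    rewrite -/(lincomb rho U Z b) -!sqr_fnorm; apply: le_trans (_ : (opnorm (lincomb rho U Z b) * fnorm y) ^+ 2 <= _).
      by rewrite lerXn2r ?nnegrE ?fnorm_ge0 ?mulr_ge0 ?fnorm_ge0 ?opnorm_ge0// opnorm_mul.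
    by rewrite exprMn ler_wpM2r// sqr_ge0.
  have := @noise_square_moment R n p r mu gmu J (rho *: usubmx b)
    (rho *: (selmx R S *m dsubmx b)) (W S b) tau (th #|J|) t0 (th0 _) (th1 _) (W01 S b) (mW S b) WP.
  move=> H; apply: (le_trans (lee_wpmul2l _ H)) => //.
  have sp : 0 < Num.sqrt (1 - 2 * th #|J|)^-1 by rewrite sqrtr_gt0 invr_gt0 subr_gt0.
  rewrite -EFinM lee_fin -[X in X ^+ _](lnK (x := Num.sqrt (1 - 2 * th #|J|)^-1)) ?posrE//.
  by rewrite -expRM_natl -expRD ler_expR /bm /D natrM; lra.
pose Sk := enum [set S : {set 'I_p} | #|S| == k]%SET.
have SkE S : (S \in Sk) = (#|S| == k) by rewrite mem_enum inE.
pose Xi x := \sum_(J : {set 'I_p}) \sum_(S <- Sk) \sum_(b <- net S) F J S b x.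
have mX2 (J S : {set 'I_p}) : measurable_fun setT (fun x => \sum_(b <- net S) F J S b x).
  exact: measurable_sum.
have mX1 (J : {set 'I_p}) : measurable_fun setT (fun x => \sum_(S <- Sk) \sum_(b <- net S) F J S b x).
  exact: measurable_sum.
have X20 J S x : 0 <= \sum_(b <- net S) F J S b x by exact: sumr_ge0.
have X10 J x : 0 <= \sum_(S <- Sk) \sum_(b <- net S) F J S b x by exact: sumr_ge0.
exists Xi; split.
- exact: measurable_sum.
- by move=> x; exact: sumr_ge0.
- rewrite (_ : \int[mu]_x (Xi x)%:E = \sum_(J : {set 'I_p})
      \int[mu]_x (\sum_(S <- Sk) \sum_(b <- net S) F J S b x)%:E)%E; last first.
    rewrite -ge0_integral_sum//.
      by apply: eq_integral => x _; rewrite sumEFin.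
      by move=> J; exact/measurable_EFinP.
    by move=> J x _; rewrite lee_fin X10.
  have M1 : 1 <= M%:R :> R by rewrite ler1n.
  have Ml : 0 < M%:R :> R by exact: lt_le_trans M1.
  apply: (@le_trans _ _ (\sum_(J : {set 'I_p}) (expR (- xm #|J|))%:E)%E).
    apply: lee_sum => J _.
    have B2 (S : {set 'I_p}) : S \in Sk -> (\int[mu]_x (\sum_(b <- net S) F J S b x)%:E <=
        ((M ^ ((r + k) * r))%:R * expR (- xm #|J| - Ent))%:E)%E.
      rewrite SkE => /eqP Sk'.
      apply: le_trans (integral_sum_le _ _ _ _) _; [exact: mF|exact: F0| |by move=> b _; exact: intF|].
        exact: expR_ge0.
      by rewrite lee_fin; apply: ler_wpM2r; rewrite ?expR_ge0 ?ler_nat -?Sk'; last exact: sizeM.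
    apply: le_trans (integral_sum_le (b := (M ^ ((r + k) * r))%:R * expR (- xm #|J| - Ent)) _ _ _ B2) _ => //.
    rewrite lee_fin.
    have -> : size Sk = 'C(p, k).
      by rewrite -cardE cardsE -[in RHS](card_ord p) -card_draws cardsE.
    have Me : (M ^ ((r + k) * r))%:R = expR (((r + k) * r)%:R * ln M%:R) :> R.
      by rewrite natrX -[X in X ^+ _](lnK (x := M%:R)) ?posrE// -expRM_natl.
    apply: (@le_trans _ _ (expR (k%:R * logep R p k) * ((M ^ ((r + k) * r))%:R * expR (- xm #|J| - Ent)))).
      by rewrite ler_wpM2r ?mulr_ge0 ?expR_ge0// bin_le_expR.
    by rewrite Me -!expRD ler_expR /Ent; lra.
  rewrite sumEFin lee_fin; apply: le_trans (sum_subsets_le p _); last by lra.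
  by apply: ler_sum => J _; rewrite ler_expR /xm.
move=> x S J b Sk' bS /= tau_le.
have FX : F J S b x <= Xi x.
  rewrite /Xi (bigD1 J)//= ler_wpDr ?sumr_ge0//.
  have SS : S \in Sk by rewrite SkE Sk'.
  rewrite (big_rem S SS)/= ler_wpDr ?sumr_ge0//.
  by rewrite (big_rem b bS)/= ler_wpDr ?sumr_ge0.
have Ent0 : 0 <= Ent.
  have lk : 0 <= logep R p k by rewrite (le_trans ler01)// logep_ge1// k0.
  by rewrite addr_ge0// mulr_ge0// ln_ge0// ler1n.
have Xi0 : 0 <= Xi x by exact: sumr_ge0.
rewrite frob2_rowres -/(Ent).
have [J0|J0] := posnP #|J|.
  rewrite big1 ?mul0r; last by move=> j; rewrite (cards0_eq J0) inE.
  rewrite J0 pensum0 mulr0 add0r; apply: mulr_ge0; first exact: ltW.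
  apply: mulr_ge0; first exact: addr_ge0.
  by rewrite divr_ge0 ?addr_ge0 ?mulr_ge0// ltW.
have Jp : (#|J| <= p)%N by rewrite -[leqRHS]card_ord max_card.
have xm0 : 0 <= xm #|J|.
  by rewrite mulr_ge0 ?divr_ge0 ?(le_trans _ (ltW b2))// mulr_ge0// (le_trans ler01)// logep_ge1// J0.
have D0 : 0 < D #|J| by rewrite mulr_gt0// ltr0n.
have [c1 c2 c3] := chisq_calibration D0 xm0 e0.
rewrite -/(th #|J|) in c1 c2 c3.
have beta0 : 0 < beta by lra.
have pl := @pensum_lower R r p beta beta0 #|J|.
(* The chi-square deviation with [D = #|J| * r] degrees of freedom at level [xm #|J|] is at most the
   penalty sum. *)
have {}pl : D #|J| + 2 * Num.sqrt (D #|J| * xm #|J|) + 2 * xm #|J| <= pensum r p beta #|J|.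
  apply: le_trans (pl _); last by rewrite J0.
  apply: eq_ler; congr (_ + _ + _); rewrite /D /xm; last by field.
  rewrite (_ : _ * _ * _ = (#|J|%:R / 2) ^+ 2 * (2 * r%:R * beta * logep R p #|J|)); last by field.
  by rewrite sqrtrM ?sqr_ge0// sqrtr_sqr ger0_norm ?divr_ge0// mulrA; congr (_ * _); field.
set N := \sum_(i in J) _.
have EE : E J S b x = N / 2 * (th #|J| / tau).
  rewrite /E /N !mulr_suml; apply: eq_bigr => i _; rewrite !mulr_suml.
  by apply: eq_bigr => j _; rewrite mulrAC.
have thp : 0 < th #|J|.
  by apply: lt_le_trans c1; rewrite divr_gt0// addr_gt0// mulr_gt0.
(* Since [1 + u <= exp u], a single summand of [Xi] bounds its own exponent. *)
have h1 : N / 2 * (th #|J| / tau) <= bm #|J| + Xi x.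
  have := expR_ge1Dx (N / 2 * (th #|J| / tau) - bm #|J|).
  move: FX; rewrite /F /W tau_le mul1r EE -expRD; lra.
have h2 : N / 2 <= tau * ((bm #|J| + Xi x) / th #|J|).
  rewrite mulrA ler_pdivlMr// -ler_pdivrMl//; apply: le_trans h1; apply: eq_ler.
  by field; rewrite gt_eqF.
apply: (le_trans h2); rewrite ler_wpM2l ?(ltW t0)//.
have h3 : (Ent + Xi x) / th #|J| <= (Ent + Xi x) * ((1 + 2 * Num.sqrt eta) / Num.sqrt eta).
  apply: ler_wpM2l; first exact: addr_ge0.
  rewrite -[leRHS]invf_div lef_pV2 ?posrE//.
  by rewrite divr_gt0// addr_gt0// mulr_gt0.
have h4 : (1 + 2 * Num.sqrt eta + 2 * eta) * D #|J| + 2 * Num.sqrt (D #|J| * xm #|J|) + 2 * xm #|J|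
   <= (1 + 2 * Num.sqrt eta + 2 * eta) * pensum r p beta #|J|.
  apply: le_trans (ler_wpM2l _ pl); last by rewrite !addr_ge0// ?mulr_ge0// ltW.
  have := sqrtr_ge0 (D #|J| * xm #|J|); nra.
rewrite /bm -addrA mulrDl; lra.
Qed.
End ChaosLevel.

Lemma frob2_col_mx (R : realType) m1 m2 n (A : 'M[R]_(m1, n)) (B : 'M[R]_(m2, n)) :
  frob2 (col_mx A B) = frob2 A + frob2 B.
Proof.
rewrite /frob2 big_split_ord/=; congr (_ + _); apply: eq_bigr => i _; apply: eq_bigr => j _.
  by rewrite col_mxEu.
by rewrite col_mxEd.
Qed.

Lemma supp_selmx (R : realType) q m (S : {set 'I_q}) (v : 'M[R]_(#|S|, m)) :
  (supp_card (selmx R S *m v) <= #|S|)%N.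
Proof.
rewrite supp_cardE; apply/subset_leq_card/fintype.subsetP => i; rewrite inE.
apply: contraR => iS; apply/eqP/rowP => j; rewrite !mxE big1// => l _.
by rewrite mxE; case: eqP => [e|_]; rewrite ?mul0r//; case/negP: iS; rewrite e enum_valP.
Qed.

(** The two blocks of [b *m y] have norm at most [|b *m y|], and [21] adds the [7] of [U] to the
    [14] of [Z0]. *)
Lemma opnorm_lincomb (R : realType) n p r (rho0 : R) (S : {set 'I_p})
    (U : 'M[R]_(n, r)) (Z0 : 'M[R]_(n, p)) : 0 < rho0 -> (0 < n)%N ->
  (forall y : 'cV[R]_r, fnorm (U *m y) <= 7 * Num.sqrt n%:R * fnorm y) ->
  (forall v : 'cV[R]_p, (supp_card v <= #|S|)%N ->
     fnorm (Z0 *m v) <= 14 * Num.sqrt n%:R * fnorm v) ->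
  forall b : 'M[R]_(r + #|S|, r),
    opnorm (lincomb (rho0 / Num.sqrt n%:R) U Z0 b) <= 21 * rho0 * opnorm b.
Proof.
move=> rho0p n0 HU HZ b.
have sn : 0 < Num.sqrt n%:R :> R by rewrite sqrtr_gt0 ltr0n.
set rho := rho0 / _; have rp : 0 < rho by rewrite divr_gt0.
apply: opnorm_le => [|y]; first by rewrite !mulr_ge0 ?opnorm_ge0// ltW.
have by_ : fnorm (b *m y) <= opnorm b * fnorm y by exact: opnorm_mul.
have split_b : frob2 (b *m y) = frob2 (usubmx b *m y) + frob2 (dsubmx b *m y).
  by rewrite -frob2_col_mx -mul_col_mx vsubmxK.
have u_le : fnorm (usubmx b *m y) <= fnorm (b *m y).
  by rewrite ler_wsqrtr// split_b lerDl frob2_ge0.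
have d_le : fnorm (selmx R S *m (dsubmx b *m y)) <= fnorm (b *m y).
  by rewrite ler_wsqrtr// frob2_isometry ?selmx_isometry// split_b lerDr frob2_ge0.
have -> : lincomb rho U Z0 b *m y =
    rho *: (U *m (usubmx b *m y) + Z0 *m (selmx R S *m (dsubmx b *m y))).
  by rewrite /lincomb -!scalemxAr -scalerDr -scalemxAl mulmxDl !mulmxA.
rewrite fnormZ (ger0_norm (ltW rp)).
have h1 := HU (usubmx b *m y).
have h2 := HZ _ (supp_selmx (dsubmx b *m y)).
have h3 := fnormD (U *m (usubmx b *m y)) (Z0 *m (selmx R S *m (dsubmx b *m y))).
have h4 : fnorm (U *m (usubmx b *m y) + Z0 *m (selmx R S *m (dsubmx b *m y))) <=
    21 * Num.sqrt n%:R * (opnorm b * fnorm y).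
  have m1 := ler_wpM2l (ltW sn) (le_trans u_le by_).
  have m2 := ler_wpM2l (ltW sn) (le_trans d_le by_).
  by lra.
apply: le_trans (ler_wpM2l (ltW rp) h4) _; apply: eq_ler.
by rewrite /rho; field; rewrite gt_eqF.
Qed.

Lemma chaos_constants (R : realType) (delta g l T E A X C1 : R) :
  0 < delta < 1 -> 0 <= g -> 0 <= l -> 0 <= T -> 0 <= C1 -> 0 <= A ->
  0 <= E + X <= (1 + l) * A ->
  (1 + delta / 20) ^+ 2 * ((1 + delta / 10) * T + (E + X) * g) <=
  (1 + delta) * T + (2 * C1 + 2 * g * (1 + l)) * A.
Proof.
move=> /andP[d0 d1] g0 l0 T0 C0 A0 /andP[E0 EA].
have s1 : (1 + delta / 20) ^+ 2 <= 1 + delta / 5 by nra.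
have s2 : (1 + delta / 5) * (1 + delta / 10) <= 1 + delta by nra.
have h1 := ler_wpM2r T0 s2.
have h2 : (E + X) * g <= (1 + l) * A * g by exact: ler_wpM2r.
have h3 : 0 <= (E + X) * g by exact: mulr_ge0.
have h4 : 0 <= (1 + delta / 10) * T by apply: mulr_ge0 => //; lra.
have h5 : (1 + delta / 5) * ((E + X) * g) <= 2 * ((E + X) * g) by apply: ler_wpM2r => //; lra.
have h6 : 0 <= C1 * A by exact: mulr_ge0.
apply: le_trans (ler_wpM2r (addr_ge0 h4 h3) s1) _.
by rewrite mulrDr mulrA; lra.
Qed.

(** Two levels of the union bound are combined. The coarse one holds at every net point and, by
    [net_sup_bound], over the whole ball up to a factor. The sharp one is used only at a net point
    near the parameter of the given orthonormal [L], where the operator norm is close to [1]. The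
    difference is controlled by [eps] times the coarse bound, so the leading constant stays within
    [1 + delta]. *)
Lemma chaos_bound (R : realType) (beta delta rho0 : R) :
  2 < beta -> 0 < delta < 1 -> 0 < rho0 -> exists C : R, 0 < C /\
  forall (n p r k : nat) (mu : probability (cfg R (noise_idx n p r)) R), gaussian_law mu ->
  (0 < n)%N -> (0 < r)%N -> (0 < k <= p)%N ->
  exists Xi : cfg R (noise_idx n p r) -> R, [/\ measurable_fun setT Xi, forall x, 0 <= Xi x,
    (\int[mu]_x (Xi x)%:E <= C%:E)%E &
    forall x (a1 : 'M[R]_r) (a2 : 'M[R]_(p, r)) (J : {set 'I_p}),
      (forall y : 'cV[R]_r, fnorm (sigU x *m y) <= 7 * Num.sqrt n%:R * fnorm y) ->
      (forall v : 'cV[R]_p, (supp_card v <= k)%N ->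
         fnorm ((sigZ x + sigT x) *m v) <= 14 * Num.sqrt n%:R * fnorm v) ->
      (supp_card a2 <= k)%N ->
      (forall y : 'cV[R]_r, frob2 (a1 *m y) + frob2 (a2 *m y) <= rho0 ^+ 2 / n%:R * frob2 y) ->
      let L := sigU x *m a1 + (sigZ x + sigT x) *m a2 in
      L^T *m L = 1%:M ->
      frob2 (rowres J ((sigZ x - sigT x)^T *m L)) / 2 <=
      (1 + delta) * pensum r p beta #|J| +
      C * (k%:R * logep R p k + ((r + k) * r)%:R + Xi x)].
Proof.
move=> b2 /andP[d0 d1] rhop.
pose La := 21 * rho0; have La0 : 0 < La by rewrite mulr_gt0.
(* Then [La * eps <= delta / 60]. The sharp level loses [La * eps] and the approximation
   [2 * (La * eps)], in all at most [delta / 20]. *)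
pose eps := delta / (60 * (1 + La)).
have d01 : 0 < delta < 1 by rewrite d0.
have La1 : 0 < 60 * (1 + La) by lra.
have e0 : 0 < eps by rewrite divr_gt0.
have Le : La * eps <= delta / 60.
  by rewrite /eps mulrA ler_pdivrMr//; nra.
have e1 : eps <= 60^-1 by rewrite /eps ler_pdivrMr//; lra.
have i2 : (1 - eps)^-1 <= 2 by rewrite invf_ple ?posrE//; lra.
have eps1 : 0 <= eps < 1 by rewrite (ltW e0)/=; lra.
have u3 : 1 + La * eps + 2 * (La * eps) <= 1 + delta / 20 by lra.
have beta0 : 0 < beta by lra.
have d20 : 0 <= 1 + delta / 20 by lra.
have d10 : 0 <= 1 + delta / 10 by lra.
pose M := (Num.truncn (1 + 8 / eps)).+1.
have eM : 1 + 8 / eps <= M%:R by apply/ltW; exact: truncnS_gt.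
have lM0 : 0 <= ln M%:R :> R by rewrite ln_ge0// ler1n.
(* Small enough for the calibration factor [1 + 2 * Num.sqrt eta + 2 * eta] to be at most
   [1 + delta / 10]. *)
pose eta := (delta / 60) ^+ 2.
have s_eta : Num.sqrt eta = delta / 60 by rewrite sqrtr_sqr ger0_norm// divr_ge0// ltW.
have seta1 : 1 + 2 * Num.sqrt eta + 2 * eta <= 1 + delta / 10 by rewrite s_eta /eta; nra.
have eta0 : 0 < eta by rewrite exprn_gt0// divr_gt0.
pose g := (1 + 2 * Num.sqrt eta) / Num.sqrt eta.
have g0 : 0 < g by rewrite /g s_eta !divr_gt0//; lra.
pose C1 : R := (1 - expR (- (beta / 2 - 1)))^-1.
have C10 : 0 < C1 by rewrite invr_gt0 subr_gt0 expR_lt1; lra.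
pose C := 2 * C1 + 2 * g * (1 + ln M%:R).
have gl : 0 < 2 * g * (1 + ln M%:R).
  by apply: mulr_gt0; [exact: mulr_gt0|apply: lt_le_trans ltr01 _; rewrite lerDl].
exists C; split; first by rewrite /C; lra.
move=> n p r k mu gmu n0 r0 kp.
have sn : 0 < Num.sqrt n%:R :> R by rewrite sqrtr_gt0 ltr0n.
have e01 : 0 < eps < 1 by rewrite e0/=; lra.
have [net netP] : exists net : (forall S : {set 'I_p}, seq 'M[R]_(r + #|S|, r)), forall S : {set 'I_p},
    [/\ (size (net S) <= M ^ ((r + #|S|) * r))%N, forall a, a \in net S -> opnorm a <= 1 &
    forall a : 'M[R]_(r + #|S|, r), opnorm a <= 1 -> exists2 b, b \in net S & opnorm (a - b) <= eps].
  exists (fun S : {set 'I_p} => sval (cid (exists_opnorm_net (r + #|S|) r e01 eM))) => S.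
  exact: svalP (cid (exists_opnorm_net (r + #|S|) r e01 eM)).
have netM S : (size (net S) <= M ^ ((r + #|S|) * r))%N by have [] := netP S.
have t1 : 0 < (1 + La * eps) ^+ 2 by rewrite exprn_gt0// addr_gt0// mulr_gt0.
have t2 : 0 < La ^+ 2 by rewrite exprn_gt0.
pose rho := rho0 / Num.sqrt n%:R.
have rp : 0 < rho by rewrite divr_gt0.
have M0 : (0 < M)%N by [].
have [Xi1 [mXi1 Xi10 iXi1 Xi1P]] := chaos_level gmu rho b2 eta0 t1 M0 r0 kp netM.
have [Xi2 [mXi2 Xi20 iXi2 Xi2P]] := chaos_level gmu rho b2 eta0 t2 M0 r0 kp netM.
exists (fun x => Xi1 x + Xi2 x); split.
- exact: measurable_funD.
- by move=> x; rewrite addr_ge0.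
- under eq_integral do rewrite EFinD.
  rewrite ge0_integralD//; try by [move=> x _; rewrite lee_fin|exact/measurable_EFinP].
  by apply: le_trans (leeD iXi1 iXi2) _; rewrite -EFinD lee_fin -/C1 /C; lra.
move=> x a1 a2 J HU HZ a2k Ha L LL.
have [k0 kp'] := andP kp.
have [S a2S Sk] : exists2 S : {set 'I_p}, suppmx a2 \subset S & #|S| = k.
  by apply: exists_superset_card; rewrite -supp_cardE a2k card_ord.
have HZS (v : 'cV[R]_p) : (supp_card v <= #|S|)%N ->
    fnorm ((sigZ x + sigT x) *m v) <= 14 * Num.sqrt n%:R * fnorm v.
  by rewrite Sk; exact: HZ.
have opL := opnorm_lincomb rhop n0 HU HZS; rewrite -/rho -/La in opL.
pose Lc (b : 'M[R]_(r + #|S|, r)) := lincomb rho (sigU x) (sigZ x + sigT x) b.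
pose N b := fnorm (rowres J ((sigZ x - sigT x)^T *m Lc b)).
have ND a b : N (a + b) <= N a + N b.
  by rewrite /N /Lc lincombD mulmxDr rowresD fnormD.
have NZ t a : 0 <= t -> N (t *: a) = t * N a.
  by move=> t0; rewrite /N /Lc lincombZ -scalemxAr rowresZ fnormZ ger0_norm.
(* The parameter of [L]; the hypothesis on [a1] and [a2] puts it in the unit ball. *)
pose b := rho^-1 *: col_mx a1 ((selmx R S)^T *m a2).
have Lb : Lc b = L.
  rewrite /Lc /b lincombZ /lincomb col_mxKu col_mxKd selmxK//.
  by rewrite -!scalemxAr -scalerDr scalerA mulVf ?scale1r// gt_eqF.
have ob : opnorm b <= 1.
  apply: opnorm_le => // y; rewrite fnorm_le// expr1n mul1r /b -scalemxAl frob2Z.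
  rewrite mul_col_mx frob2_col_mx.
  have h : frob2 ((selmx R S)^T *m a2 *m y) <= frob2 (a2 *m y).
    by rewrite -mulmxA frob2_isometryT// selmx_isometry.
  rewrite exprVn ler_pdivrMl ?exprn_gt0//.
  apply: le_trans (_ : frob2 (a1 *m y) + frob2 (a2 *m y) <= _); first by rewrite lerD2l.
  by apply: le_trans (Ha y) _; rewrite /rho expr_div_n sqr_sqrtr.
have Jp : (#|J| <= p)%N by rewrite -[leqRHS]card_ord max_card.
pose T := pensum r p beta #|J|.
have T0 : 0 <= T by exact: pensum_ge0.
pose Ent : R := k%:R * logep R p k + ((r + k) * r)%:R * ln M%:R.
have lk : 0 <= logep R p k by rewrite (le_trans ler01)// logep_ge1.
have kl0 : 0 <= k%:R * logep R p k by rewrite mulr_ge0.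
have Ent0 : 0 <= Ent by rewrite addr_ge0// mulr_ge0.
pose K := (1 + delta / 10) * T + (Ent + (Xi1 x + Xi2 x)) * g.
have K0 : 0 <= K.
  apply: addr_ge0; first exact: mulr_ge0.
  by apply: mulr_ge0; [|exact: ltW]; apply: addr_ge0 => //; exact: addr_ge0.
have calib tau (N2 : R) Xi' : 0 <= tau -> 0 <= Xi' <= Xi1 x + Xi2 x ->
    N2 / 2 <= tau ^+ 2 * ((1 + 2 * Num.sqrt eta + 2 * eta) * T + (Ent + Xi') * g) ->
    N2 <= (tau * Num.sqrt (2 * K)) ^+ 2.
  move=> tau0 /andP[X'0 X'X] h; rewrite exprMn sqr_sqrtr ?mulr_ge0//.
  have : (1 + 2 * Num.sqrt eta + 2 * eta) * T + (Ent + Xi') * g <= K.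
    apply: lerD; last by rewrite ler_wpM2r ?(ltW g0)// lerD2l.
    by rewrite ler_wpM2r.
  move=> /(ler_wpM2l (sqr_ge0 tau)); clear -h; lra.
have s2K : 0 <= Num.sqrt (2 * K) by exact: sqrtr_ge0.
have La0' := ltW La0.
(* Coarse level: every net point gives a matrix of operator norm at most [La]. *)
have crude c : c \in net S -> N c <= La * Num.sqrt (2 * K).
  move=> cS; rewrite -ler_sqr ?nnegrE; [|exact: fnorm_ge0|exact: mulr_ge0].
  rewrite sqr_fnorm.
  apply: (calib _ _ (Xi2 x)); rewrite ?La0' ?Xi20 ?lerDr ?Xi10//.
  apply: Xi2P => //; rewrite lerXn2r ?nnegrE ?opnorm_ge0 ?La0'//.
  apply: le_trans (opL c) _; rewrite ler_piMr ?La0'//.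
  by have [_ + _] := netP S; exact.
have NB c : opnorm c <= 1 -> N c <= fnorm (sigZ x - sigT x)^T * ((n * r)%:R * La).
  move=> c1; apply: le_trans (_ : fnorm ((sigZ x - sigT x)^T *m Lc c) <= _).
    by rewrite ler_wsqrtr// frob2_rowres_le.
  apply: le_trans (fnorm_mul _ _) _; rewrite ler_wpM2l ?fnorm_ge0//.
  apply: fnorm_le_sum => i j; apply: le_trans (entry_le_opnorm _ i j) _.
  by apply: le_trans (opL c) _; rewrite ler_piMr ?La0'.
have crude' c : opnorm c <= 1 -> N c <= La * Num.sqrt (2 * K) / (1 - eps).
  move=> c1; have [_ _ n3] := netP S.
  by apply: net_sup_bound n3 ND NZ crude NB _ c1.
have [b' b'S bb'] : exists2 b', b' \in net S & opnorm (b - b') <= eps.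
  by have [_ _ n3] := netP S; exact: n3.
(* Sharp level: [L] is an isometry and [b'] is within [eps] of its parameter, so the matrix of [b']
   has operator norm at most [1 + La * eps]. *)
have sharp : N b' <= (1 + La * eps) * Num.sqrt (2 * K).
  have p1 : 0 <= 1 + La * eps by rewrite addr_ge0// mulr_ge0// ltW.
  rewrite -ler_sqr ?nnegrE; [|exact: fnorm_ge0|exact: mulr_ge0].
  rewrite sqr_fnorm.
  apply: (calib _ _ (Xi1 x)); rewrite ?Xi10 ?lerDl ?Xi20//.
  apply: Xi1P => //; rewrite lerXn2r ?nnegrE ?opnorm_ge0//.
  have LD : Lc b' = L + -1 *: Lc (b - b').
    by rewrite -Lb /Lc -lincombZ -lincombD scaleN1r opprB addrCA subrr addr0.
  rewrite -/(Lc b') LD; apply: le_trans (opnormD _ _) _.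
  apply: lerD.
    apply: opnorm_le => // y; rewrite mul1r ler_wsqrtr// frob2_isometry//.
  rewrite opnormZ normrN1 mul1r; apply: le_trans (opL _) _.
  by rewrite ler_wpM2l// ltW.
have diff : N (b - b') <= eps * (La * Num.sqrt (2 * K) / (1 - eps)).
  have -> : b - b' = eps *: (eps^-1 *: (b - b')) by rewrite scalerA divff ?scale1r// gt_eqF.
  rewrite NZ ?(ltW e0)// ler_wpM2l ?(ltW e0)// crude'// opnormZ ger0_norm ?invr_ge0 ?(ltW e0)//.
  by rewrite ler_pdivrMl// mulr1.
have Nb : N b <= (1 + delta / 20) * Num.sqrt (2 * K).
  have -> : b = b' + (b - b') by rewrite addrCA subrr addr0.
  apply: le_trans (ND _ _) _.
  have diff' : N (b - b') <= 2 * (La * eps) * Num.sqrt (2 * K).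
    apply: (le_trans diff).
    rewrite [leLHS](_ : _ = La * eps * Num.sqrt (2 * K) * (1 - eps)^-1); last by ring.
    rewrite [leRHS](_ : _ = La * eps * Num.sqrt (2 * K) * 2); last by ring.
    by apply: ler_wpM2l => //; do 2?apply: mulr_ge0 => //; exact: ltW.
  apply: le_trans (lerD sharp diff') _.
  by apply: le_trans (ler_wpM2r s2K u3); rewrite [leRHS]mulrDl.
have {}Nb : frob2 (rowres J ((sigZ x - sigT x)^T *m L)) <= (1 + delta / 20) ^+ 2 * (2 * K).
  have K2 : 0 <= 2 * K by exact: mulr_ge0.
  rewrite -Lb -sqr_fnorm -(sqr_sqrtr K2) -exprMn.
  by rewrite lerXn2r ?nnegrE//; [exact: fnorm_ge0|exact: mulr_ge0].
apply: le_trans (_ : (1 + delta / 20) ^+ 2 * K <= _).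
  by rewrite ler_pdivrMr// mulrAC -mulrA.
pose A : R := k%:R * logep R p k + ((r + k) * r)%:R + (Xi1 x + Xi2 x).
have X0 : 0 <= Xi1 x + Xi2 x by exact: addr_ge0.
have A0 : 0 <= A by apply: addr_ge0 => //; exact: addr_ge0.
have EntA : Ent + (Xi1 x + Xi2 x) <= (1 + ln M%:R) * A.
  have q1 : 0 <= ln M%:R * (k%:R * logep R p k) by exact: mulr_ge0.
  have q2 : 0 <= ln M%:R * (Xi1 x + Xi2 x) by exact: mulr_ge0.
  have q3 : 0 <= ((r + k) * r)%:R :> R by [].
  by rewrite /Ent /A; clear -q1 q2 q3; lra.
apply: chaos_constants => //; try exact: ltW.
by apply/andP; split => //; exact: addr_ge0.
Qed.

(** * Spectral theorem for symmetric matrices and the thin SVD *)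

Section SpectralTheorem.
Variable R : realType.

(** Positivity at the vector [x - N^-1 *: (A *m x)] gives [|A x|^2 <= N * fdot x (A *m x)], and
    invertibility bounds [|x|] by a multiple of [|A x|]. *)
Lemma psd_unitmx_gap r (A : 'M[R]_r) : A^T = A -> A \in unitmx ->
  (forall x : 'cV[R]_r, 0 <= fdot x (A *m x)) ->
  exists2 c : R, 0 < c & forall x : 'cV[R]_r, c * frob2 x <= fdot x (A *m x).
Proof.
move=> AT Au psd.
pose N := 1 + fnorm A; pose N' := 1 + frob2 (invmx A).
have N0 : 0 < N by rewrite ltr_pwDl// fnorm_ge0.
have N'0 : 0 < N' by rewrite ltr_pwDl// frob2_ge0.
exists ((N * N')^-1) => [|x]; first by rewrite invr_gt0 mulr_gt0.
have b1 : frob2 x <= N' * frob2 (A *m x).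
  rewrite -{1}(mulKmx Au x); apply: le_trans (frob2_mul _ _) _.
  by rewrite ler_wpM2r ?frob2_ge0// lerDr.
have b2 : fdot (A *m x) (A *m (A *m x)) <= N * frob2 (A *m x).
  apply: le_trans (fdot_le _ _) _; rewrite -sqr_fnorm expr2 mulrCA ler_wpM2l ?fnorm_ge0//.
  by apply: le_trans (fnorm_mul _ _) _; rewrite ler_wpM2r ?fnorm_ge0// lerDr.
have sym (y z : 'cV[R]_r) : fdot y (A *m z) = fdot (A *m y) z.
  by rewrite !fdot_tr trmx_mul AT mulmxA.
have b3 : 0 <= fdot x (A *m x) - 2 * (N^-1 * frob2 (A *m x)) +
    N^-1 ^+ 2 * fdot (A *m x) (A *m (A *m x)).
  apply: le_trans (psd (x - N^-1 *: (A *m x))) _; apply: eq_ler.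
  rewrite mulmxBr -scalemxAr !(fdotDl, fdotDr, fdotNl, fdotNr, fdotZl, fdotZr).
  by rewrite [fdot x (A *m (A *m x))]sym fdotAA; ring.
have b4 : N^-1 * frob2 (A *m x) <= fdot x (A *m x).
  have := ler_wpM2l (sqr_ge0 N^-1) b2.
  have -> : N^-1 ^+ 2 * (N * frob2 (A *m x)) = N^-1 * frob2 (A *m x).
    by field; rewrite gt_eqF.
  by lra.
apply: le_trans b4; rewrite ler_pdivrMl ?mulr_gt0//.
by rewrite [leRHS](_ : _ = N' * frob2 (A *m x))//; field; rewrite gt_eqF.
Qed.

(** Let [a] be the largest number for which [A - a%:M] is positive semidefinite. If that matrix were
    invertible, [psd_unitmx_gap] would allow a larger [a], so it has a kernel. The argument takes a
    supremum of numbers in place of a minimum over the sphere. *)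
Lemma min_eigenvector r (A : 'M[R]_r.+1) : A^T = A -> exists a : R,
  (exists2 v : 'cV[R]_r.+1, v != 0 & A *m v = a *: v) /\
  forall y : 'cV[R]_r.+1, a * frob2 y <= fdot y (A *m y).
Proof.
move=> AT; pose E := [set a : R | forall y : 'cV[R]_r.+1, a * frob2 y <= fdot y (A *m y)].
have Es : has_sup E.
  split.
    exists (- fnorm A) => y; rewrite mulNr lerNl -fdotNl; apply: le_trans (fdot_le _ _) _.
    rewrite fnormN mulrC -sqr_fnorm expr2 mulrA ler_wpM2r ?fnorm_ge0//.
    exact: fnorm_mul.
  exists (fdot (delta_mx 0 0 : 'cV_r.+1) (A *m delta_mx 0 0)) => a /(_ (delta_mx 0 0)).
  suff -> : frob2 (delta_mx 0 0 : 'cV[R]_r.+1) = 1 by rewrite mulr1.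
  rewrite /frob2 (bigD1 ord0)//= !big_ord1 mxE eqxx expr1n big1 ?addr0// => i i0.
  by rewrite big_ord1 mxE (negbTE i0) expr0n.
pose a := sup E.
have aE : forall y : 'cV[R]_r.+1, a * frob2 y <= fdot y (A *m y).
  move=> y; rewrite leNgt; apply/negP => h.
  have [y0|yn0] := eqVneq (frob2 y) 0.
    by move: h; rewrite (frob2_eq0 y0) mulmx0 fdotAA frob2_0 mulr0 ltxx.
  have yp : 0 < frob2 y by rewrite lt_neqAle eq_sym yn0 frob2_ge0.
  move: h; rewrite -ltr_pdivrMr// => h.
  have [a' a'E] := sup_gt Es.1 h.
  by rewrite ltNge => /negP; apply; rewrite ler_pdivlMr//; exact: a'E.
exists a; split=> //.
pose B := A - a%:M.
have BT : B^T = B by rewrite /B linearB/= AT tr_scalar_mx.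
have Bq (y : 'cV[R]_r.+1) : fdot y (B *m y) = fdot y (A *m y) - a * frob2 y.
  by rewrite mulmxBl mul_scalar_mx fdotDr fdotNr fdotZr fdotAA.
have [Bu|Bn] := boolP (B \in unitmx).
  have [|c c0 Bc] := psd_unitmx_gap BT Bu; first by move=> x; rewrite Bq subr_ge0.
  have : a + c <= a.
    apply: ub_le_sup; first exact: Es.2.
    by move=> y; have := Bc y; rewrite Bq mulrDl; lra.
  by move=> h; exfalso; move: h; rewrite gerDl leNgt c0.
move: Bn; rewrite unitmxE unitfE negbK => /det0P[u u0 uB].
exists u^T; first by rewrite -(inj_eq trmx_inj) trmxK trmx0.
have : (u *m B)^T = 0 by rewrite uB trmx0.
rewrite trmx_mul BT mulmxBl mul_scalar_mx => /eqP; rewrite subr_eq0 => /eqP //.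
Qed.

(** Passes from eigenvalues to vectors: the smallest eigenvalue of [M^T *m M] bounds its Rayleigh
    quotient from below. *)
Lemma sigma_r_ge_fnorm r (M : 'M[R]_r) (c : R) (y : 'cV[R]_r) : 0 <= c ->
  sigma_r_ge M c -> c * fnorm y <= fnorm (M *m y).
Proof.
move=> c0 sM.
case: r M y sM => [|r] M y sM; first by rewrite [y]flatmx0 fnorm0 mulr0 fnorm_ge0.
have [|a [[v v0 va] am]] := @min_eigenvector r (M^T *m M); first by rewrite trmx_mul trmxK.
have : c ^+ 2 <= a.
  apply: sM; apply/eigenvalueP; exists v^T; last by rewrite -(inj_eq trmx_inj) trmxK trmx0.
  by apply: trmx_inj; rewrite trmx_mul trmxK linearZ/= trmxK -va !trmx_mul trmxK.
move=> ca; rewrite -ler_sqr ?nnegrE ?mulr_ge0 ?fnorm_ge0// exprMn !sqr_fnorm.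
apply: le_trans (ler_wpM2r (frob2_ge0 _) ca) _.
by apply: le_trans (am y) _; rewrite -fdotAA !fdot_tr trmx_mul !mulmxA.
Qed.

(** The Householder reflection along [v - e] exchanges [v] and the first basis vector [e]. *)
Lemma orthogonal_first_col r (v : 'cV[R]_r.+1) : frob2 v = 1 ->
  exists2 H : 'M[R]_r.+1, H^T *m H = 1%:M & H *m delta_mx 0 0 = v.
Proof.
move=> v1; pose e : 'cV[R]_r.+1 := delta_mx 0 0.
have [->|vne] := eqVneq v e; first by exists 1%:M; rewrite ?trmx1 mul1mx.
pose w := v - e; pose s := frob2 w.
have s0 : s != 0 by apply: contraNneq vne => /frob2_eq0/eqP; rewrite subr_eq0.
have ww : w^T *m w = s%:M by rewrite [LHS]mx11_scalar -trace_mx11 -fdot_tr fdotAA.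
have e1 : fdot e e = 1.
  rewrite /fdot (bigD1 ord0)//= !big_ord1 mxE eqxx mulr1 big1 ?addr0// => i i0.
  by rewrite big_ord1 mxE (negbTE i0) mulr0.
have we : w^T *m e = (- s / 2)%:M.
  rewrite [LHS]mx11_scalar -trace_mx11 -fdot_tr; congr (_%:M).
  rewrite /s -fdotAA /w !(fdotDl, fdotDr, fdotNl, fdotNr) e1 fdotAA v1 [fdot e v]fdotC.
  by field.
pose H := 1%:M - (2 / s) *: (w *m w^T).
have HT : H^T = H by rewrite /H linearB/= linearZ/= trmx_mul trmxK trmx1.
exists H.
  rewrite HT /H mulmxBl mul1mx mulmxBr mulmx1 -!scalemxAl -!scalemxAr.
  rewrite mulmxA -[w *m w^T *m w]mulmxA ww mul_mx_scalar -scalemxAl !scalerA.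
  rewrite (_ : 2 / s * (2 / s * s) = 2 / s + 2 / s); last by field.
  by rewrite scalerDl opprB addrK subrK.
rewrite /H mulmxBl mul1mx -scalemxAl -mulmxA we mul_mx_scalar scalerA.
have -> : 2 / s * (- s / 2) = -1 by field.
by rewrite scaleN1r opprK addrC subrK.
Qed.

Lemma block_of_first_col r (B : 'M[R]_(1 + r)) (a : R) :
  (forall i : 'I_r.+1, B i ord0 = a * (i == ord0)%:R) ->
  (forall i : 'I_r.+1, B ord0 i = a * (i == ord0)%:R) ->
  B = block_mx a%:M 0 0 (drsubmx B).
Proof.
move=> Bi0 B0i; rewrite -[LHS]submxK; congr (block_mx _ _ _ _); apply/matrixP => i j; rewrite !mxE.
- rewrite (ord1 i) (ord1 j) (_ : lshift r 0 = ord0); last exact: val_inj.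
  by rewrite mulr1n; apply: etrans (Bi0 ord0) _; rewrite eqxx mulr1.
- rewrite (ord1 i) (_ : lshift r 0 = ord0); last exact: val_inj.
  by apply: etrans (B0i (@rshift 1 r j)) _; rewrite mulr0.
- rewrite (ord1 j) (_ : lshift r 0 = ord0); last exact: val_inj.
  by apply: etrans (Bi0 (@rshift 1 r i)) _; rewrite mulr0.
Qed.

(** Moving a unit eigenvector to the first basis vector makes the matrix block diagonal, and
    induction treats the remaining block. *)
Lemma symmetric_spectral r (A : 'M[R]_r) : A^T = A ->
  exists Q : 'M[R]_r, exists d : 'rV[R]_r, Q^T *m Q = 1%:M /\ A = Q *m diag_mx d *m Q^T.
Proof.
elim: r A => [|r IH] A AT.
  by exists 1%:M, 0; split; apply/matrixP => i; case: i.
have [a [[v v0 va] _]] := min_eigenvector AT.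
pose u := (fnorm v)^-1 *: v.
have vn0 : fnorm v != 0.
  apply: contraNneq v0 => h; apply/eqP/frob2_eq0.
  by rewrite -sqr_fnorm h expr0n.
have u1 : frob2 u = 1 by rewrite /u frob2Z -sqr_fnorm -exprMn mulVf// expr1n.
have ua : A *m u = a *: u by rewrite /u -scalemxAr va !scalerA mulrC.
have [H HH He] := orthogonal_first_col u1.
have HH' : H *m H^T = 1%:M by exact: mulmx1C.
pose B : 'M[R]_(1 + r) := H^T *m A *m H.
have BT : B^T = B by rewrite /B !trmx_mul trmxK AT mulmxA.
have Be : H^T *m A *m H *m delta_mx 0 0 = a *: (delta_mx 0 0 : 'cV[R]_r.+1).
  by rewrite -!mulmxA He ua -scalemxAr -He mulmxA HH mul1mx.
have Bi0 (i : 'I_r.+1) : B i ord0 = a * (i == ord0)%:R.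
  have : col ord0 (H^T *m A *m H) = a *: delta_mx 0 0 by rewrite colE Be.
  by move/colP/(_ i); rewrite [LHS]mxE [RHS]mxE [in RHS]mxE eqxx andbT.
have B0i (i : 'I_r.+1) : B ord0 i = a * (i == ord0)%:R by rewrite -{1}BT mxE Bi0.
have Bb := block_of_first_col Bi0 B0i.
have [Q [d [QQ QA]]] := IH (drsubmx B) (ltac:(by rewrite trmx_drsub BT)).
pose G : 'M[R]_(1 + r) := block_mx 1%:M 0 0 Q.
pose D : 'rV[R]_(1 + r) := row_mx a%:M d.
have GG : G^T *m G = 1%:M.
  rewrite tr_block_mx !trmx0 trmx1 mulmx_block !mulmx0 !mul0mx !addr0 !add0r QQ mulmx1.
  by rewrite -scalar_mx_block.
have BG : B = G *m diag_mx D *m G^T.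
  rewrite Bb QA tr_block_mx !trmx0 trmx1 diag_mx_row mulmx_block !mulmx0 !mul0mx !addr0 !add0r.
  rewrite mul1mx mulmx_block !mulmx0 !mul0mx !addr0 !add0r mulmx1; congr block_mx.
  by apply/matrixP => i j; rewrite !mxE (ord1 i) (ord1 j).
have {}GG : (G : 'M[R]_r.+1)^T *m G = 1%:M by exact: GG.
have {}BG : H^T *m A *m H = (G : 'M[R]_r.+1) *m diag_mx (D : 'rV[R]_r.+1) *m G^T by exact: BG.
exists (H *m (G : 'M[R]_r.+1)), (D : 'rV[R]_r.+1); split.
  by rewrite trmx_mul mulmxA -[_ *m H^T *m H]mulmxA HH mulmx1.
rewrite trmx_mul mulmxA -[_ *m G *m _]mulmxA -[_ *m (G *m _) *m _]mulmxA -BG.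
by rewrite !mulmxA HH' mul1mx -mulmxA HH' mulmx1.
Qed.

Lemma gram_diag m n (X : 'M[R]_(m, n)) i : (X^T *m X) i i = frob2 (col i X).
Proof.
by rewrite mxE; apply: eq_bigr => j _; rewrite big_ord1 !mxE expr2.
Qed.

(** Diagonalize [B^T *m B] by [Q]; the lower bound on [B] makes the eigenvalues positive, so [C] is
    their square root and [L = B *m Q *m invmx C]. *)
Lemma exists_thin_svd n r (B : 'M[R]_(n, r)) (c : R) : 0 < c ->
  (forall y : 'cV[R]_r, c * fnorm y <= fnorm (B *m y)) ->
  exists L : 'M[R]_(n, r), exists C Q : 'M[R]_r, thin_svd B L C Q /\ C \in unitmx.
Proof.
move=> c0 Bc.
have [Q [d [QQ QA]]] := @symmetric_spectral r (B^T *m B) (ltac:(by rewrite trmx_mul trmxK)).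
have QQ' : Q *m Q^T = 1%:M by exact: mulmx1C.
have dE : Q^T *m (B^T *m B) *m Q = diag_mx d.
  by rewrite QA !mulmxA QQ mul1mx -mulmxA QQ mulmx1.
have d0 i : 0 < d 0 i.
  have -> : d 0 i = frob2 (B *m col i Q).
    by rewrite colE mulmxA -colE -gram_diag trmx_mul -!mulmxA [B^T *m _]mulmxA mulmxA dE mxE eqxx.
  rewrite -sqr_fnorm exprn_gt0//; apply: lt_le_trans (Bc _).
  by rewrite mulr_gt0// sqrtr_gt0 -gram_diag QQ mxE eqxx.
pose C : 'M[R]_r := diag_mx (\row_i Num.sqrt (d 0 i)).
pose Ci : 'M[R]_r := diag_mx (\row_i (Num.sqrt (d 0 i))^-1).
have s0 i : Num.sqrt (d 0 i) != 0 by rewrite gt_eqF// sqrtr_gt0.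
have CCi : Ci *m C = 1%:M.
  rewrite mulmx_diag -diag_const_mx; congr diag_mx; apply/rowP => i; rewrite !mxE mulVf//.
have CdC : Ci *m diag_mx d *m Ci = 1%:M.
  rewrite !mulmx_diag -diag_const_mx; congr diag_mx; apply/rowP => i; rewrite !mxE.
  by rewrite -{2}(sqr_sqrtr (ltW (d0 i))); field.
have CiT : Ci^T = Ci by rewrite tr_diag_mx.
exists (B *m Q *m Ci), C, Q; split; last by have [] := mulmx1_unit CCi.
split=> //.
- rewrite !trmx_mul CiT -CdC -dE !mulmxA//.
- by move=> i j ij; rewrite !mxE (negbTE ij).
- by move=> i; rewrite !mxE eqxx mulr1n sqrtr_ge0.
- by rewrite -!mulmxA [Ci *m _]mulmxA CCi mul1mx QQ' mulmx1.
Qed.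
End SpectralTheorem.

(** * Loss between projections *)

Section Projections.
Variable R : realType.

Lemma frob2_idem p (Q : 'M[R]_p) : Q^T = Q -> Q *m Q = Q -> frob2 Q = \tr Q.
Proof. by move=> QT QQ; rewrite -fdotAA fdot_tr QT QQ. Qed.

Lemma frob2_orthonormal p r (V : 'M[R]_(p, r)) : V^T *m V = 1%:M -> frob2 V = r%:R.
Proof. by move=> VV; rewrite -fdotAA fdot_tr VV mxtrace1. Qed.

Lemma frob2_sum_col m n (X : 'M[R]_(m, n)) : frob2 X = \sum_j frob2 (col j X).
Proof.
rewrite /frob2 exchange_big/=; apply: eq_bigr => j _; apply: eq_bigr => i _.
by rewrite big_ord1 mxE.
Qed.

Lemma frob2_mulr_ge m n k (W : 'M[R]_(m, n)) (A : 'M[R]_(n, k)) (s : R) :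
  (forall y : 'cV[R]_n, s * frob2 y <= frob2 (A^T *m y)) -> s * frob2 W <= frob2 (W *m A).
Proof.
move=> As; rewrite -[in leLHS]frob2_trmx -[in leRHS]frob2_trmx trmx_mul !frob2_sum_col mulr_sumr.
by apply: ler_sum => j _; rewrite !colE -mulmxA.
Qed.

Lemma frob2_mulr_le m n k (W : 'M[R]_(m, n)) (A : 'M[R]_(n, k)) (s : R) :
  (forall y : 'cV[R]_n, frob2 (A^T *m y) <= s * frob2 y) -> frob2 (W *m A) <= s * frob2 W.
Proof.
move=> As; rewrite -[in leRHS]frob2_trmx -[in leLHS]frob2_trmx trmx_mul !frob2_sum_col mulr_sumr.
by apply: ler_sum => j _; rewrite !colE -mulmxA.
Qed.

Variables (p r : nat) (V W : 'M[R]_(p, r)).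
Hypotheses (VV : V^T *m V = 1%:M) (WW : W^T *m W = 1%:M).

Let Q := 1%:M - W *m W^T.

Lemma compl_proj_tr : Q^T = Q.
Proof. by rewrite /Q linearB/= trmx1 trmx_mul trmxK. Qed.

Lemma compl_proj_idem : Q *m Q = Q.
Proof.
rewrite {2}/Q mulmxBr mulmx1 /Q mulmxBl mul1mx mulmxA -[W *m _ *m W]mulmxA WW mulmx1.
by rewrite subrr subr0.
Qed.

(** Both sides equal [2 * (r - frob2 (W^T *m V))]. *)
Lemma frob2_projB : frob2 (W *m W^T - V *m V^T) = 2 * frob2 (Q *m V).
Proof.
have -> : frob2 (Q *m V) = r%:R - frob2 (W^T *m V).
  rewrite -fdotAA fdot_tr trmx_mul compl_proj_tr -mulmxA [Q *m (Q *m _)]mulmxA compl_proj_idem.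
  rewrite /Q mulmxBl mul1mx mulmxBr VV linearB/= mxtrace1; congr (_ - _).
  by rewrite -fdotAA fdot_tr trmx_mul trmxK !mulmxA.
have PP (X : 'M[R]_(p, r)) : X^T *m X = 1%:M -> frob2 (X *m X^T) = r%:R.
  by move=> XX; rewrite frob2_isometry// frob2_trmx frob2_orthonormal.
rewrite frob2D frob2N fdotNr !PP//.
have -> : fdot (W *m W^T) (V *m V^T) = frob2 (W^T *m V).
  by rewrite -fdotAA !fdot_tr !trmx_mul !trmxK [RHS]mxtrace_mulC -!mulmxA [LHS]mxtrace_mulC !mulmxA.
by ring.
Qed.

Lemma frob2_compl_proj : frob2 Q = p%:R - r%:R.
Proof.
rewrite frob2_idem ?compl_proj_tr ?compl_proj_idem// /Q linearB/= mxtrace1 mxtrace_mulC WW.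
by rewrite mxtrace1.
Qed.

Lemma compl_proj_pythagoras m (M : 'M[R]_(p, m)) :
  frob2 M = frob2 (Q *m M) + frob2 (W *m (W^T *m M)).
Proof.
rewrite -{1}[M](_ : Q *m M + W *m (W^T *m M) = M).
  rewrite frob2D (_ : fdot _ _ = 0) ?mulr0 ?addr0//.
  rewrite fdot_tr trmx_mul compl_proj_tr -mulmxA [Q *m _]mulmxA /Q mulmxBl mul1mx -mulmxA WW mulmx1.
  by rewrite subrr mul0mx mulmx0 linear0.
by rewrite /Q mulmxBl mul1mx mulmxA subrK.
Qed.

Lemma frob2_compl_proj_le m (M : 'M[R]_(p, m)) : frob2 (Q *m M) <= frob2 M.
Proof. by rewrite (compl_proj_pythagoras M) lerDl frob2_ge0. Qed.

Lemma frob2_projB_le : frob2 (W *m W^T - V *m V^T) <= 2 * Num.min r%:R (p%:R - r%:R).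
Proof.
rewrite frob2_projB ler_wpM2l// le_min; apply/andP; split.
  by rewrite -(frob2_orthonormal VV) frob2_compl_proj_le.
rewrite -frob2_compl_proj -frob2_trmx trmx_mul compl_proj_tr.
exact: frob2_isometryT.
Qed.

(** The projection [Q] off the span of [W] kills [Th], so [Q *m V *m A] is minus the projection of
    the error [Th - V *m A]; the lower bound [s] on [A *m A^T] removes the factor [A]. *)
Lemma frob2_projB_span (A : 'M[R]_r) (Th : 'M[R]_(p, r)) (s : R) : 0 < s ->
  (Th^T <= W^T)%MS -> (forall y : 'cV[R]_r, s * frob2 y <= frob2 (A^T *m y)) ->
  frob2 (W *m W^T - V *m V^T) <= 2 / s * frob2 (Th - V *m A).
Proof.
move=> s0 /submxP[D TD] As; rewrite frob2_projB -mulrA ler_wpM2l// ler_pdivlMl//.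
have QTh : Q *m Th = 0.
  rewrite -[Th]trmxK TD trmx_mul trmxK mulmxA /Q mulmxBl mul1mx -mulmxA WW mulmx1.
  by rewrite subrr mul0mx.
apply: (@le_trans _ _ (frob2 (Q *m V *m A))); first exact: frob2_mulr_ge.
rewrite -mulmxA; have -> : Q *m (V *m A) = - (Q *m (Th - V *m A)).
  by rewrite mulmxBr QTh sub0r opprK.
by rewrite frob2N frob2_compl_proj_le.
Qed.
End Projections.

(** * The left singular vectors as a combination of the noise matrices *)

Lemma unitmx_of_fnorm_ge (R : realType) r (K : 'M[R]_r) (c : R) : 0 < c ->
  (forall y : 'cV[R]_r, c * fnorm y <= fnorm (K *m y)) -> K \in unitmx.
Proof.
move=> c0 Kc; rewrite -unitmx_tr unitmxE unitfE; apply/det0P => -[v v0 vK].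
have := Kc v^T; rewrite -[K]trmxK -trmx_mul vK trmx0 fnorm0.
rewrite pmulr_rle0// => v1; have : fnorm v^T = 0 by apply/le_anti; rewrite v1 fnorm_ge0.
move=> h; case/negP: v0; apply/eqP; rewrite -[v]trmxK; apply: trmx_inj; rewrite trmxK trmx0.
by apply: frob2_eq0; rewrite -sqr_fnorm h expr0n.
Qed.

Lemma fnorm_Dmat_ge (R : realType) r (lam : 'I_r -> R) (l0 : R) (y : 'cV[R]_r) :
  0 <= l0 -> (forall i, l0 <= lam i) -> Num.sqrt l0 * fnorm y <= fnorm (Dmat lam *m y).
Proof.
move=> l00 lam_ge; rewrite -ler_sqr ?nnegrE ?mulr_ge0 ?fnorm_ge0 ?sqrtr_ge0//.
rewrite exprMn !sqr_fnorm sqr_sqrtr// /frob2 mulr_sumr; apply: ler_sum => i _; rewrite !big_ord1.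
rewrite /Dmat mul_diag_mx !mxE exprMn sqr_sqrtr ?(le_trans l00)//.
by rewrite ler_wpM2r ?sqr_ge0.
Qed.

Lemma fnorm_Dmat_le (R : realType) r (lam : 'I_r -> R) (l1 : R) (y : 'cV[R]_r) :
  (forall i, 0 <= lam i <= l1) -> frob2 (Dmat lam *m y) <= l1 * frob2 y.
Proof.
move=> lam_le; rewrite /frob2 mulr_sumr; apply: ler_sum => i _; rewrite !big_ord1.
have /andP[lam0 lam1] := lam_le i.
by rewrite /Dmat mul_diag_mx !mxE exprMn sqr_sqrtr// ler_wpM2r ?sqr_ge0.
Qed.

Lemma supp_card_mulr (R : realType) p r m (A : 'M[R]_(p, r)) (B : 'M[R]_(r, m)) :
  (supp_card (A *m B) <= supp_card A)%N.
Proof.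
rewrite !supp_cardE; apply/subset_leq_card/fintype.subsetP => i; rewrite !inE.
by apply: contraNN => /eqP h; rewrite row_mul h mul0mx.
Qed.

Section SvdCoordinates.
Context {R : realType} (n p r k : nat).
Variables (V V0 : 'M[R]_(p, r)) (lam : 'I_r -> R) (lam0 cl : R).
Variables (U : 'M[R]_(n, r)) (Z0 : 'M[R]_(n, p)).
Hypotheses (n0 : (0 < n)%N) (cl0 : 0 < cl) (lam1 : 1 <= lam0) (lam_cl : 112 <= cl * Num.sqrt lam0).
Hypothesis lam_ge : forall i, lam0 <= lam i.
Hypotheses (V0V0 : V0^T *m V0 = 1%:M) (V0k : (supp_card V0 <= k)%N).
Hypothesis VV0 : sigma_r_ge (V^T *m V0) (1 / 2).
Hypothesis Ul : forall y : 'cV[R]_r, cl * Num.sqrt n%:R * fnorm y <= fnorm (U *m y).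
Hypothesis Zu : forall v : 'cV[R]_p, (supp_card v <= k)%N ->
  fnorm (Z0 *m v) <= 14 * Num.sqrt n%:R * fnorm v.

(** With [K = Dmat lam *m (V^T *m V0)], the projected data are [U *m K + Z0 *m V0]. The signal
    [U *m K] dominates because [K] is bounded below by [sqrt lam0 / 2]. Multiplying by
    [t = Q *m invmx C] gives [a1 = K *m t] and [a2 = V0 *m t], and this bounded form with sparse
    [a2] is what [chaos_bound] accepts. *)
Lemma svd_coordinates : exists L : 'M[R]_(n, r), exists C Q a1 : 'M[R]_r, exists a2 : 'M[R]_(p, r),
  let X0 := U *m Dmat lam *m V^T + Z0 in
  [/\ thin_svd (X0 *m V0) L C Q, C \in unitmx, L = X0 *m V0 *m Q *m invmx C &
  [/\ L = U *m a1 + Z0 *m a2, (supp_card a2 <= k)%N,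
      forall y : 'cV[R]_r, frob2 (a1 *m y) + frob2 (a2 *m y) <= (5 / cl) ^+ 2 / n%:R * frob2 y &
      forall z : 'cV[R]_r, cl / 2 * Num.sqrt n%:R * fnorm z <= fnorm (L^T *m (U *m z))]].
Proof.
pose s : R := Num.sqrt n%:R; pose l := Num.sqrt lam0.
have s0 : 0 < s by rewrite sqrtr_gt0 ltr0n.
have l0 : 0 < l by rewrite sqrtr_gt0 (lt_le_trans ltr01).
have l1 : 1 <= l by rewrite -sqrtr1 ler_wsqrtr.
pose K := Dmat lam *m (V^T *m V0).
have lam00 : 0 <= lam0 := le_trans ler01 lam1.
have V0n (y : 'cV[R]_r) : fnorm (V0 *m y) = fnorm y by rewrite /fnorm frob2_isometry.
have HK (y : 'cV[R]_r) : l / 2 * fnorm y <= fnorm (K *m y).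
  rewrite /K -mulmxA; apply: (le_trans _ (fnorm_Dmat_ge _ lam00 lam_ge)).
  rewrite -mulrA ler_wpM2l ?(ltW l0)//.
  by rewrite mulrC; have := sigma_r_ge_fnorm y _ VV0; rewrite mul1r mulrC; apply.
have Ku : K \in unitmx by apply: unitmx_of_fnorm_ge HK; rewrite divr_gt0.
pose X0 := U *m Dmat lam *m V^T + Z0; pose B := X0 *m V0.
have BE (y : 'cV[R]_r) : B *m y = U *m (K *m y) + Z0 *m (V0 *m y).
  by rewrite /B /X0 !mulmxDl /K !mulmxA.
have ZV (y : 'cV[R]_r) : fnorm (Z0 *m (V0 *m y)) <= 14 * s * fnorm y.
  by rewrite -[in leRHS](V0n y) Zu// (leq_trans (supp_card_mulr _ _)).
(* With the constant [112], the noise term [14 * s * fnorm y] is at most a quarter of the signal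
   bound [cl * s * fnorm (K *m y)]. *)
have y_le (y : 'cV[R]_r) : fnorm y <= cl / 56 * fnorm (K *m y).
  have h := ler_wpM2l (ltW cl0) (HK y).
  have : 112 * fnorm y <= cl * l * fnorm y by rewrite ler_wpM2r ?fnorm_ge0.
  by lra.
have HB (y : 'cV[R]_r) : cl * s / 2 * fnorm (K *m y) <= fnorm (B *m y).
  rewrite BE; have h1 := fnormB_ge (U *m (K *m y)) (Z0 *m (V0 *m y)).
  have h2 := Ul (K *m y); have h3 := ZV y.
  have h4 := ler_wpM2l (ltW s0) (y_le y).
  rewrite -/s in h2; have := mulr_ge0 (mulr_ge0 (ltW cl0) (ltW s0)) (fnorm_ge0 (K *m y)).
  by lra.
have HB' (y : 'cV[R]_r) : cl * s * l / 4 * fnorm y <= fnorm (B *m y).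
  apply: le_trans (HB y); have := ler_wpM2l (ltW (mulr_gt0 cl0 s0)) (HK y).
  by lra.
have [|L [C [Q [svd Cu]]]] := exists_thin_svd _ HB'.
  by rewrite divr_gt0// !mulr_gt0.
have [LL _ _ QQ BL] := svd.
pose t := Q *m invmx C.
have LE : L = B *m t.
  by rewrite BL /t mulmxA -[_ *m Q^T *m Q]mulmxA QQ mulmx1 mulmxK.
exists L, C, Q, (K *m t), (V0 *m t); split=> //; first by rewrite LE /t !mulmxA.
split.
- by rewrite LE /B /X0 /K !mulmxDl !mulmxA.
- exact: leq_trans (supp_card_mulr _ _) V0k.
(* In units of [fnorm y / (cl * s)], [a1 *m y] is at most [2] and [a2 *m y] at most [4], and
   [4 + 16 <= 25]. *)
- move=> y; have h : cl * s / 2 * fnorm (K *m (t *m y)) <= fnorm y.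
    by apply: le_trans (HB _) _; rewrite mulmxA -LE /fnorm frob2_isometry.
  have h' := y_le (t *m y).
  rewrite -[K *m t *m y]mulmxA -[V0 *m t *m y]mulmxA (frob2_isometry _ V0V0) -!sqr_fnorm.
  have f0 := fnorm_ge0 (K *m (t *m y)); have f1 := fnorm_ge0 (t *m y).
  rewrite -(ler_pM2l (_ : 0 < (cl * s) ^+ 2)); last by rewrite exprn_gt0// mulr_gt0.
  have -> : (cl * s) ^+ 2 * ((5 / cl) ^+ 2 / n%:R * fnorm y ^+ 2) = 25 * fnorm y ^+ 2.
    have -> : n%:R = s ^+ 2 :> R by rewrite sqr_sqrtr.
    by field; rewrite !gt_eqF.
  have i1 : (cl * s * fnorm (K *m (t *m y))) ^+ 2 <= (2 * fnorm y) ^+ 2.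
    have c0 := ltW (mulr_gt0 cl0 s0).
    by rewrite lerXn2r ?nnegrE//; [exact: mulr_ge0|apply: mulr_ge0 => //; exact: fnorm_ge0|lra].
  have i2 : (cl * s * fnorm (t *m y)) ^+ 2 <= (4 * fnorm y) ^+ 2.
    have c0 := ltW (mulr_gt0 cl0 s0).
    have g : cl * s * l / 4 * fnorm (t *m y) <= fnorm y.
      by apply: le_trans (HB' _) _; rewrite mulmxA -LE /fnorm frob2_isometry.
    have g' := ler_wpM2l (mulr_ge0 c0 f1) l1.
    by rewrite lerXn2r ?nnegrE//; [exact: mulr_ge0|apply: mulr_ge0 => //; exact: fnorm_ge0|lra].
  move: i1 i2 (sqr_ge0 (fnorm y)); rewrite mulrDr !exprMn; lra.
(* On the range of [B], [L^T] is an isometry. Passing between [U *m z] and [B *m w] costs the noise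
   term twice, that is, half of [cl * s * fnorm z]. *)
- move=> z; pose w := invmx K *m z.
  have Kw : K *m w = z by rewrite mulKVmx.
  have h1 : fnorm (L^T *m (B *m w)) = fnorm (B *m w).
    by rewrite BL -!mulmxA [L^T *m (L *m _)]mulmxA LL mul1mx /fnorm (frob2_isometry _ LL).
  have h2 : L^T *m (U *m z) = L^T *m (B *m w) + - (L^T *m (Z0 *m (V0 *m w))).
    by rewrite BE Kw mulmxDr addrK.
  have h3 := fnormB_ge (L^T *m (B *m w)) (- (L^T *m (Z0 *m (V0 *m w)))).
  rewrite -h2 h1 fnormN in h3.
  have h4 : fnorm (L^T *m (Z0 *m (V0 *m w))) <= fnorm (Z0 *m (V0 *m w)).
    by rewrite ler_wsqrtr// frob2_isometryT.
  have h5 := ZV w.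
  have h6 := fnormB_ge (U *m z) (Z0 *m (V0 *m w)).
  have h7 : fnorm (U *m z + Z0 *m (V0 *m w)) = fnorm (B *m w) by rewrite BE Kw.
  have h8 := Ul z; have h9 := ler_wpM2l (ltW s0) (y_le w); rewrite Kw in h9.
  rewrite -/s in h8; rewrite -/s; lra.
Qed.
End SvdCoordinates.

(** * Oracle inequality for the penalized least squares estimator *)

Lemma penE (R : realType) r (beta delta : R) p k :
  pen r beta delta p k = (1 + delta) ^+ 2 * pensum r p beta k.
Proof. by []. Qed.

Lemma supp_card_rowres (R : realType) p r (S : {set 'I_p}) (A : 'M[R]_(p, r)) :
  (supp_card (rowres S A) <= #|S|)%N.
Proof.
rewrite supp_cardE; apply/subset_leq_card/fintype.subsetP => i; rewrite inE.
by apply: contraR => iS; apply/eqP/rowP => j; rewrite !mxE (negbTE iS).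
Qed.

Lemma rowres_id (R : realType) p r (S : {set 'I_p}) (A : 'M[R]_(p, r)) :
  suppmx A \subset S -> rowres S A = A.
Proof.
move=> AS; apply/matrixP => i j; rewrite mxE; case: ifPn => // iS.
have := contraNN (fintype.subsetP AS i) iS; rewrite inE negbK => /eqP/rowP/(_ j).
by rewrite !mxE.
Qed.

Lemma fdot_rowres (R : realType) p r (S : {set 'I_p}) (A B : 'M[R]_(p, r)) :
  fdot (rowres S A) B = fdot A (rowres S B).
Proof.
apply: eq_bigr => i _; apply: eq_bigr => j _; rewrite !mxE.
by case: ifP => _; rewrite ?mul0r ?mulr0.
Qed.

Lemma rowres_mulr (R : realType) p r m (S : {set 'I_p}) (A : 'M[R]_(p, r)) (B : 'M[R]_(r, m)) :
  rowres S (A *m B) = rowres S A *m B.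
Proof.
apply/matrixP => i j; rewrite !mxE; case: ifP => iS.
  by apply: eq_bigr => l _; rewrite mxE iS.
by rewrite big1// => l _; rewrite mxE iS mul0r.
Qed.

Lemma rowresC (R : realType) p r (S : {set 'I_p}) (A : 'M[R]_(p, r)) :
  rowres S A - A = - rowres (~: S)%SET A.
Proof.
apply/matrixP => i j; rewrite !mxE inE; case: (i \in S) => /=; first by rewrite subrr oppr0.
by rewrite sub0r.
Qed.

Lemma oracle_arith (R : realType) (delta X2 b2 D E2 ED T TS Tk G : R) :
  0 < delta < 1 -> 0 <= X2 -> 0 <= b2 ->
  X2 <= b2 + 2 * ED + (1 + delta) ^+ 2 * Tk - (1 + delta) ^+ 2 * TS ->
  2 * ED <= (1 + delta)^-1 * D + (1 + delta)^-1^-1 * E2 ->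
  E2 <= (1 + delta) * T + G -> T <= TS + Tk ->
  D <= (1 + delta / 2) * X2 + (1 + (delta / 2)^-1) * b2 ->
  delta / 4 * X2 <= (2 + 2 / delta) * b2 + 2 * (1 + delta) ^+ 2 * Tk + (1 + delta) * G.
Proof.
move=> /andP[d0 d1] X0 b0 h1 h2 h3 h4 h5; rewrite invrK in h2.
pose a := (1 + delta)^-1; have a0 : 0 <= a by rewrite invr_ge0; lra.
have a1 : a <= 1 by rewrite invf_le1//; lra.
have ad : a * (1 + delta / 2) <= 1 - delta / 4.
  by rewrite ler_pdivrMl; [nra|lra].
have i0 : 0 <= (delta / 2)^-1 by rewrite invr_ge0; lra.
have k1 := ler_wpM2l a0 h5.
have k2 := ler_wpM2r X0 ad.
have k3 : a * ((1 + (delta / 2)^-1) * b2) <= (1 + (delta / 2)^-1) * b2.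
  by rewrite ler_piMl// mulr_ge0// addr_ge0.
have k4 : (1 + delta) * E2 <= (1 + delta) * ((1 + delta) * T + G) by rewrite ler_wpM2l//; lra.
have k5 : (1 + delta) ^+ 2 * T <= (1 + delta) ^+ 2 * (TS + Tk) by rewrite ler_wpM2l ?sqr_ge0.
have e : (delta / 2)^-1 = 2 / delta by field; rewrite gt_eqF.
rewrite e in k1 k3; rewrite -/a in h2; set u := 2 / delta in k1 k3 *.
lra.
Qed.

(** Comparing [Th] with the truncation of [Th0] to [S] leaves the cross term [2 <E, Th - Th'>]. It
    is split as [(1 + delta)^-1 |Th - Th'|^2 + (1 + delta) |E_J|^2]. The noise part is at most the
    penalty of [J], hence by subadditivity that of [supp Th] plus that of [S], and the former
    cancels exactly. Since [(1 + delta)^-1 (1 + delta / 2) <= 1 - delta / 4], a share [delta / 4] of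
    the error remains on the left. *)
Lemma oracle_inequality (R : realType) p r (beta delta G : R) (Th0 E Th : 'M[R]_(p, r)) (S : {set 'I_p}) :
  0 < beta -> 0 < delta < 1 -> 0 <= G ->
  is_pen_minimizer beta delta (Th0 + E) Th ->
  (forall J, frob2 (rowres J E) <= (1 + delta) * pensum r p beta #|J| + G) ->
  delta / 4 * frob2 (Th - Th0) <= (2 + 2 / delta) * frob2 (rowres (~: S)%SET Th0) +
    2 * (1 + delta) ^+ 2 * pensum r p beta #|S| + (1 + delta) * G.
Proof.
move=> beta0 d01 G0 min noise; have [d0 d1] := andP d01.
pose Th' := rowres S Th0; pose J := (suppmx Th :|: S)%SET.
have cardp (A : {set 'I_p}) : (#|A| <= p)%N by rewrite -[leqRHS]card_ord max_card.
have b2E : frob2 (Th' - Th0) = frob2 (rowres (~: S)%SET Th0) by rewrite rowresC frob2N.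
have TJ : pensum r p beta #|J| <= pensum r p beta (supp_card Th) + pensum r p beta #|S|.
  have JE : #|J| = (supp_card Th + #|(S :\: suppmx Th)%SET|)%N.
    have e1 : (J :&: suppmx Th)%SET = suppmx Th.
      by apply/finset.setP => i; rewrite !inE; case: (row i Th != 0); rewrite ?andbF.
    have e2 : (J :\: suppmx Th)%SET = (S :\: suppmx Th)%SET.
      by apply/finset.setP => i; rewrite !inE; case: (row i Th != 0).
    by rewrite supp_cardE -(cardsID (suppmx Th) J) e1 e2.
  rewrite JE; apply: le_trans (pensum_subadd _ _ _) _ => //; first by rewrite -JE.
  by rewrite lerD2l; apply: pensum_homo => //; rewrite cardp andbT subset_leq_card// finset.subsetDl.
apply: (@oracle_arith _ delta (frob2 (Th - Th0)) _ (frob2 (Th - Th')) (frob2 (rowres J E))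
  (fdot E (Th - Th')) (pensum r p beta #|J|) (pensum r p beta (supp_card Th))) => //.
- exact: frob2_ge0.
- exact: frob2_ge0.
- have := min Th'; rewrite /pen_crit !penE.
  have -> : Th0 + E - Th = E - (Th - Th0) by rewrite opprB addrA [E + _]addrC.
  have -> : Th0 + E - Th' = E - (Th' - Th0) by rewrite opprB addrA [E + _]addrC.
  rewrite !(frob2D E) !frob2N !fdotNr b2E.
  have : pensum r p beta (supp_card Th') <= pensum r p beta #|S|.
    by apply: pensum_homo; rewrite // supp_card_rowres cardp.
  have -> : Th - Th' = (Th - Th0) - (Th' - Th0) by rewrite opprB addrA subrK.
  rewrite [fdot E (_ - _ - _)]fdotDr fdotNr !(fdotDr _ _ E) !fdotNr => h.
  have := ler_wpM2l (sqr_ge0 (1 + delta)) h; lra.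
(* The difference lives on the rows of [J], so only the noise on [J] enters. *)
- have {1}-> : Th - Th' = rowres J (Th - Th').
    rewrite rowres_id//; apply/fintype.subsetP => i; rewrite !inE; apply: contraR.
    rewrite negb_or negbK => /andP[/eqP i1 i2]; apply/eqP/rowP => j; rewrite !mxE (negbTE i2) subr0.
    by have /rowP/(_ j) := i1; rewrite !mxE.
  rewrite -fdot_rowres fdotC.
  by apply: fdot_AMGM; rewrite invr_gt0; lra.
- have -> : Th - Th' = (Th - Th0) + - (Th' - Th0) by rewrite opprB addrA subrK.
  by rewrite -b2E -(frob2N (Th' - Th0)); apply: frob2D_le; rewrite divr_gt0.
Qed.

(** * Tails of the weak ball and the critical sparsity *)

Lemma powR_sub_ge (R : realType) (a : R) (j : nat) : 0 < a -> (0 < j)%N ->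
  a * powR j.+1%:R (- (a + 1)) <= powR j%:R (- a) - powR j.+1%:R (- a).
Proof.
move=> a0 j0; have j1 : 0 < j.+1%:R :> R by rewrite ltr0n.
have jR : 0 < j%:R :> R by rewrite ltr0n.
pose u : R := j.+1%:R^-1.
have ju : j%:R = j.+1%:R * (1 - u) :> R.
  by rewrite mulrBr mulr1 divff ?gt_eqF// -natr1 addrK.
have u1 : 0 < 1 - u by rewrite -(pmulr_rgt0 _ j1) -ju.
rewrite [X in powR X (- a)]ju powRM ?(ltW j1) ?(ltW u1)//.
have -> : powR j.+1%:R (- (a + 1)) = powR j.+1%:R (- a) * u.
  by rewrite opprD powRD; [rewrite powR_inv1// ltW|apply/implyP => _; rewrite gt_eqF].
have h : 1 + a * u <= powR (1 - u) (- a).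
  rewrite /powR gt_eqF//; apply: le_trans (expR_ge1Dx _).
  rewrite lerD2l mulNr -mulrN ler_wpM2l ?(ltW a0)// lerNr.
  by apply: le_trans (le_ln1Dx _) _; rewrite // -subr_gt0 opprK addrC.
have := ler_wpM2l (powR_ge0 j.+1%:R (- a)) h.
lra.
Qed.

(** Each term is at most the increment of [- j^(1 - g) / (g - 1)], and the increments telescope. *)
Lemma sum_powR_tail (R : realType) (g : R) (k p : nat) : 1 < g -> (0 < k <= p)%N ->
  \sum_(k <= j < p) powR j.+1%:R (- g) <= powR k%:R (1 - g) / (g - 1).
Proof.
move=> g1 /andP[k0 kp]; have a0 : 0 < g - 1 by rewrite subr_gt0.
rewrite ler_pdivlMr// mulrC mulr_sumr.
apply: (@le_trans _ _ (\sum_(k <= j < p) (- powR j.+1%:R (1 - g) - - powR j%:R (1 - g)))).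
  rewrite big_nat [leRHS]big_nat; apply: ler_sum => j /andP[kj _].
  have := @powR_sub_ge R (g - 1) j a0 (leq_trans k0 kj).
  by rewrite subrK !opprB => h; rewrite opprK [leRHS]addrC.
by rewrite (telescope_sumr (fun j => - powR j%:R (1 - g)))// opprK gerDr oppr_le0 powR_ge0.
Qed.

Lemma exists_largest (R : realType) p (f : 'I_p -> R) (k : nat) : (k <= p)%N ->
  exists2 S : {set 'I_p}, #|S| = k &
  \sum_(i in (~: S)%SET) f i ^+ 2 =
  \sum_(k <= j < p) (nth 0 (sort (fun a b : R => b <= a) [seq f i | i <- enum 'I_p]) j) ^+ 2.
Proof.
move=> kp; pose es := sort (relpre f (fun a b : R => b <= a)) (enum 'I_p).
have pes : perm_eq es (enum 'I_p) by rewrite perm_sort.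
have ues : uniq es by rewrite (perm_uniq pes) enum_uniq.
have ses : size es = p by rewrite (perm_size pes) size_enum_ord.
exists [set i in take k es]%SET.
  by rewrite cardsE (card_uniqP _) ?take_uniq// size_takel// ses.
rewrite sort_map -/es.
have -> : \sum_(i in (~: [set i in take k es])%SET) f i ^+ 2 = \sum_(i <- drop k es) f i ^+ 2.
  transitivity (\sum_(i <- es | i \in (~: [set i in take k es])%SET) f i ^+ 2).
    by rewrite (perm_big _ pes)/= big_enum_cond.
  rewrite big_mkcond/= -{1}(cat_take_drop k es) big_cat/= big1_seq ?add0r; last first.
    by move=> i /andP[_ ik]; rewrite !inE ik.
  rewrite big_seq [RHS]big_seq; apply: eq_bigr => i ik; rewrite !inE.
  case: ifPn => //; rewrite negbK => ik'.
  move: ues; rewrite -(cat_take_drop k es) cat_uniq => /and3P[_ /hasPn/(_ _ ik)].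
  by rewrite /= ik'.
case: p f kp es pes ues ses => [|p] f kp es pes ues ses.
  by rewrite big_geq// drop_oversize ?big_nil// ses.
rewrite (big_nth ord0) size_drop ses -[in RHS](add0n k) big_addn.
rewrite big_nat [RHS]big_nat; apply: eq_bigr => j /andP[_ jp].
by rewrite nth_drop (nth_map ord0) ?ses 1?addnC// -ltn_subRL.
Qed.

Section CriticalRadius.
Variables (R : realType) (q s N : R) (p r : nat).
Hypotheses (q0 : 0 <= q) (q2 : q < 2) (s0 : 0 < s) (N0 : 0 < N) (p0 : (0 < p)%N).

Let rho (x : R) := r%:R + ln (expR 1 * p%:R / x).
Let E := [set x : R | 0 <= x <= p%:R /\ (x = 0 \/ x <= s * powR (N / rho x) (q / 2))].

Let pR : 0 < p%:R :> R. Proof. by rewrite ltr0n. Qed.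

Lemma rho_ge1 x : 0 < x <= p%:R -> 1 <= rho x.
Proof.
move=> /andP[x0 xp]; rewrite /rho -mulrA lnM ?posrE ?expR_gt0 ?divr_gt0// expRK.
have : 0 <= ln (p%:R / x) by rewrite ln_ge0// ler_pdivlMr// mul1r.
have : 0 <= r%:R :> R by [].
lra.
Qed.

Lemma radius_sup : has_sup E.
Proof.
split; first by exists 0; split; [rewrite lexx ltW|left].
by exists p%:R => x [/andP[]].
Qed.

(** Ensures that the critical sparsity is at least [1]. The witness is a small [y ^+ 2]: the
    logarithm in [rho (y ^+ 2)] is at most of order [1 / y], so [s * N / rho (y ^+ 2)] still exceeds
    [y ^+ 2]; when the ratio is at most [1], the power [q / 2 <= 1] can only increase it. *)
Lemma radius_gt0 : 0 < sup E.
Proof.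
pose K : R := r%:R + 2 * Num.sqrt (expR 1 * p%:R).
have ep0 : 0 < expR 1 * p%:R :> R by rewrite mulr_gt0 ?expR_gt0.
have K0 : 0 < K by rewrite ltr_wpDl// mulr_gt0// sqrtr_gt0.
pose y := Num.min 1 (Num.min s (s * N / K)).
have y0 : 0 < y by rewrite !lt_min ltr01 s0 divr_gt0// mulr_gt0.
have y1 : y <= 1 by rewrite ge_min lexx.
have ys : y <= s by rewrite /y !ge_min lexx orbT.
have yK : y * K <= s * N by rewrite -ler_pdivlMr// /y !ge_min lexx !orbT.
apply: (@lt_le_trans _ _ (y ^+ 2)); first by rewrite exprn_gt0.
apply: ub_le_sup; first exact: radius_sup.2.
have y20 : 0 < y ^+ 2 by rewrite exprn_gt0.
have y21 : y ^+ 2 <= y by rewrite expr2 ler_piMr// ltW.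
have p1 : 1 <= p%:R :> R by rewrite ler1n.
have yp : 0 < y ^+ 2 <= p%:R by rewrite y20/=; lra.
split; first by rewrite (ltW y20)/=; lra.
right; have rho1 := rho_ge1 yp.
have rho0 : 0 < rho (y ^+ 2) by lra.
set t := N / _; have t0 : 0 < t by rewrite divr_gt0.
have [t1|t1] := lerP t 1; last first.
  apply: (@le_trans _ _ s); first lra.
  have e1 : powR 1 (q / 2) = 1 :> R by rewrite powR1.
  rewrite ler_peMr ?(ltW s0)// -[leLHS]e1.
  by apply: ge0_ler_powR; rewrite ?nnegrE//; [exact: divr_ge0|exact: ltW|exact: ltW].
apply: (@le_trans _ _ (s * t)); last first.
  by apply: ler_wpM2l; [exact: ltW|apply: ger1_powR; [rewrite t0|by rewrite ler_pdivrMr// mul1r ltW]].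
rewrite /t mulrA ler_pdivlMr//; apply: le_trans yK; rewrite expr2 -mulrA ler_wpM2l ?(ltW y0)//.
have : ln (expR 1 * p%:R / y ^+ 2) <= 2 * (Num.sqrt (expR 1 * p%:R) / y).
  have -> : expR 1 * p%:R / y ^+ 2 = (Num.sqrt (expR 1 * p%:R) / y) ^+ 2.
    by rewrite expr_div_n sqr_sqrtr// ltW.
  set z := Num.sqrt _ / y; have z0 : 0 < z by rewrite divr_gt0 ?sqrtr_gt0.
  rewrite lnXn// mulr2n; suff : ln z <= z by lra.
  apply: le_trans (_ : ln (1 + z) <= _); first by rewrite ler_ln ?posrE ?addr_gt0// lerDr.
  by apply: le_ln1Dx; lra.
move=> /(ler_wpM2l (ltW y0)); rewrite [leRHS](_ : _ = 2 * Num.sqrt (expR 1 * p%:R)); last first.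
  by field; rewrite gt_eqF.
have : y * r%:R <= r%:R by rewrite ler_piMl.
by rewrite /rho /K mulrDr; lra.
Qed.

Let k := `|Num.ceil (sup E)|%N.

(** If the last inequality failed at [k < p], then [x], the minimum of [p] and its left side, would
    exceed [k]. As [rho] decreases, [x] would satisfy the defining inequality of [E], against
    [sup E <= k]. *)
Lemma ceil_radius : [/\ (0 < k <= p)%N, sup E <= k%:R &
  (k < p)%N -> s * powR (N / rho k%:R) (q / 2) <= k%:R].
Proof.
have S0 := radius_gt0; have [_ Eub] := radius_sup.
have Sp : sup E <= p%:R by apply: ge_sup; [exact: radius_sup.1|move=> x [/andP[]]].
have c0 : 0 <= Num.ceil (sup E) by rewrite ceil_ge0; lra.
have kE : k%:R = (Num.ceil (sup E))%:~R :> R by rewrite /k -[in RHS](gez0_abs c0).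
have Sk : sup E <= k%:R by rewrite kE ceil_ge.
have k0 : (0 < k)%N by rewrite -(ltr_nat R) (lt_le_trans S0).
have kp : (k <= p)%N.
  by rewrite -lez_nat /k gez0_abs// ceil_le_int.
split=> //; first by rewrite k0.
move=> {}kp; rewrite leNgt; apply/negP => h.
have kpR : k%:R < p%:R :> R by rewrite ltr_nat.
have k0R : 0 < k%:R :> R by rewrite ltr0n.
pose x := Num.min p%:R (s * powR (N / rho k%:R) (q / 2)).
have kx : k%:R < x by rewrite lt_min kpR.
have xp : x <= p%:R by rewrite ge_min lexx.
have x0 : 0 < x by lra.
suff : x <= sup E by lra.
apply: ub_le_sup => //; split; first by rewrite xp ltW.
right; apply: (@le_trans _ _ (s * powR (N / rho k%:R) (q / 2))).
  by rewrite ge_min lexx orbT.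
have rx := @rho_ge1 x (ltac:(by rewrite x0)).
have rk := @rho_ge1 k%:R (ltac:(by rewrite k0R ltW)).
rewrite ler_wpM2l ?(ltW s0)//; apply: ge0_ler_powR.
- by rewrite divr_ge0.
- by rewrite nnegrE divr_ge0 ?(ltW N0)//; lra.
- by rewrite nnegrE divr_ge0 ?(ltW N0)//; lra.
rewrite ler_wpM2l ?(ltW N0)// lef_pV2 ?posrE; try lra.
rewrite lerD2l ler_ln ?posrE ?divr_gt0 ?mulr_gt0 ?expR_gt0//.
by rewrite ler_wpM2l ?mulr_ge0 ?expR_ge0// lef_pV2 ?posrE// ltW.
Qed.

End CriticalRadius.

Lemma sqr_le_powR (R : realType) (q v b : R) : 0 < q -> 0 <= v -> powR v q <= b ->
  v ^+ 2 <= powR b (2 / q).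
Proof.
move=> q0 v0 vb; have -> : v ^+ 2 = powR (powR v q) (2 / q).
  by rewrite -powRrM -powR_mulrn//; congr powR; field; rewrite gt_eqF.
apply: ge0_ler_powR => //; rewrite ?nnegrE ?powR_ge0//.
  by rewrite divr_ge0// ltW.
exact: le_trans (powR_ge0 _ _) vb.
Qed.

Lemma sorted_rownorms_ge0 (R : realType) p r (V : 'M[R]_(p, r)) j :
  0 <= nth 0 (sorted_rownorms V) j.
Proof.
have [jl|jl] := ltnP j (size (sorted_rownorms V)); last by rewrite nth_default.
have : all (fun x : R => 0 <= x) (sorted_rownorms V).
  rewrite all_sort; apply/allP => _ /mapP[i _ ->]; exact: sqrtr_ge0.
by move=> /allP/(_ _ (mem_nth 0 jl)).
Qed.

Lemma frob2_rownorm (R : realType) p r (S : {set 'I_p}) (V : 'M[R]_(p, r)) :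
  frob2 (rowres S V) = \sum_(i in S) rownorm V i ^+ 2.
Proof.
rewrite frob2_rowres; apply: eq_bigr => i _; rewrite sqr_sqrtr//.
by apply: sumr_ge0 => j _; exact: sqr_ge0.
Qed.

Lemma weak_lq_powR (R : realType) (q s : R) p r (V : 'M[R]_(p, r)) (j : nat) :
  0 < q -> weak_lq q V <= s -> (j < p)%N ->
  powR (nth 0 (sorted_rownorms V) j) q <= s / j.+1%:R.
Proof.
move=> q0 Vs jp; rewrite ler_pdivlMr ?ltr0n// mulrC; apply: le_trans Vs.
rewrite /weak_lq gt_eqF//.
exact: (le_bigmax_cond _ (j := Ordinal jp) (fun j : 'I_p => j.+1%:R * powR (nth 0 (sorted_rownorms V) j) q)).
Qed.

(** For [q > 0] the [j]-th largest squared row norm is at most [(s / j)^(2/q)], so the tail beyond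
    [k] is of order [k (s / k)^(2/q)], and the choice of [k] bounds [(s / k)^(2/q)] by
    [(r + log(ep/k)) / (n h)]. For [q = 0] nothing remains beyond [k]. *)
Lemma weak_lq_tail (R : realType) (q : R) : 0 <= q < 2 -> exists2 Cq : R, 0 < Cq &
  forall (n p r : nat) (s lam0 : R) (V : 'M[R]_(p, r)), (0 < r <= p)%N ->
  V^T *m V = 1%:M -> weak_lq q V <= s -> 0 < n%:R * hfun lam0 ->
  let k := kstar q s p r n lam0 in
  (0 < k <= p)%N /\ exists2 S : {set 'I_p}, #|S| = k &
  frob2 (rowres (~: S)%SET V) <= Cq * (k%:R * (r%:R + logep R p k) / (n%:R * hfun lam0)).
Proof.
move=> /andP[q0 q2].
have [Cq Cq0 CqE] : exists2 Cq : R, 0 < Cq & q != 0 -> Cq = (2 / q - 1)^-1.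
  have [->|qn0] := eqVneq q 0; first by exists 1.
  have qp : 0 < q by rewrite lt_neqAle eq_sym qn0.
  by exists (2 / q - 1)^-1 => //; rewrite invr_gt0 subr_gt0 ltr_pdivlMr// mul1r.
exists Cq => // n p r s lam0 V /andP[r0 rp] VV Vs N0 k.
set N := n%:R * hfun lam0 in N0 *.
have p0 : (0 < p)%N by exact: leq_trans rp.
have VF : 0 < frob2 V by rewrite frob2_orthonormal// ltr0n.
have Vtail j (S : {set 'I_p}) : (j <= p)%N -> 0 < q ->
    frob2 (rowres (~: S)%SET V) = \sum_(j <= i < p) (nth 0 (sorted_rownorms V) i) ^+ 2 ->
    frob2 (rowres (~: S)%SET V) <= \sum_(j <= i < p) powR (s / i.+1%:R) (2 / q).
  move=> jp qp ->; rewrite big_nat [leRHS]big_nat; apply: ler_sum => i /andP[_ ip].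
  by apply: sqr_le_powR => //; [exact: sorted_rownorms_ge0|exact: weak_lq_powR].
(* A nonpositive radius would force [V = 0], against its orthonormal columns. *)
have s0 : 0 < s.
  rewrite ltNge; apply/negP => s0.
  have [q00|qn0] := eqVneq q 0.
    move: Vs; rewrite /weak_lq q00 eqxx supp_cardE => Vs.
    have : #|suppmx V| = 0%N by apply/eqP; rewrite -leqn0 -(ler_nat R) (le_trans Vs).
    move=> /eqP; rewrite cards_eq0 => /eqP h.
    have : rowres (suppmx V) V = V by rewrite rowres_id.
    move=> VE; move: VF; rewrite -VE frob2_rowres h big1 ?ltxx// => i; by rewrite inE.
  have qp : 0 < q by rewrite lt_neqAle eq_sym qn0.
  have [S S0 SE] := exists_largest (rownorm V) (leq0n p).
  have {}SE := etrans (frob2_rownorm (~: S)%SET V) SE.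
  have SV : rowres (~: S)%SET V = V.
    apply/matrixP => i j; rewrite mxE inE; case: ifPn => //; rewrite negbK => iS.
    by move: S0 => /eqP; rewrite cards_eq0 => /eqP S0; rewrite S0 inE in iS.
  move: SE; rewrite SV => SE.
  have : frob2 V = 0.
    rewrite SE big_nat big1// => i /andP[_ ip].
    have := weak_lq_powR qp Vs ip; rewrite -/(sorted_rownorms V) => h.
    have : powR (nth 0 (sorted_rownorms V) i) q = 0.
      by apply/le_anti; rewrite powR_ge0 (le_trans h)// mulr_le0_ge0// invr_ge0.
    by move=> /eqP; rewrite powR_eq0 => /andP[/eqP -> _]; rewrite expr0n.
  by move=> h; rewrite h ltxx in VF.
have [k01 kS] : (0 < k <= p)%N /\
    ((k < p)%N -> s * powR (N / (r%:R + logep R p k)) (q / 2) <= k%:R).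
  by have [kp _ kS] := @ceil_radius R q s N p r q0 q2 s0 N0 p0; split; [exact: kp|exact: kS].
have [k0 kp] := andP k01.
split=> //.
have l1 : 1 <= logep R p k by exact: logep_ge1.
have rl0 : 0 < r%:R + logep R p k by rewrite ltr_wpDl// (lt_le_trans ltr01).
have rhs0 : 0 <= Cq * (k%:R * (r%:R + logep R p k) / N).
  by rewrite mulr_ge0 ?(ltW Cq0)// divr_ge0 ?(ltW N0)// mulr_ge0// ltW.
have [S Sk SE] := exists_largest (rownorm V) kp.
have {}SE := etrans (frob2_rownorm (~: S)%SET V) SE.
have [kp'|] := ltnP k p; last first.
  move=> pk; exists S => //; rewrite (le_trans _ rhs0)// SE big_geq//.
have {}kS := kS kp'.
(* For [q = 0] the power is [1], so [s <= k] and all nonzero rows fit into a set of size [k]. *)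
have [q00|qn0] := eqVneq q 0.
  move: Vs; rewrite /weak_lq q00 eqxx supp_cardE => Vs.
  have : (#|suppmx V| <= k)%N.
    rewrite -(ler_nat R) (le_trans Vs)//; move: kS; rewrite q00 mul0r powRr0 mulr1//.
  move=> Vk; have [|S' VS' S'k] := @exists_superset_card _ (suppmx V) k.
    by rewrite Vk card_ord.
  exists S' => //; apply: le_trans rhs0; apply: eq_ler.
  have := rowres_id VS' => e; have := rowresC S' V; rewrite e subrr => h.
  by rewrite -[LHS]frob2N -h frob2_0.
have qp : 0 < q by rewrite lt_neqAle eq_sym qn0.
exists S => //; apply: (le_trans (Vtail _ S kp qp SE)).
pose g := 2 / q; have g1 : 1 < g by rewrite ltr_pdivlMr// mul1r.
have -> : \sum_(k <= i < p) powR (s / i.+1%:R) (2 / q) =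
    powR s g * \sum_(k <= i < p) powR i.+1%:R (- g).
  rewrite mulr_sumr; apply: eq_bigr => i _; rewrite powRM ?(ltW s0) ?invr_ge0//.
  by congr (_ * _); rewrite -powR_inv1// -powRrM mulN1r.
have kR : 0 < k%:R :> R by rewrite ltr0n.
apply: le_trans (ler_wpM2l (powR_ge0 _ _) (sum_powR_tail g1 k01)) _.
rewrite CqE// -/g [leLHS]mulrA [leLHS]mulrC; apply: ler_wpM2l.
  by rewrite invr_ge0 subr_ge0 ltW.
set t := N / (r%:R + logep R p k).
have t0 : 0 < t by rewrite divr_gt0.
have -> : k%:R * (r%:R + logep R p k) / N = k%:R * t^-1 by rewrite /t invf_div mulrA.
(* The defining inequality of the critical sparsity, raised to the power [2 / q]. *)
have kq : powR (s / k%:R) g <= t^-1.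
  have : s / k%:R <= powR t^-1 (q / 2).
    rewrite ler_pdivrMr// -powR_inv1 ?(ltW t0)// -powRrM mulN1r powRN.
    by rewrite ler_pdivlMl ?powR_gt0// mulrC.
  have g0 : 0 <= g by lra.
  have sk0 : 0 <= s / k%:R by rewrite divr_ge0// ltW.
  move=> h; have := @ge0_ler_powR R g g0 (s / k%:R) (powR t^-1 (q / 2)).
  rewrite !nnegrE sk0 powR_ge0 => /(_ isT isT h); rewrite -powRrM.
  have -> : q / 2 * g = 1 by rewrite /g; field; rewrite gt_eqF.
  by rewrite powRr1// invr_ge0 ltW.
apply: le_trans (ler_wpM2l (ltW kR) kq); apply: eq_ler.
rewrite powRM ?invr_ge0 ?(ltW s0)// mulrCA; congr (_ * _).
rewrite powRD; last by apply/implyP => _; rewrite gt_eqF.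
by rewrite powRr1// -powR_inv1// -powRrM mulN1r.
Qed.

(** * Loss on the good event, then in expectation *)

Lemma reduction_loss (R : realType) (n p r k : nat) (beta delta kappa cl lam0 G : R)
    (V V0 Vh : 'M[R]_(p, r)) (lam : 'I_r -> R) (U : 'M[R]_(n, r)) (Z Zt : 'M[R]_(n, p))
    (S : {set 'I_p}) :
  (0 < n)%N -> 0 < beta -> 0 < delta < 1 -> 0 < cl -> 1 <= lam0 ->
  112 <= cl * Num.sqrt lam0 -> (forall i, lam0 <= lam i <= kappa * lam0) ->
  V^T *m V = 1%:M -> V0^T *m V0 = 1%:M -> (supp_card V0 <= k)%N ->
  sigma_r_ge (V^T *m V0) (1 / 2) -> 0 <= G ->
  (forall y : 'cV[R]_r, fnorm (U *m y) <= 7 * Num.sqrt n%:R * fnorm y) ->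
  (forall y : 'cV[R]_r, cl * Num.sqrt n%:R * fnorm y <= fnorm (U *m y)) ->
  (forall v : 'cV[R]_p, (supp_card v <= k)%N ->
     fnorm ((Z + Zt) *m v) <= 14 * Num.sqrt n%:R * fnorm v) ->
  (forall (a1 : 'M[R]_r) (a2 : 'M[R]_(p, r)) (J : {set 'I_p}), (supp_card a2 <= k)%N ->
     (forall y : 'cV[R]_r, frob2 (a1 *m y) + frob2 (a2 *m y) <= (5 / cl) ^+ 2 / n%:R * frob2 y) ->
     let L := U *m a1 + (Z + Zt) *m a2 in L^T *m L = 1%:M ->
     frob2 (rowres J ((Z - Zt)^T *m L)) / 2 <= (1 + delta) * pensum r p beta #|J| + G) ->
  reduction_output beta delta (Xdata V lam U Z + Zt) (Xdata V lam U Z - Zt) V0 Vh ->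
  frob2 (Vh *m Vh^T - V *m V^T) <= 16 / (cl ^+ 2 * n%:R * lam0) * (4 / delta *
    ((2 + 2 / delta) * (49 / 2 * n%:R * (kappa * lam0) * frob2 (rowres (~: S)%SET V)) +
     2 * (1 + delta) ^+ 2 * pensum r p beta #|S| + (1 + delta) * G)).
Proof.
move=> n0 beta0 d01 cl0 lam1 lam_cl lam_in VV V0V0 V0k VV0 G0 Uu Ul Zu noise [VhVh red].
have lam_ge i : lam0 <= lam i by have /andP[] := lam_in i.
have nR : 0 < n%:R :> R by rewrite ltr0n.
have lam00 : 0 < lam0 := lt_le_trans ltr01 lam1.
have [d0 d1] := andP d01.
have [L [C [Q [a1 [a2 [svd Cu LE [La a2k Ha LU]]]]]]] :=
  svd_coordinates n0 cl0 lam1 lam_cl lam_ge V0V0 V0k VV0 Ul Zu.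
have x0E : Xdata V lam U Z + Zt = U *m Dmat lam *m V^T + (Z + Zt) by rewrite addrA.
have [LL _ _ _ _] := svd.
rewrite -x0E in svd LE; have [Th [Thmin ThVh]] := red _ _ _ svd Cu.
(* The regression form [Y = V *m A + E]: signal and noise of [X1], both multiplied by [L] and
   divided by [sqrt 2]. *)
pose A : 'M[R]_r := (Num.sqrt 2)^-1 *: (Dmat lam *m U^T *m L).
pose E : 'M[R]_(p, r) := (Num.sqrt 2)^-1 *: ((Z - Zt)^T *m L).
have DT : (Dmat lam)^T = Dmat lam by rewrite /Dmat tr_diag_mx.
have s2 : (Num.sqrt 2)^-1 ^+ 2 = 2^-1 :> R by rewrite exprVn sqr_sqrtr.
have YE : (Num.sqrt 2)^-1 *: ((Xdata V lam U Z - Zt)^T *m (Xdata V lam U Z + Zt) *m V0 *m Q *m invmx C) =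
    V *m A + E.
  rewrite -!mulmxA [V0 *m _]mulmxA [_ *m (V0 *m _ *m _)]mulmxA [_ *m (V0 *m Q)]mulmxA -LE.
  rewrite /A /E -scalemxAr -scalerDr; congr (_ *: _).
  rewrite !mulmxA -mulmxDl; congr (_ *m _).
  by rewrite /Xdata -addrA linearD/= !trmx_mul trmxK DT !mulmxA.
rewrite YE in Thmin.
have AT : A^T = (Num.sqrt 2)^-1 *: (L^T *m U *m Dmat lam).
  by rewrite /A linearZ/= !trmx_mul trmxK DT !mulmxA.
(* The signal strength, of order [n lam0]: it converts the error on [V *m A] into projection
   loss. *)
have Alow (y : 'cV[R]_r) : cl ^+ 2 * n%:R * lam0 / 8 * frob2 y <= frob2 (A^T *m y).
  have h1 := fnorm_Dmat_ge y (ltW lam00) lam_ge.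
  have h2 := LU (Dmat lam *m y).
  rewrite AT -scalemxAl frob2Z s2 -!mulmxA.
  have : (cl / 2 * Num.sqrt n%:R * (Num.sqrt lam0 * fnorm y)) ^+ 2 <=
      fnorm (L^T *m (U *m (Dmat lam *m y))) ^+ 2.
    rewrite lerXn2r ?nnegrE ?fnorm_ge0//.
      by rewrite !mulr_ge0 ?sqrtr_ge0 ?fnorm_ge0 ?(ltW cl0).
    by apply: le_trans h2; rewrite ler_wpM2l// !mulr_ge0 ?sqrtr_ge0 ?(ltW cl0).
  by rewrite !exprMn !sqr_fnorm !sqr_sqrtr// ?(ltW lam00)//; lra.
(* The same order from above, with [kappa]: it keeps the truncated part of [V *m A] comparable to
   [n lam0] times that of [V]. *)
have Aup (y : 'cV[R]_r) : frob2 (A^T *m y) <= 49 / 2 * n%:R * (kappa * lam0) * frob2 y.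
  have lam_in' i : 0 <= lam i <= kappa * lam0.
    by have /andP[l1 l2] := lam_in i; rewrite l2 (le_trans (ltW lam00)).
  have h1 := fnorm_Dmat_le y lam_in'.
  have h2 : frob2 (U *m (Dmat lam *m y)) <= 49 * n%:R * frob2 (Dmat lam *m y).
    have := Uu (Dmat lam *m y); rewrite fnorm_le ?mulr_ge0 ?sqrtr_ge0//.
    by rewrite exprMn sqr_sqrtr// -natrX.
  have h3 := frob2_isometryT (U *m (Dmat lam *m y)) LL.
  rewrite AT -scalemxAl frob2Z s2 -!mulmxA.
  have h4 := ler_wpM2l (ltW nR) h1; lra.
have s0 : 0 < cl ^+ 2 * n%:R * lam0 / 8 by rewrite divr_gt0// !mulr_gt0// exprn_gt0.
have l1 := frob2_projB_span VV VhVh s0 ThVh Alow.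
have noise' J : frob2 (rowres J E) <= (1 + delta) * pensum r p beta #|J| + G.
  rewrite /E rowresZ frob2Z s2 mulrC La; apply: noise => //.
  by rewrite -La.
have := oracle_inequality S beta0 d01 G0 Thmin noise'.
have tail : frob2 (rowres (~: S)%SET (V *m A)) <=
    49 / 2 * n%:R * (kappa * lam0) * frob2 (rowres (~: S)%SET V).
  by rewrite rowres_mulr; exact: frob2_mulr_le.
have c0 : 0 <= 2 + 2 / delta by rewrite addr_ge0// divr_ge0// ltW.
have := ler_wpM2l c0 tail; set b1 := (2 + 2 / delta) * frob2 _; set b2 := (2 + 2 / delta) * _.
move=> b12 orc; apply: (le_trans l1).
have -> : 2 / (cl ^+ 2 * n%:R * lam0 / 8) = 16 / (cl ^+ 2 * n%:R * lam0).
  by field; rewrite !gt_eqF.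
rewrite ler_wpM2l//; first by rewrite divr_ge0// !mulr_ge0 ?sqr_ge0// ltW.
rewrite -ler_pdivrMl ?divr_gt0// invf_div; apply: (le_trans orc); lra.
Qed.

Lemma hfun_bounds (R : realType) (lam : R) : 1 <= lam -> 0 < hfun lam <= lam.
Proof.
move=> l1; have l0 : 0 < lam by exact: lt_le_trans l1.
by rewrite /hfun divr_gt0 ?exprn_gt0 ?addr_gt0//= ler_pdivrMr ?addr_gt0//; nra.
Qed.

(** One has [n <= 2 e^(n/2)], and [hfun lam <= lam <= e^(n/2)] by the hypothesis on [ln lam];
    multiply. *)
Lemma expRN_le_nh (R : realType) (n : nat) (lam : R) : (0 < n)%N -> 1 <= lam ->
  2 * ln lam <= n%:R -> expR (- n%:R) <= 2 / (n%:R * hfun lam).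
Proof.
move=> n0 l1 ln_le; have /andP[h0 hl] := hfun_bounds l1.
have nR : 0 < n%:R :> R by rewrite ltr0n.
have nh0 : 0 < n%:R * hfun lam by exact: mulr_gt0.
have l0 : 0 < lam by exact: lt_le_trans l1.
have e : expR n%:R = expR (n%:R / 2) * expR (n%:R / 2) :> R by rewrite -expRD -splitr.
have h1 : n%:R <= 2 * expR (n%:R / 2) :> R by have := expR_ge1Dx (n%:R / 2 : R); lra.
have h2 : hfun lam <= expR (n%:R / 2).
  by apply: (le_trans hl); rewrite -[leLHS](lnK (x := lam)) ?posrE// ler_expR; lra.
rewrite ler_pdivlMr// expRN ler_pdivrMl ?expR_gt0// e.
have := ler_pM (ltW nR) (ltW h0) h1 h2; lra.
Qed.

Lemma loss_arith (R : realType) (k r n : nat) (beta delta kappa cl lam0 l h Cq Cc tail T X loss : R) :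
  (0 < n)%N -> 0 < delta -> 0 < beta -> 0 < cl -> 0 < kappa -> 0 < lam0 -> 0 < h <= lam0 ->
  0 < Cq -> 0 < Cc -> 0 <= X -> (r <= k)%N -> 0 <= l ->
  tail <= Cq * (k%:R * (r%:R + l) / (n%:R * h)) ->
  T <= 2 * (k%:R * r%:R) + 3 * beta * (k%:R * l) ->
  loss <= 16 / (cl ^+ 2 * n%:R * lam0) * (4 / delta *
    ((2 + 2 / delta) * (49 / 2 * n%:R * (kappa * lam0) * tail) +
     2 * (1 + delta) ^+ 2 * T + (1 + delta) * (Cc * (k%:R * l + ((r + k) * r)%:R + X)))) ->
  loss <= 64 / (cl ^+ 2 * delta) *
    ((2 + 2 / delta) * (49 / 2 * kappa * Cq) + 2 * (1 + delta) ^+ 2 * (2 + 3 * beta) +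
     2 * (1 + delta) * Cc) * (((r * k)%:R + k%:R * l + X) / (n%:R * h)).
Proof.
move=> n0 d0 b0 cl0 ka0 lam00 /andP[h0 hl] Cq0 Cc0 X0 rk l0 tailE TE lossE.
have nR : 0 < n%:R :> R by rewrite ltr0n.
have nh0 : 0 < n%:R * h by exact: mulr_gt0.
have nl0 : 0 < n%:R * lam0 by exact: mulr_gt0.
pose M : R := k%:R * r%:R + k%:R * l.
have kr0 : 0 <= k%:R * r%:R :> R by exact: mulr_ge0.
have kl0 : 0 <= k%:R * l by exact: mulr_ge0.
have M0 : 0 <= M by exact: addr_ge0.
have rk2 : ((r + k) * r)%:R <= 2 * (k%:R * r%:R) :> R.
  by rewrite -!natrM ler_nat mulnDl mul2n -addnn leq_add2r leq_mul2r rk orbT.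
pose c1 := (2 + 2 / delta) * (49 / 2 * kappa).
have c10 : 0 <= c1.
  apply: mulr_ge0; last by apply: mulr_ge0; [|exact: ltW].
  by apply: addr_ge0 => //; rewrite divr_ge0// ltW.
have inv_le : (n%:R * lam0)^-1 <= (n%:R * h)^-1.
  by rewrite lef_pV2 ?posrE// ler_wpM2l// ltW.
have c640 : 0 <= 64 / (cl ^+ 2 * delta).
  by rewrite divr_ge0// mulr_ge0 ?sqr_ge0// ltW.
pose B := 2 * (1 + delta) ^+ 2 * T + (1 + delta) * (Cc * (k%:R * l + ((r + k) * r)%:R + X)).
pose c2 := 2 * (1 + delta) ^+ 2 * (2 + 3 * beta) + 2 * (1 + delta) * Cc.
have d1 : 0 <= 1 + delta by lra.
have B1 : B <= c2 * (M + X).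
  have t1 : T <= (2 + 3 * beta) * (M + X).
    have q1 : 0 <= beta * (k%:R * r%:R) by rewrite mulr_ge0// ltW.
    have q2 : 0 <= beta * X by rewrite mulr_ge0// ltW.
    by rewrite /M; lra.
  have t2 : k%:R * l + ((r + k) * r)%:R + X <= 2 * (M + X) by rewrite /M; lra.
  rewrite /B /c2 [leRHS]mulrDl; apply: lerD.
    by rewrite -[leRHS]mulrA; apply: ler_wpM2l => //; apply: mulr_ge0 => //; exact: sqr_ge0.
  rewrite (_ : 2 * _ * _ * _ = (1 + delta) * (Cc * (2 * (M + X)))); last by ring.
  by rewrite !ler_wpM2l// ltW.
have B0 : 0 <= c2 * (M + X).
  have Cc0' := ltW Cc0; have b0' := ltW b0.
  apply: mulr_ge0; last exact: addr_ge0.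
  apply: addr_ge0; apply: mulr_ge0 => //; last exact: mulr_ge0.
    by apply: mulr_ge0 => //; exact: sqr_ge0.
  by apply: addr_ge0 => //; exact: mulr_ge0.
have step : loss <= 64 / (cl ^+ 2 * delta) * (c1 * tail + B / (n%:R * lam0)).
  apply: (le_trans lossE); rewrite /c1 /B; apply: eq_ler; field.
  by rewrite !gt_eqF.
apply: (le_trans step); rewrite -[leRHS]mulrA; apply: ler_wpM2l => //.
have tail1 : c1 * tail <= c1 * Cq * ((M + X) / (n%:R * h)).
  rewrite -mulrA ler_wpM2l//; apply: (le_trans tailE).
  rewrite ler_wpM2l ?(ltW Cq0)// ler_wpM2r ?invr_ge0 ?(ltW nh0)//.
  by rewrite mulrDr lerDl.
have tail2 : B / (n%:R * lam0) <= c2 * ((M + X) / (n%:R * h)).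
  rewrite mulrA; apply: le_trans (_ : c2 * (M + X) / (n%:R * lam0) <= _).
    by rewrite ler_wpM2r// invr_ge0 ltW.
  by rewrite ler_wpM2l.
have -> : (r * k)%:R + k%:R * l + X = M + X by rewrite /M natrM [r%:R * _]mulrC.
apply: (le_trans (lerD tail1 tail2)); apply: eq_ler; rewrite /c1 /c2; ring.
Qed.

Lemma integral_le_mix d (Omega : measurableType d) (R : realType) (P : probability Omega R)
    (f X X0 : Omega -> R) (A : set Omega) (a b c e1 e2 e3 : R) :
  measurable_fun setT f -> measurable_fun setT X -> measurable_fun setT X0 -> measurable A ->
  (forall w, 0 <= f w) -> (forall w, 0 <= X w) -> (forall w, 0 <= X0 w) ->
  0 <= a -> 0 <= b -> 0 <= c ->
  (forall w, f w <= a + b * X w + c * (X0 w + \1_(~` A) w)) ->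
  (\int[P]_w (X w)%:E <= e1%:E)%E -> (\int[P]_w (X0 w)%:E <= e2%:E)%E -> ((1 - e3)%:E <= P A)%E ->
  (\int[P]_w (f w)%:E <= (a + b * e1 + c * (e2 + e3))%:E)%E.
Proof.
move=> mf mX mX0 mA f0 X_0 X00 a0 b0 c0 fle iX iX0 PA.
have mC : measurable (~` A) by exact: measurableC.
have m1 : measurable_fun setT (\1_(~` A) : Omega -> R) by exact: measurable_indic.
have iA : (\int[P]_w (\1_(~` A) w)%:E <= e3%:E)%E.
  rewrite integral_indic// setIT [leLHS](_ : _ = (1 - P A)%E); last exact: probability_setC.
  rewrite leeBlDr ?fin_num_measure//; apply: le_trans (leeD2l e3%:E PA).
  by rewrite -EFinD lee_fin addrC subrK.
have i0 w : 0 <= \1_(~` A) w :> R by rewrite indicE.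
apply: (@le_trans _ _ (\int[P]_w (a + b * X w + c * (X0 w + \1_(~` A) w))%:E)%E).
  apply: ge0_le_integral => //.
  - by move=> w _; rewrite lee_fin.
  - exact/measurable_EFinP.
  - apply/measurable_EFinP; apply: measurable_funD.
      by apply: measurable_funD => //; apply: measurable_funM.
    by apply: measurable_funM => //; apply: measurable_funD.
  - by move=> w _; rewrite lee_fin.
under eq_integral do rewrite EFinD EFinD !EFinM EFinD.
rewrite ge0_integralD//; last 4 first.
- by move=> w _; rewrite -!EFinM -EFinD lee_fin addr_ge0// mulr_ge0.
- by apply: emeasurable_funD => //; apply/measurable_EFinP; apply: measurable_funM.
- by move=> w _; rewrite -EFinD -EFinM lee_fin mulr_ge0// addr_ge0.
- by under eq_fun do rewrite -EFinD -EFinM; apply/measurable_EFinP; apply: measurable_funM => //; exact: measurable_funD.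
rewrite ge0_integralD//; last 2 first.
- by move=> w _; rewrite -EFinM lee_fin mulr_ge0.
- by apply/measurable_EFinP; apply: measurable_funM.
rewrite [X in (X + _ + _)%E](_ : _ = a%:E); last first.
  rewrite (integral_cst P)// [X in (_ * X)%E](_ : _ = 1%E) ?mule1//.
  exact: probability_setT.
rewrite ge0_integralZl//; [|exact/measurable_EFinP|by move=> w _; rewrite lee_fin].
rewrite ge0_integralZl//; last 2 first.
- by under eq_fun do rewrite -EFinD; apply/measurable_EFinP; exact: measurable_funD.
- by move=> w _; rewrite -EFinD lee_fin addr_ge0.
rewrite ge0_integralD//; try by [move=> w _; rewrite lee_fin|exact/measurable_EFinP].
rewrite !EFinD !EFinM EFinD; apply: leeD; first apply: leeD => //.
  exact: lee_wpmul2l.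
by apply: lee_wpmul2l => //; exact: leeD.
Qed.

(** Restricted to its nonzero rows, [V] still has [r] orthonormal columns. *)
Lemma leq_supp_orthonormal (R : realType) p r (V : 'M[R]_(p, r)) :
  V^T *m V = 1%:M -> (r <= supp_card V)%N.
Proof.
move=> VV; rewrite supp_cardE.
apply: (@mulmx1_min _ _ _ ((selmx R (suppmx V))^T *m V)^T ((selmx R (suppmx V))^T *m V)).
by rewrite trmx_mul trmxK -mulmxA selmxK.
Qed.

(** Adds four deviation variables: both bounds for [U], and the sparse upper bound for each of [Z]
    and [Zt], whose sum has constant [14 = 7 + 7]. For [U] the support is all of its [r] columns,
    where [logep R r r = 1]. *)
Lemma good_noise (R : realType) (cl K : R) n p r k (mu : probability (cfg R (noise_idx n p r)) R) :
  (forall (I : finType) (mu : probability (cfg R I) R), gaussian_law mu ->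
    forall (n r : nat) (c : 'I_n -> 'I_r -> I), injective (fun e => c e.1 e.2) ->
    r%:R * K <= n%:R ->
    exists X : cfg R I -> R, [/\ measurable_fun setT X, forall x, 0 <= X x,
      (\int[mu]_x (X x)%:E <= (expR (- n%:R))%:E)%E &
      forall x, X x < 1 ->
        let G : 'M[R]_(n, r) := \matrix_(i, l) x (c i l) in
        (forall v : 'cV[R]_r, fnorm (G *m v) <= 7 * Num.sqrt n%:R * fnorm v) ->
        forall v : 'cV[R]_r, cl * Num.sqrt n%:R * fnorm v <= fnorm (G *m v)]) ->
  gaussian_law mu -> (0 < r <= k)%N -> (k <= p)%N -> 0 <= K ->
  (1 + ln 17 + K) * (k%:R * logep R p k) <= n%:R ->
  exists X : cfg R (noise_idx n p r) -> R, [/\ measurable_fun setT X, forall x, 0 <= X x,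
    (\int[mu]_x (X x)%:E <= (4 * expR (- n%:R))%:E)%E &
    forall x, X x < 1 -> [/\
      forall y : 'cV[R]_r, fnorm (sigU x *m y) <= 7 * Num.sqrt n%:R * fnorm y,
      forall y : 'cV[R]_r, cl * Num.sqrt n%:R * fnorm y <= fnorm (sigU x *m y) &
      forall v : 'cV[R]_p, (supp_card v <= k)%N ->
        fnorm ((sigZ x + sigT x) *m v) <= 14 * Num.sqrt n%:R * fnorm v]].
Proof.
move=> low gmu /andP[r0 rk] kp K0 kn.
have k0 : (0 < k)%N by exact: leq_trans rk.
have l1 : 1 <= logep R p k by rewrite logep_ge1// k0.
have ln0 : 0 <= ln 17 :> R by rewrite ln_ge0// ler1n.
have kl : k%:R <= k%:R * logep R p k by rewrite ler_peMr.
have rkR : r%:R <= k%:R :> R by rewrite ler_nat.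
have kl0 : 0 <= k%:R * logep R p k by exact: le_trans kl.
have kn1 : (1 + ln 17) * (k%:R * logep R p k) <= n%:R.
  by apply: le_trans kn; rewrite ler_wpM2r// lerDl.
have logrr : logep R r r = 1 by rewrite logepE ?r0//= addrK.
have kn2 : (1 + ln 17) * (r%:R * logep R r r) <= n%:R.
  apply: le_trans kn1; rewrite ler_wpM2l ?addr_ge0// logrr mulr1; exact: le_trans rkR kl.
have kn3 : r%:R * K <= n%:R.
  apply: le_trans kn; rewrite [leRHS]mulrDl mulrC; apply: ler_wpDl; first by rewrite mulr_ge0 ?addr_ge0.
  by rewrite ler_wpM2l// (le_trans rkR).
pose I := noise_idx n p r.
have [XU [mXU XU0 iXU XUP]] := @gaussian_opnorm_upper R I mu gmu n r r (fun i l => inl (i, l))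
  (ltac:(by move=> [? ?] [? ?] [-> ->])) (ltac:(by rewrite r0 leqnn)) kn2.
have [XL [mXL XL0 iXL XLP]] := low I mu gmu n r (fun i l => inl (i, l))
  (ltac:(by move=> [? ?] [? ?] [-> ->])) kn3.
have [XZ [mXZ XZ0 iXZ XZP]] := @gaussian_opnorm_upper R I mu gmu n p k (fun i l => inr (inl (i, l)))
  (ltac:(by move=> [? ?] [? ?] [-> ->])) (ltac:(by rewrite k0)) kn1.
have [XT [mXT XT0 iXT XTP]] := @gaussian_opnorm_upper R I mu gmu n p k (fun i l => inr (inr (i, l)))
  (ltac:(by move=> [? ?] [? ?] [-> ->])) (ltac:(by rewrite k0)) kn1.
exists (fun x => XU x + XL x + (XZ x + XT x)); split.
- by apply: measurable_funD; apply: measurable_funD.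
- by move=> x; rewrite !addr_ge0.
- under eq_integral do rewrite !EFinD.
  rewrite ge0_integralD//; last 4 first.
  + by move=> x _; rewrite -EFinD lee_fin addr_ge0.
  + by apply: emeasurable_funD; exact/measurable_EFinP.
  + by move=> x _; rewrite -EFinD lee_fin addr_ge0.
  + by apply: emeasurable_funD; exact/measurable_EFinP.
  rewrite !ge0_integralD//; try by [move=> x _; rewrite lee_fin|exact/measurable_EFinP].
  apply: le_trans (leeD (leeD iXU iXL) (leeD iXZ iXT)) _.
  by rewrite -!EFinD lee_fin; lra.
move=> x X1; have := XU0 x; have := XL0 x; have := XZ0 x; have := XT0 x => t0 z0 l0 u0.
have HU (y : 'cV[R]_r) : fnorm (sigU x *m y) <= 7 * Num.sqrt n%:R * fnorm y.
  apply: XUP; first lra.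
  by rewrite supp_cardE -[leqRHS]card_ord max_card.
split=> //; first by apply: XLP => //; lra.
move=> v vk; rewrite mulmxDl; apply: le_trans (fnormD _ _) _.
have hz : fnorm (sigZ x *m v) <= 7 * Num.sqrt n%:R * fnorm v by apply: XZP => //; lra.
have ht : fnorm (sigT x *m v) <= 7 * Num.sqrt n%:R * fnorm v by apply: XTP => //; lra.
lra.
Qed.

Theorem theorem7 (R : realType) (q beta delta kappa : R) :
  0 <= q < 2 -> 2 < beta -> 0 < delta < 1 -> 1 < kappa ->
  exists C0 : R, 0 < C0 /\
  forall C' : R, exists C : R, 0 < C /\
  forall (n p r : nat) (s lam0 : R),
  (1 <= r <= p)%N ->
  let k := kstar q s p r n lam0 in
  let nh := n%:R * hfun lam0 in
  C0 <= lam0 ->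
  C0 * Num.sqrt (ln n%:R / n%:R) <= lam0 ->
  C0 * k%:R * (r%:R + ln (expR 1 * p%:R / k%:R)) <= nh ->
  C0 * Num.max (k%:R * ln (expR 1 * p%:R / k%:R)) (ln lam0) <= n%:R ->
  forall (d : measure_display) (Omega : measurableType d)
         (P : probability Omega R)
         (U : Omega -> 'M[R]_(n, r)) (Z Zt : Omega -> 'M[R]_(n, p)),
  gauss_entries P U Z Zt ->
  let X0 V lam w := Xdata V lam (U w) (Z w) + Zt w in
  let X1 V lam w := Xdata V lam (U w) (Z w) - Zt w in
  forall (V0 : 'M[R]_(n, p) -> 'M[R]_(p, r)),
  (forall x, orthonormal_cols (V0 x)) ->
  (forall V lam, in_Theta q s kappa lam0 V lam ->
     forall i j, measurable_fun setT (fun w => V0 (X0 V lam w) i j)) ->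
  (forall V lam, in_Theta q s kappa lam0 V lam ->
     exists A : set Omega, measurable A /\
       A `<=` [set w | (supp_card (V0 (X0 V lam w)) <= k)%N /\
                       sigma_r_ge (V^T *m V0 (X0 V lam w)) (1 / 2)] /\
       ((1 - C' / nh)%:E <= P A)%E) ->
  forall (Vhat : 'M[R]_(n, p) -> 'M[R]_(n, p) -> 'M[R]_(p, r)),
  (forall x0 x1, reduction_output beta delta x0 x1 (V0 x0) (Vhat x0 x1)) ->
  (forall V lam, in_Theta q s kappa lam0 V lam ->
     forall i j, measurable_fun setT
                   (fun w => Vhat (X0 V lam w) (X1 V lam w) i j)) ->
  forall V lam, in_Theta q s kappa lam0 V lam ->
  (\int[P]_w (frob2 (Vhat (X0 V lam w) (X1 V lam w) *m (Vhat (X0 V lam w) (X1 V lam w))^T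
                      - V *m V^T))%:E
   <= (Num.min (2 * Num.min r%:R (p%:R - r%:R)) (C * Psi k p r n lam0))%:E)%E.

Proof.
move=> q02 b2 d01 ka1.
have [cl [K [cl0 K0 low]]] := gaussian_lower R.
have rho0 : 0 < 5 / cl by rewrite divr_gt0.
have [Cc [Cc0 chaos]] := chaos_bound b2 d01 rho0.
have [Cq Cq0 tail] := weak_lq_tail q02.
have [d0 d1] := andP d01.
have b0 : 0 < beta by lra.
have ka0 : 0 < kappa by lra.
have ln17 : 0 <= ln 17 :> R by rewrite ln_ge0// ler1n.
(* The [2] gives [lam0 > 1] and [2 * ln lam0 <= n]; the square gives [112 <= cl * sqrt lam0]; the
   last group is the sample size asked by [good_noise]. *)
pose C0 := 2 + (112 / cl) ^+ 2 + (1 + ln 17 + K).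
have sq0 := sqr_ge0 (112 / cl).
have C02 : 2 <= C0 by rewrite /C0; lra.
have C0cl : (112 / cl) ^+ 2 <= C0 by rewrite /C0; lra.
have C0K : 1 + ln 17 + K <= C0 by rewrite /C0; lra.
have C00 : 0 < C0 by lra.
clearbody C0; exists C0; split=> // C'.
pose c1 := 64 / (cl ^+ 2 * delta) *
    ((2 + 2 / delta) * (49 / 2 * kappa * Cq) + 2 * (1 + delta) ^+ 2 * (2 + 3 * beta) +
     2 * (1 + delta) * Cc).
have c10 : 0 < c1.
  have i1 : 0 < 2 / delta by rewrite divr_gt0.
  have i2 : 0 < kappa * Cq by exact: mulr_gt0.
  apply: mulr_gt0; first by rewrite divr_gt0// mulr_gt0// exprn_gt0.
  apply: addr_gt0; last by apply: mulr_gt0 => //; lra.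
  apply: addr_gt0; first by apply: mulr_gt0; [lra|rewrite -mulrA mulr_gt0].
  by apply: mulr_gt0; [apply: mulr_gt0 => //; apply: exprn_gt0; lra|lra].
have c1E : c1 = 64 / (cl ^+ 2 * delta) *
    ((2 + 2 / delta) * (49 / 2 * kappa * Cq) + 2 * (1 + delta) ^+ 2 * (2 + 3 * beta) +
     2 * (1 + delta) * Cc) by [].
clearbody c1.
(* The part with [c1] is the loss on the good event, with [Cc] bounding the mean of [Xi]; the rest
   is the loss [2 r] times the failure probability, [8] coming from the noise and [C'] from the
   initial estimator. *)
pose C := c1 * (1 + Cc) + 2 * (8 + `|C'|).
have C'0 : 0 <= `|C'| by exact: normr_ge0.
have C0' : 0 < C by rewrite ltr_pwDl ?mulr_gt0//; lra.
exists C; split=> // n p r s lam0 /andP[r1 rp] k nh hl _ _ hn d Omega P U Z Zt HG X0 X1.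
move=> V0 V0V0 mV0 HV0 Vhat red mVhat V lam HT.
have [lam00 lam_in _ VV Vs] := HT.
have l1 : 1 <= lam0 by lra.
have lnl0 : 0 < ln lam0 by rewrite ln_gt0; lra.
have hnl : C0 * ln lam0 <= n%:R.
  by apply: le_trans hn; rewrite ler_wpM2l ?(ltW C00)// le_max lexx orbT.
have hnk : C0 * (k%:R * logep R p k) <= n%:R.
  by apply: le_trans hn; rewrite ler_wpM2l ?(ltW C00)// le_max lexx.
have nR : 0 < n%:R :> R by apply: lt_le_trans hnl; rewrite mulr_gt0.
have n0 : (0 < n)%N by rewrite ltr0n in nR.
have h2l := hfun_bounds l1; have [h0 hl0] := andP h2l.
have nh0 : 0 < nh by exact: mulr_gt0.
have lam_cl : 112 <= cl * Num.sqrt lam0.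
  rewrite -ler_pdivrMl// mulrC -[leLHS]ger0_norm ?divr_ge0 ?(ltW cl0)// -sqrtr_sqr ler_wsqrtr//.
  exact: le_trans C0cl hl.
have n2 : 2 * ln lam0 <= n%:R by apply: le_trans hnl; rewrite ler_wpM2r// ltW.
have [kp [S Sk St]] := tail n p r s lam0 V (ltac:(by rewrite r1)) VV Vs nh0.
rewrite -/k -/nh in kp Sk St; have [k0 kp'] := andP kp.
have lk1 : 1 <= logep R p k by exact: logep_ge1.
pose M : R := (r * k)%:R + k%:R * logep R p k.
have PsiE : Psi k p r n lam0 = M / nh by [].
have kl0 : 0 <= k%:R * logep R p k by rewrite mulr_ge0// (le_trans ler01).
have k1R : 1 <= k%:R :> R by rewrite ler1n.
have Mr : r%:R <= M.
  apply: (@le_trans _ _ (r * k)%:R); last by rewrite lerDl.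
  by rewrite ler_nat leq_pmulr.
have M1 : 1 <= M by apply: le_trans Mr; rewrite ler1n.
pose f w := frob2 (Vhat (X0 V lam w) (X1 V lam w) *m (Vhat (X0 V lam w) (X1 V lam w))^T - V *m V^T).
have f_le w : f w <= 2 * Num.min r%:R (p%:R - r%:R).
  by apply: frob2_projB_le => //; exact: (red _ _).1.
have f2r w : f w <= 2 * r%:R.
  by apply: le_trans (f_le w) _; rewrite ler_wpM2l// ge_min lexx.
have f0 w : 0 <= f w by exact: frob2_ge0.
have mf : measurable_fun setT f.
  have mV : measurable_mx (fun w => Vhat (X0 V lam w) (X1 V lam w)) by exact: mVhat.
  apply: measurable_sum => i; apply: measurable_sum => j; apply: measurable_funX.
  apply: measurable_mxB; last exact: measurable_mx_cst.
  by apply: measurable_mxM => //; exact: measurable_mxT.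
have f_const B : 0 <= B -> (forall w, f w <= B) -> (\int[P]_w (f w)%:E <= B%:E)%E.
  move=> B0 fB; have z0 : (\int[P]_w (0 : R)%:E <= 0%:E)%E by rewrite integral0.
  have PT : ((1 - 0)%:E <= P setT)%E by rewrite subr0 probability_setT.
  apply: le_trans (integral_le_mix (X := cst 0) (X0 := cst 0) (a := B) (b := 0) (c := 0)
    mf _ _ measurableT f0 _ _ B0 _ _ _ z0 z0 PT) _ => //.
    by move=> w; rewrite !mul0r !addr0.
  by rewrite lee_fin !mul0r !addr0.
rewrite minEle; case: ifP => _.
  apply: f_const => //; rewrite mulr_ge0// le_min ler0n subr_ge0 ler_nat//.
rewrite PsiE.
have [A [mA [AP PA]]] := HV0 V lam HT.
(* If [k < r], no [r] orthonormal columns have only [k] nonzero rows, so [A] is empty and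
   [nh <= C']; the trivial bound [2 r] is then already of the required order. *)
have [rk|kr] := leqP r k; last first.
  have A0 : A = set0.
    apply/seteqP; split=> // w /AP[/= vk _].
    by have := leq_trans (leq_supp_orthonormal (V0V0 (X0 V lam w))) vk; rewrite leqNgt kr.
  move: PA; rewrite A0 measure0 lee_fin subr_le0 ler_pdivlMr// mul1r => C'nh.
  have C'n : nh <= `|C'| by apply: le_trans C'nh (ler_norm _).
  have B : 2 * r%:R <= C * (M / nh).
    have CC' : 2 * `|C'| <= C.
      by have := mulr_ge0 (ltW c10) (addr_ge0 ler01 (ltW Cc0)); rewrite /C; lra.
    rewrite mulrA ler_pdivlMr//; apply: le_trans (ler_wpM2r (le_trans ler01 M1) CC').
    by rewrite [leRHS]mulrAC -!mulrA ler_wpM2l// ler_pM// ltW.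
  apply: f_const; last by move=> w; exact: le_trans (f2r w) B.
  by apply: le_trans B; rewrite mulr_ge0.
have [mu [gmu muE]] := exists_gaussian_law HG.
have [Xi [mXi Xi0 iXi XiP]] := chaos n p r k mu gmu n0 r1 kp.
have rk' : (0 < r <= k)%N by rewrite r1.
have hnK : (1 + ln 17 + K) * (k%:R * logep R p k) <= n%:R.
  by apply: le_trans hnk; rewrite ler_wpM2r.
have [Y [mY Y0 iY YP]] := good_noise low gmu rk' kp' K0 hnK.
pose W := noise_map U Z Zt.
have mW : measurable_fun setT W := measurable_noise_map HG.
have intW (F : cfg R (noise_idx n p r) -> R) (e : R) : measurable_fun setT F ->
    (forall x, 0 <= F x) -> (\int[mu]_x (F x)%:E <= e%:E)%E ->
    (\int[P]_w (F (W w))%:E <= e%:E)%E.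
  move=> mF F0; rewrite -(muE (fun x => (F x)%:E))//; exact/measurable_EFinP.
have r2 : 0 <= 2 * r%:R :> R by rewrite mulr_ge0.
(* Where the noise or the initial estimator fails, the last factor is at least [1] and [2 r] bounds
   the loss; elsewhere the first two terms do. *)
have point w : f w <= c1 * (M / nh) + c1 / nh * Xi (W w) + 2 * r%:R * (Y (W w) + \1_(~` A) w).
  have Xi00 := Xi0 (W w).
  have Y00 := Y0 (W w).
  have rest0 : 0 <= c1 * (M / nh) + c1 / nh * Xi (W w).
    by rewrite addr_ge0// mulr_ge0 ?divr_ge0 ?(ltW c10) ?(ltW nh0)// (le_trans ler01).
  have i0 : 0 <= \1_(~` A) w :> R by rewrite indicE.
  have [Y1|Y1] := ltP (Y (W w)) 1; last first.
    apply: (le_trans (f2r w)); apply: ler_wpDl => //.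
    by rewrite ler_peMr// (le_trans Y1)// lerDl.
  have [Aw|nAw] := pselect (A w); last first.
    apply: (le_trans (f2r w)); apply: ler_wpDl => //.
    by rewrite ler_peMr// indicE mem_set// lerDr.
  apply: (@le_trans _ _ (c1 * (M / nh) + c1 / nh * Xi (W w))); last first.
    by rewrite lerDl mulr_ge0// addr_ge0.
  have [/= V0k V0s] := AP _ Aw.
  have [Uu Ul Zu] := YP _ Y1.
  rewrite noise_mapU in Uu Ul; rewrite noise_mapZ noise_mapT in Zu.
  pose G := Cc * (k%:R * logep R p k + ((r + k) * r)%:R + Xi (W w)).
  have G0 : 0 <= G by rewrite mulr_ge0 ?(ltW Cc0)// !addr_ge0.
  have noise (a1 : 'M[R]_r) (a2 : 'M[R]_(p, r)) (J : {set 'I_p}) : (supp_card a2 <= k)%N ->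
     (forall y : 'cV[R]_r, frob2 (a1 *m y) + frob2 (a2 *m y) <= (5 / cl) ^+ 2 / n%:R * frob2 y) ->
     let L := U w *m a1 + (Z w + Zt w) *m a2 in L^T *m L = 1%:M ->
     frob2 (rowres J ((Z w - Zt w)^T *m L)) / 2 <= (1 + delta) * pensum r p beta #|J| + G.
    move=> a2k Ha L LL; have := XiP (W w) a1 a2 J.
    by rewrite noise_mapU noise_mapZ noise_mapT; apply.
  have loss := reduction_loss S n0 b0 d01 cl0 l1 lam_cl lam_in VV (V0V0 _) V0k V0s G0 Uu Ul Zu noise
    (red (X0 V lam w) (X1 V lam w)).
  rewrite -/(f w) Sk in loss.
  have pu := pensum_upper r b0 kp.
  have := loss_arith n0 d0 b0 cl0 ka0 lam00 h2l Cq0 Cc0 Xi00 rk (le_trans ler01 lk1) St pu loss.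
  by rewrite -c1E -/nh -/M => h; apply: (le_trans h); apply: eq_ler; field; rewrite gt_eqF.
have e2 : (\int[P]_w (Y (W w))%:E <= (8 / nh)%:E)%E.
  apply: intW => //; apply: (le_trans iY); rewrite lee_fin.
  by have := expRN_le_nh n0 l1 n2; rewrite -/nh; lra.
have e1 := intW _ _ mXi Xi0 iXi.
apply: le_trans (integral_le_mix mf (measurableT_comp mXi mW) (measurableT_comp mY mW) mA f0
  (fun w => Xi0 (W w)) (fun w => Y0 (W w)) _ _ r2 point e1 e2 PA) _.
- by rewrite mulr_ge0 ?divr_ge0 ?(ltW c10) ?(ltW nh0)// (le_trans ler01).
- by rewrite divr_ge0 ?(ltW c10) ?(ltW nh0).
rewrite lee_fin.
have -> : c1 * (M / nh) + c1 / nh * Cc + 2 * r%:R * (8 / nh + C' / nh) =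
    (c1 * M + c1 * Cc + 2 * r%:R * (8 + C')) / nh by field; rewrite gt_eqF.
(* Everything is compared with [M / nh], using [1 <= M] for the mean of [Xi] and [r <= M] for the
   contribution of the bad event. *)
rewrite [C * _]mulrA; apply: ler_wpM2r; first by rewrite invr_ge0 ltW.
have h1 : c1 * Cc <= c1 * Cc * M by rewrite ler_peMr// mulr_ge0// ltW.
have C8 : 0 <= 8 + `|C'| by exact: addr_ge0.
have h2 : 2 * r%:R * (8 + C') <= 2 * r%:R * (8 + `|C'|).
  by rewrite ler_wpM2l// lerD2l ler_norm.
have h3 : r%:R * (8 + `|C'|) <= M * (8 + `|C'|) by exact: ler_wpM2r.
by rewrite /C; clear -h1 h2 h3; lra.
Qed.
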